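(* Let $\Sigma\setminus\{P_1,\dots,P_n\}$ be of class $C^2$ and $f\in C^p(\Sigma)$ with $p>0$. Then $$\|(\bar g-\bar g_M)(s)\|_\infty\le\frac{C}{M},\qquad\forall s\in[0,1],$$ where $C$ is a positive constant independent of $M$.
   Context: $D\subset\mathbb R^2$ is a simply connected bounded region with boundary $\Sigma$, twice continuously differentiable except for corners at $P_1,\dots,P_n$ with interior angles $(1-\chi_k)\pi$, $-1<\chi_k<1$, $\chi_k\neq0$. The function $f$ satisfies $\int_\Sigma f\,d\Sigma=0$, and $g(P)=\int_\Sigma f(Q)\log|P-Q|\,d\Sigma_Q$, $P\in\Sigma$. Decomposition into $3n$ sections: proceeding counterclockwise, for each $k$, $\Gamma_k,\Upsilon_k$ are two sufficiently small smooth arcs of $\Sigma$ meeting at $P_k$ and $C_k$ is the section connecting $\Upsilon_k$ and $\Gamma_{k+1}$ ($\Gamma_{n+1}=\Gamma_1$); $\Sigma_{3k-2}=\Gamma_k$, $\Sigma_{3k-1}=\Upsilon_k$, $\Sigma_{3k}=C_k$. Each $\Sigma_i$ has a parametrization $\sigma_i:[0,1]\to\Sigma_i$, $\sigma_i\in C^2([0,1])$, $|\sigma_i'|\ne0$. Put $\bar g=(\bar g_1,\dots,\bar g_{3n})$, $\bar g_i(s)=g(\sigma_i(s))$. For a vector function $F$, $\|F(s)\|_\infty=\max_i|F_i(s)|$. Decomposition into $n$ smooth arcs: $\tilde\Sigma_k$ is the arc of $\Sigma$ connecting $P_k$ with $P_{k+1}$ ($P_{n+1}=P_1$), with parametrization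 $\tilde\sigma_k\in C^2([0,1])$, $|\tilde\sigma_k'|\ne0$ on $[0,1]$. Let $\phi_k(t)=f(\tilde\sigma_k(t))|\tilde\sigma_k'(t)|$. For $i\in\{1,\dots,3n\}$ and $s\in[0,1]$ let $\ell\in\{1,\dots,n\}$ and $s_i\in[0,1]$ be such that $\sigma_i(s)=\tilde\sigma_\ell(s_i)$, so that $\bar g_i(s)=g(\tilde\sigma_\ell(s_i))$. Gauss–Legendre formula on $[0,1]$ with $M$ nodes: $\int_0^1F\approx\sum_{h=1}^M\lambda^L_{M,h}F(x^L_{M,h})$. Let $p_\nu$ be the orthonormal Legendre polynomial of degree $\nu$ on $[0,1]$, $c_\nu(s)=\int_0^1p_\nu(z)\log|z-s|\,dz$, and, with $eps$ denoting the machine precision, $$\delta_\ell(t,s)=\begin{cases}\log|\tilde\sigma_\ell'(t)|,&|t-s|<eps,\\ \log\dfrac{|\tilde\sigma_\ell(s)-\tilde\sigma_\ell(t)|}{|t-s|},&\text{otherwise}\end{cases}$$ (the first case is used as a numerical approximation of the second, to avoid cancellation, and with it one writes $\log|\tilde\sigma_\ell(s)-\tilde\sigma_\ell(t)|$ as $\log|t-s|+\delta_\ell(t,s)$). The approximation $\bar g_M=(\bar g_{M,1},\dots,\bar g_{M,3n})$ of $\bar g$ is $$\bar g_{M,i}(s)=\sum_{\substack{k=1\\k\ne\ell}}^n\sum_{h=1}^M\lambda^L_{M,h}\phi_k(x^L_{M,h})\log|\tilde\sigma_\ell(s_i)-\tilde\sigma_k(x^L_{M,h})|+\sum_{h=1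}^M\lambda^L_{M,h}\phi_\ell(x^L_{M,h})\Big(\sum_{\nu=0}^{M-1}c_\nu(s_i)p_\nu(x^L_{M,h})+\delta_\ell(x^L_{M,h},s_i)\Big).$$
   Formalization: For fixed eps > 0 the bound fails as M tends to infinity, since the first case of δ perturbs the limit; the formal theorem takes 0 ≤ eps ≤ 1/M with C independent of eps, where eps = 0 is the exact kernel for all M ≥ 1. *)

(* Defs.v *)
From HB Require Import structures.
From mathcomp Require Import all_boot all_order all_algebra.
From mathcomp Require Import all_classical all_reals all_analysis.

Set Implicit Arguments.
Unset Strict Implicit.
Unset Printing Implicit Defensive.

Import Order.TTheory GRing.Theory Num.Theory.
Import numFieldNormedType.Exports.

Local Open Scope classical_set_scope.
Local Open Scope ring_scope.

(* The plane is R * R.  Its canonical norm is the max norm, which gives the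
   right topology; lengths are taken with the Euclidean norm [enorm]. *)
Definition enorm {R : realType} (u : R * R) : R :=
  Num.sqrt (u.1 ^+ 2 + u.2 ^+ 2).

Definition rotate_by {R : realType} (theta : R) (u : R * R) : R * R :=
  (cos theta * u.1 - sin theta * u.2, sin theta * u.1 + cos theta * u.2).

(* Derivatives are taken relatively to [0, 1]: one-sided at 0 and at 1. *)
Definition diffquot01 {R : realType} (h : R -> R) (t u : R) : R :=
  (h u - h t) / (u - t).

Definition derivable01 {R : realType} (h : R -> R) (t : R) : Prop :=
  cvg (diffquot01 h t u @[u --> within `[0, 1] t^']).

Definition derive01 {R : realType} (h : R -> R) (t : R) : R :=
  lim (diffquot01 h t u @[u --> within `[0, 1] t^']).

Fixpoint C01 {R : realType} (m : nat) (h : R -> R) : Prop :=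
  {within `[0, 1], continuous h} /\
  (if m is m'.+1 then
     (forall t : R, t \in `[0, 1] -> derivable01 h t) /\ C01 m' (derive01 h)
   else True).

Definition dcurve {R : realType} (c : R -> R * R) (t : R) : R * R :=
  (derive01 (fun u => (c u).1) t, derive01 (fun u => (c u).2) t).

Definition speed {R : realType} (c : R -> R * R) (t : R) : R :=
  enorm (dcurve c t).

Definition regular_C2 {R : realType} (c : R -> R * R) : Prop :=
  [/\ C01 2 (fun t => (c t).1), C01 2 (fun t => (c t).2) &
      forall t : R, t \in `[0, 1] -> speed c t != 0].

Definition simply_connected {R : realType} (D : set (R * R)) : Prop :=
  connected D /\
  forall c : R -> R * R,
    {within `[0, 1], continuous c} -> c @` `[0, 1] `<=` D -> c 0 = c 1 ->
    exists H : R * R -> R * R,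
      [/\ {within `[0, 1] `*` `[0, 1], continuous H},
          H @` (`[0, 1] `*` `[0, 1]) `<=` D,
          (forall t : R, t \in `[0, 1] -> H (0, t) = c t),
          (exists a, forall t : R, t \in `[0, 1] -> H (1, t) = a) &
          (forall u : R, u \in `[0, 1] -> H (u, 0) = H (u, 1))].

Definition closed_curve {R : realType} (n : nat) (st : 'I_n -> R -> R * R) :
    set (R * R) :=
  \bigcup_(k in [set: 'I_n]) (st k @` `[0, 1]).

(* [st k] parametrizes the arc from P k to P (k + 1), indices being cyclic
   ([ordS], [ord_pred]).  In [corner_angle], the interior angle
   (1 - chi k) * pi at P k is measured counterclockwise from the outgoing
   tangent to the reversed incoming tangent; this is the angle inside D since
   the curve is run through with D on its left. *)
Record corner_domain {R : realType} (n : nat) (D : set (R * R))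
    (P : 'I_n -> R * R) (chi : 'I_n -> R) (st : 'I_n -> R -> R * R) : Prop :=
  CornerDomain {
    domain_open : open D;
    domain_nonempty : D !=set0;
    domain_bounded : bounded_set D;
    domain_simply_connected : simply_connected D;
    domain_boundary : closure D `\` D° = closed_curve st;
    arc_regular : forall k, regular_C2 (st k);
    arc_start : forall k, st k 0 = P k;
    arc_end : forall k, st k 1 = P (ordS k);
    arcs_simple : forall k k' (t t' : R), t \in `[0, 1[ -> t' \in `[0, 1[ ->
      st k t = st k' t' -> k = k' /\ t = t';
    arc_counterclockwise : forall k (t : R), t \in `]0, 1[ ->
      \forall e \near (0 : R)^'+,
        D (st k t + e *: rotate_by (pi / 2) (dcurve (st k) t));
    corner_range : forall k, -1 < chi k < 1 /\ chi k != 0;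
    corner_angle : forall k,
      let u := dcurve (st k) 0 in
      let v := - dcurve (st (ord_pred k)) 1 in
      (enorm v)^-1 *: v = rotate_by ((1 - chi k) * pi) ((enorm u)^-1 *: u)
  }.

Lemma section_arc_subproof n (i : 'I_(3 * n)) : (i %/ 3 < n)%N.
Proof. by rewrite ltn_divLR // [(n * 3)%N]mulnC. Qed.

Definition section_arc n (i : 'I_(3 * n)) : 'I_n :=
  Ordinal (section_arc_subproof i).

(* The cut points are st k (a k) and st k (b k).  For j = 0, 1, 2 the section
   of index 3 k + j is Gamma_k (the end of the arc reaching P k), Upsilon_k
   (the beginning of the arc leaving P k), and C_k. *)
Definition section_set {R : realType} (n : nat) (st : 'I_n -> R -> R * R)
    (a b : 'I_n -> R) (i : 'I_(3 * n)) : set (R * R) :=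
  let k := section_arc i in
  match (i %% 3)%N with
  | 0 => st (ord_pred k) @` `[b (ord_pred k), 1]
  | 1 => st k @` `[0, a k]
  | _ => st k @` `[a k, b k]
  end.

Definition section_decomposition {R : realType} (n : nat)
    (st : 'I_n -> R -> R * R) (sg : 'I_(3 * n) -> R -> R * R) : Prop :=
  exists a b : 'I_n -> R,
    (forall k, [/\ 0 < a k, a k < b k & b k < 1]) /\
    (forall i, regular_C2 (sg i) /\
               set_bij `[0, 1] (section_set st a b i) (sg i)).

(* [C_arc m c h]: h has continuous derivatives up to order m with respect to
   the arc length of c; h is a function of the parameter of c.  Thus C^p
   regularity on the curve does not depend on the parametrization, even when
   p exceeds the smoothness of the latter. *)
Fixpoint C_arc {R : realType} (m : nat) (c : R -> R * R) (h : R -> R) : Prop :=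
  {within `[0, 1], continuous h} /\
  (if m is m'.+1 then
     (forall t : R, t \in `[0, 1] -> derivable01 h t) /\
     C_arc m' c (fun t => derive01 h t / speed c t)
   else True).

(* At the corners f is continuous and its arc-length derivatives have
   one-sided limits; tangential derivatives of the two arcs meeting there
   are not required to agree (they do not, even for f linear on the plane). *)
Definition C_boundary {R : realType} (n : nat) (st : 'I_n -> R -> R * R)
    (p : nat) (f : R * R -> R) : Prop :=
  {within closed_curve st, continuous f} /\
  forall k, C_arc p (st k) (f \o st k).

Definition boundary_integral {R : realType} (n : nat)
    (st : 'I_n -> R -> R * R) (F : R * R -> R) : R :=
  \sum_(k < n)
    \int[lebesgue_measure]_(t in `[0, 1]) (F (st k t) * speed (st k) t).

Definition log_potential {R : realType} (n : nat) (st : 'I_n -> R -> R * R)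
    (f : R * R -> R) (P : R * R) : R :=
  boundary_integral st (fun Q => f Q * ln (enorm (P - Q))).

Definition orthonormal_legendre {R : realType} (leg : nat -> {poly R}) : Prop :=
  (forall nu, size (leg nu) = nu.+1 /\ 0 < lead_coef (leg nu)) /\
  (forall mu nu,
    \int[lebesgue_measure]_(z in `[0, 1]) ((leg mu).[z] * (leg nu).[z]) =
    (mu == nu)%:R).

(* The nodes are the M zeros of the Legendre polynomial of degree M, the rule
   is interpolatory. *)
Definition gauss_legendre {R : realType} (leg : nat -> {poly R}) (M : nat)
    (x lam : 'I_M -> R) : Prop :=
  [/\ injective x,
      forall h, root (leg M) (x h) &
      forall h, lam h = \int[lebesgue_measure]_(z in `[0, 1])
        \prod_(j < M | j != h) ((z - x j) / (x h - x j))].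

Definition log_moment {R : realType} (leg : nat -> {poly R}) (nu : nat)
    (s : R) : R :=
  \int[lebesgue_measure]_(z in `[0, 1]) ((leg nu).[z] * ln `|z - s|).

(* For eps > 0 the test t == s is redundant.  For eps = 0 this is the exact
   kernel, ln |c s - c t| - ln |t - s| continued by ln |c' t| at t = s. *)
Definition delta {R : realType} (eps : R) (c : R -> R * R) (t s : R) : R :=
  if (t == s) || (`|t - s| < eps) then ln (speed c t)
  else ln (enorm (c s - c t) / `|t - s|).

Definition density {R : realType} (f : R * R -> R) (c : R -> R * R) (t : R) :
    R :=
  f (c t) * speed c t.

Definition gbar {R : realType} (n : nat) (st : 'I_n -> R -> R * R)
    (sg : 'I_(3 * n) -> R -> R * R) (f : R * R -> R) (i : 'I_(3 * n)) (s : R) :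
    R :=
  log_potential st f (sg i s).

Definition gbar_approx {R : realType} (n : nat) (st : 'I_n -> R -> R * R)
    (f : R * R -> R) (leg : nat -> {poly R}) (eps : R) (M : nat)
    (x lam : 'I_M -> R) (ell : 'I_(3 * n) -> R -> 'I_n)
    (si : 'I_(3 * n) -> R -> R) (i : 'I_(3 * n)) (s : R) : R :=
  let l := ell i s in
  \sum_(k < n | k != l) \sum_(h < M)
    lam h * density f (st k) (x h) * ln (enorm (st l (si i s) - st k (x h)))
  + \sum_(h < M) lam h * density f (st l) (x h) *
      (\sum_(nu < M) log_moment leg nu (si i s) * (leg nu).[x h]
       + delta eps (st l) (x h) (si i s)).

Definition supnorm {R : realType} (m : nat) (v : 'I_m -> R) : R :=
  \big[Num.max/0]_(i < m) `|v i|.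

(* Main.v *)
(* The error is a finite sum of errors over the arcs, on which the integrand is at
   worst logarithmically singular.

   On an arc k, distances to a point st l y of the boundary are bounded below by a multiple of
   t (1 - t), times |y - t| when k = l: by compactness this is local, and at a corner it holds
   since the two tangents do not have the same direction, the interior angle being neither 0
   nor 2 pi.  So off the diagonal the integrand is phi * ln E, with phi and E Lipschitz and E
   vanishing at most to first order at the two ends.  On the diagonal ln |st l y - st l t| is
   ln |t - y|, treated by the product rule, plus ln E for the chord quotient E, which is
   bounded below in the same way; replacing ln E by delta costs O(eps).

   A function F with |F t - F t'| <= A |ln t - ln t'| is approximated within
   O(A / (M sqrt t)) by polynomials of degree < M, by Jackson's theorem for F (v^2) with a
   kernel built from Chebyshev polynomials.  A Gauss rule is exact on these polynomials and
   satisfies sum_h lam h / sqrt (x h) = O(1), because Hermite interpolation bounds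
   sum_h lam h / (x h + a) by ln (1 + 1/a) for every a > 0.  Functions phi * ln E are split
   into two such functions, one for each end.  In the product rule the truncated Legendre
   series S of ln |t - y| is paired exactly with polynomials of degree < M; replacing phi by
   a polynomial at distance O(1/M) costs O(1/M) since Bessel's inequality bounds
   sum_h lam h S(x h)^2 = int S^2. *)

From HB Require Import structures.
Require Import Defs.
From mathcomp Require Import all_boot all_order all_algebra.
From mathcomp Require Import all_classical all_reals all_analysis.
From mathcomp Require Import measurable_realfun.
From mathcomp Require Import ring lra zify.
Import Order.TTheory GRing.Theory Num.Theory.
Import numFieldNormedType.Exports.
Set Implicit Arguments.
Unset Strict Implicit.
Unset Printing Implicit Defensive.
Local Open Scope classical_set_scope.
Local Open Scope ring_scope.

(** The logarithms are unbounded, so no polynomial is uniformly close to them, and the rate 1/M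
    needs a weighted estimate: 1 / sqrt t is integrable and has bounded Gauss sums, so an error A /
    (M sqrt t) is harmless on both sides. The variable v = sqrt t yields exactly this weight. Degree
    M in t is degree 2 M in v, evenness in v removes the end 0, and a function that varies like ln t
    = 2 ln v has slope of the order of 1/v, which a kernel of width 1/M turns into an error 1 / (M
    v).

    The second obstacle is uniformity in the evaluation point, which may approach a corner. All that
    is needed of an arc is therefore packed into one natural number K ([log_weight]), found by
    compactness on pairs of parameters. The O(eps) cost of [delta] is of the right order because eps
    <= 1/M. *)

(* Locked, for conversion must not look inside the integral. *)
HB.lock Definition pint (R : realType) (a b : R) (p : {poly R}) : R :=
  \int[lebesgue_measure]_(t in `[a, b]) p.[t].
Canonical pint_unlockable := Unlockable pint.unlock.
Arguments pint {R} a b p.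

(** * Integrals of polynomials *)

Section PolynomialIntegrals.
Context {R : realType}.
Implicit Types (a b : R) (p q : {poly R}).
Local Notation mu := (@lebesgue_measure R).

Lemma is_derive_horner p (x : R) : is_derive x 1 (horner p) p^`().[x].
Proof. by apply: DeriveDef; [exact: derivable_horner | rewrite -derive1E -derivE]. Qed.

Lemma continuous_horner_poly p : continuous (horner p : R -> R).
Proof.
move=> x; apply: differentiable_continuous; apply/derivable1_diffP.
exact: derivable_horner.
Qed.

Lemma integrable_continuous (f : R -> R) a b :
  continuous f -> mu.-integrable `[a, b] (EFin \o f).
Proof.
move=> cf; apply: continuous_compact_integrable; first exact: segment_compact.
exact: continuous_subspaceT.
Qed.

Lemma ler_of_derive (f g df dg : R -> R) a b : a <= b ->
  (forall x : R, a <= x <= b -> is_derive x 1 f (df x)) ->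
  (forall x : R, a <= x <= b -> is_derive x 1 g (dg x)) ->
  (forall x : R, a <= x <= b -> df x <= dg x) ->
  f b - f a <= g b - g a.
Proof.
move=> ab Df Dg le.
have D x : a <= x <= b -> is_derive x 1 (fun t => g t - f t) (dg x - df x).
  by move=> h; have ? := Df _ h; have ? := Dg _ h; exact: is_deriveB.
suff : (fun t => g t - f t) a <= (fun t => g t - f t) b by move=> /= h; lra.
apply: (@ger0_derive1_le_cc R (fun t => g t - f t) a b); rewrite ?in_itv/= ?lexx ?ab//.
- move=> x; rewrite in_itv/= => /andP[/ltW ax /ltW xb].
  by have /D[] : a <= x <= b by rewrite ax xb.
- move=> x; rewrite in_itv/= => /andP[/ltW ax /ltW xb].
  have h : a <= x <= b by rewrite ax xb.
  by have ? := D _ h; rewrite derive1E derive_val subr_ge0 le.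
- apply: derivable_within_continuous => x; rewrite in_itv/= => h.
  by have [] := D _ h.
Qed.

Definition pprim p : {poly R} :=
  \poly_(i < (size p).+1) (if i is j.+1 then p`_j / j.+1%:R else 0).

Lemma deriv_pprim p : (pprim p)^`() = p.
Proof.
apply/polyP => i; rewrite coef_deriv coef_poly ltnS.
case: ltnP => [ip|pi]; last by rewrite mul0rn nth_default.
by rewrite -[LHS]mulr_natr divfK// pnatr_eq0.
Qed.

Lemma pintI a b p : pint a b p = \int[mu]_(t in `[a, b]) p.[t].
Proof. by rewrite unlock. Qed.

Lemma pintE a b p : a <= b -> pint a b p^`() = p.[b] - p.[a].
Proof.
rewrite pintI le_eqVlt => /predU1P[->|ab].
  by rewrite set_itv1 Rintegral_set1 subrr.
rewrite /Rintegral (@continuous_FTC2 R _ (horner p)) //.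
- exact/continuous_subspaceT/continuous_horner_poly.
- split.
  + by move=> x _; exact: derivable_horner.
  + by apply: cvg_at_right_filter; exact: continuous_horner_poly.
  + by apply: cvg_at_left_filter; exact: continuous_horner_poly.
- by move=> x _; rewrite -derivE.
Qed.

Lemma pint_is_linear a b c p q : pint a b (c *: p + q) = c * pint a b p + pint a b q.
Proof.
rewrite !pintI.
under eq_Rintegral do rewrite hornerD hornerZ.
have h r : continuous (horner r : R -> R) by exact: continuous_horner_poly.
rewrite RintegralD ?RintegralZl//; try exact: integrable_continuous.
by apply: integrable_continuous => x; apply: cvgZr; exact: h.
Qed.

Lemma pint0 a b : pint a b 0 = 0.
Proof. by have := pint_is_linear a b (-1) 0 0; rewrite scaler0 addr0 mulN1r addNr. Qed.

Lemma pintD a b p q : pint a b (p + q) = pint a b p + pint a b q.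
Proof. by have := pint_is_linear a b 1 p q; rewrite scale1r mul1r. Qed.

Lemma pintZ a b c p : pint a b (c *: p) = c * pint a b p.
Proof. by have := pint_is_linear a b c p 0; rewrite !addr0 pint0 addr0. Qed.

Lemma pintB a b p q : pint a b (p - q) = pint a b p - pint a b q.
Proof. by rewrite pintD -scaleN1r pintZ mulN1r. Qed.

Lemma pint_sum a b (I : Type) (r : seq I) (F : I -> {poly R}) :
  pint a b (\sum_(i <- r) F i) = \sum_(i <- r) pint a b (F i).
Proof. by elim/big_rec2: _ => [|i y z _ <-]; rewrite (pint0, pintD). Qed.

Lemma pint_ge0 a b p : (forall x : R, a <= x <= b -> 0 <= p.[x]) -> 0 <= pint a b p.
Proof. by move=> p0; rewrite pintI; apply: Rintegral_ge0 => x /=; rewrite in_itv; exact: p0. Qed.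

Lemma ler_pint a b p q :
  (forall x : R, a <= x <= b -> p.[x] <= q.[x]) -> pint a b p <= pint a b q.
Proof.
move=> pq; rewrite -subr_ge0 -pintB; apply: pint_ge0 => x h.
by rewrite hornerD hornerN subr_ge0 pq.
Qed.

Lemma pintC a b c : a <= b -> pint a b c%:P = c * (b - a).
Proof.
move=> ab; rewrite (_ : c%:P = (c *: 'X)^`()); last by rewrite derivZ derivX alg_polyC.
by rewrite pintE// !hornerZ !hornerX mulrBr.
Qed.

Lemma pint_le_primitive a b p (g dg : R -> R) : a <= b ->
  (forall x : R, a <= x <= b -> is_derive x 1 g (dg x)) ->
  (forall x : R, a <= x <= b -> p.[x] <= dg x) -> pint a b p <= g b - g a.
Proof.
move=> ab Dg le; rewrite -{1}[p]deriv_pprim pintE//.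
apply: ler_of_derive Dg le => // x _.
by rewrite -{2}[p]deriv_pprim; exact: is_derive_horner.
Qed.

Lemma pint_cat a b c p : a <= b -> b <= c -> pint a c p = pint a b p + pint b c p.
Proof.
move=> ab bc; rewrite -[p]deriv_pprim !pintE ?(le_trans ab bc)//; ring.
Qed.

Lemma pint_subset a b c d p : a <= c -> c <= d -> d <= b ->
  (forall x : R, a <= x <= b -> 0 <= p.[x]) -> pint c d p <= pint a b p.
Proof.
move=> ac cd db p0.
rewrite (@pint_cat a c b) ?(le_trans cd)// (@pint_cat c d b)//.
have h1 : 0 <= pint a c p by apply: pint_ge0 => x h; apply: p0; lra.
have h2 : 0 <= pint d b p by apply: pint_ge0 => x h; apply: p0; lra.
lra.
Qed.

(* The substitution u = v - t. *)
Lemma pint_comp_subl a b v p : a <= b ->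
  pint a b (p \Po (v%:P - 'X)) = pint (v - b) (v - a) p.
Proof.
move=> ab; have vab : v - b <= v - a by lra.
rewrite -[p]deriv_pprim; set P := pprim p.
have -> : P^`() \Po (v%:P - 'X) = (- (P \Po (v%:P - 'X)))^`().
  by rewrite derivN deriv_comp derivB derivC derivX sub0r mulrN1 opprK.
by rewrite !pintE// !hornerN !horner_comp !hornerE; ring.
Qed.

(* A nonzero polynomial has finitely many roots, so it is positive on some subinterval. *)
Lemma pint_eq0 p : (forall x : R, 0 <= x <= 1 -> 0 <= p.[x]) -> pint 0 1 p = 0 -> p = 0.
Proof.
move=> p0 Ip; set P := pprim p.
(* The integrals over [0, x] and [x, 1] are nonnegative and add up to 0, so the primitive [P] keeps
   its value at 0. *)
have cst x : 0 <= x <= 1 -> root (P - P.[0]%:P) x.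
  move=> /andP[x0 x1].
  have h1 : 0 <= pint 0 x p by apply: pint_ge0 => y hy; apply: p0; lra.
  have h2 : 0 <= pint x 1 p by apply: pint_ge0 => y hy; apply: p0; lra.
  have := Ip; rewrite (@pint_cat 0 x 1)// => h3.
  have : pint 0 x p = 0 by lra.
  by rewrite -[p]deriv_pprim pintE// => h4; rewrite /root !hornerE; apply/eqP.
suff /eqP : P - P.[0]%:P == 0.
  by rewrite -[p]deriv_pprim -/P => /eqP; rewrite subr_eq0 => /eqP ->; rewrite derivC.
apply: contraT => nz.
(* The points 1 / (i + 1) give more roots than the size allows. *)
pose s := [seq i.+1%:R^-1 : R | i <- iota 0 (size (P - P.[0]%:P)).+1].
have := max_poly_roots nz (rs := s); rewrite size_map size_iota ltnNge ltnW//.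
apply.
  apply/allP => _ /mapP[i _ ->]; apply: cst.
  by rewrite invr_ge0 ler0n/= invf_le1 ?ltr0n// ler1n.
rewrite map_inj_uniq ?iota_uniq// => i j /invr_inj /eqP.
by rewrite eqr_nat => /eqP[].
Qed.

End PolynomialIntegrals.

(** * Jackson approximation *)

Section JacksonKernel.
Context {R : realType}.

Lemma ler_sqr_norm (x y : R) : (x ^+ 2 <= y ^+ 2) = (`|x| <= `|y|).
Proof. by rewrite -[x ^+ 2]real_normK ?num_real// -[y ^+ 2]real_normK ?num_real// ler_pXn2r ?nnegrE. Qed.

(** Both components are advanced by a rotation through 2a, with cos 2a = 1 - 2 t^2; carrying the
    sine and the cosine part together keeps the recursion polynomial in t. The first component is a
    Dirichlet kernel, with peak 2m + 1 at t = 0. *)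
Fixpoint peak (m : nat) : {poly R} * {poly R} :=
  if m is m'.+1 then
    let: (W, V) := peak m' in
    ((1 - 2 *: 'X^2) * W + 2 *: ((1 - 'X^2) * V),
     (1 - 2 *: 'X^2) * V - 2 *: ('X^2 * W))
  else (1, 1).

Lemma peakS1 m (t : R) : (peak m.+1).1.[t] =
  (1 - 2 * t ^+ 2) * (peak m).1.[t] + 2 * ((1 - t ^+ 2) * (peak m).2.[t]).
Proof. by rewrite /=; case: (peak m) => W V /=; rewrite !hornerE. Qed.

Lemma peakS2 m (t : R) : (peak m.+1).2.[t] =
  (1 - 2 * t ^+ 2) * (peak m).2.[t] - 2 * (t ^+ 2 * (peak m).1.[t]).
Proof. by rewrite /=; case: (peak m) => W V /=; rewrite !hornerE. Qed.

Let horner1 (t : R) : (1 : {poly R}).[t] = 1.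
Proof. by rewrite hornerE. Qed.

Lemma size_peak m :
  (size (peak m).1 <= (2 * m).+1)%N /\ (size (peak m).2 <= (2 * m).+1)%N.
Proof.
elim: m => [|m] /=; first by rewrite size_poly1.
case: (peak m) => W V /= [sW sV].
have sX2 : (size ('X^2 : {poly R}) <= 3)%N by rewrite size_polyXn.
have sa : (size (1 - 2 *: 'X^2 : {poly R})%R <= 3)%N.
  rewrite (leq_trans (size_polyD _ _))// geq_max size_poly1 size_polyN/=.
  exact: leq_trans (size_scale_leq _ _) sX2.
have sb : (size (1 - 'X^2 : {poly R})%R <= 3)%N.
  by rewrite (leq_trans (size_polyD _ _))// geq_max size_poly1 size_polyN.
have M (p q : {poly R}) : (size p <= 3)%N -> (size q <= (2 * m).+1)%N ->
    (size (p * q)%R <= (2 * m.+1).+1)%N.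
  move=> sp sq; rewrite (leq_trans (size_polyMleq _ _))//.
  by rewrite mulnS; move: sp sq; case: (size p) => [|[|[|[|]]]] //; lia.
split; rewrite (leq_trans (size_polyD _ _))// geq_max ?size_polyN.
  by rewrite M//= (leq_trans (size_scale_leq _ _))// M.
by rewrite M//= (leq_trans (size_scale_leq _ _))// M.
Qed.

(* With t = sin a, (peak m).1.[t] = sin ((2m+1)a) / sin a and
   (peak m).2.[t] = cos ((2m+1)a) / cos a. *)
Lemma peak_pell m (t : R) :
  t ^+ 2 * (peak m).1.[t] ^+ 2 + (1 - t ^+ 2) * (peak m).2.[t] ^+ 2 = 1.
Proof.
elim: m => [|m IH]; first by rewrite /= !horner1; ring.
by rewrite peakS1 peakS2 -[RHS]IH; ring.
Qed.

Lemma peak_le m (t : R) : t ^+ 2 <= 1 -> `|(peak m).1.[t]| <= (2 * m).+1%:R.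
Proof.
move=> t1; elim: m => [|m IH]; first by rewrite /= hornerE normr1.
have := peak_pell m t; move: IH; rewrite peakS1.
set w := (peak m).1.[t]; set v := (peak m).2.[t] => IH pell.
(* For t = sin a this is cos ((2m+2) a), and the recursion adds 2 e to w. *)
set e := (1 - t ^+ 2) * v - t ^+ 2 * w.
have e1 : e ^+ 2 <= 1.
  rewrite -subr_ge0 (_ : _ - _ = t ^+ 2 * (1 - t ^+ 2) * (w + v) ^+ 2).
    by apply: mulr_ge0 (sqr_ge0 _); apply: mulr_ge0 (sqr_ge0 _) _; rewrite subr_ge0.
  rewrite -{1}(mulr1 1) -{1}pell /e.
  rewrite [in LHS](_ : 1 = t ^+ 2 + (1 - t ^+ 2)); last by ring.
  ring.
have {}e1 : `|e| <= 1 by rewrite -(@ler_pXn2r _ 2) ?nnegrE// real_normK ?num_real// expr1n.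
rewrite (_ : _ + _ = w + 2 * e); last by rewrite /e; ring.
rewrite (le_trans (ler_normD _ _))// normrM ger0_norm//.
have -> : (2 * m.+1).+1%:R = (2 * m).+1%:R + 2 :> R by rewrite -natrD; congr _%:R; lia.
lra.
Qed.

(** The condition t^2 <= 1/2 keeps 1 - t^2 away from 0, so that [peak_pell] bounds the second
    component by 2. Induction gives the bound 1 - N^2 t^2 for the second component, and from it the
    bound for the first. *)
Lemma peak_ge m (t : R) : t ^+ 2 <= 1 / 2 ->
  (2 * m).+1%:R * (1 - (2 * m).+1%:R ^+ 2 * t ^+ 2) <= (peak m).1.[t].
Proof.
move=> t1; have t0 := sqr_ge0 t.
have v2 k : `|(peak k).2.[t]| <= 2.
  rewrite -(@ler_pXn2r _ 2) ?nnegrE// real_normK ?num_real//.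
  have := peak_pell k t; set w := _.[_]; set v := _.[_].
  have := mulr_ge0 t0 (sqr_ge0 w); have := sqr_ge0 v; nra.
have tle : t ^+ 2 <= 1 by lra.
have v_ge k : 1 - (2 * k).+1%:R ^+ 2 * t ^+ 2 <= (peak k).2.[t].
  elim: k => [|k IH]; first by rewrite /= horner1 muln0; lra.
  have := peak_le k tle; have := v2 k; rewrite peakS2 !ler_norml.
  have -> : (2 * k.+1).+1%:R = (2 * k).+1%:R + 2 :> R by rewrite -natrD; congr _%:R; lia.
  have N0 : 1 <= (2 * k).+1%:R :> R by rewrite ler1n.
  move: IH N0; set N := _%:R; set v := (peak k).2.[t]; set w := (peak k).1.[t] => IH N0 hv hw.
  have : t ^+ 2 * v <= t ^+ 2 * 2 by apply: ler_wpM2l => //; lra.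
  have : t ^+ 2 * w <= t ^+ 2 * N by apply: ler_wpM2l => //; lra.
  have : 0 <= t ^+ 2 * (N - 1) by apply: mulr_ge0 => //; lra.
  nra.
elim: m => [|k IH]; first by rewrite /= horner1 muln0; lra.
have := peak_le k tle; have := v2 k; have := v_ge k; rewrite peakS1 !ler_norml.
have -> : (2 * k.+1).+1%:R = (2 * k).+1%:R + 2 :> R by rewrite -natrD; congr _%:R; lia.
have N0 : 1 <= (2 * k).+1%:R :> R by rewrite ler1n.
move: IH N0; set N := _%:R; set w := _.[_]; set v := _.[_] => IH N0 hv2 hv hw.
have h1 : t ^+ 2 * v <= t ^+ 2 * 2 by apply: ler_wpM2l => //; lra.
have h2 : t ^+ 2 * w <= t ^+ 2 * N by apply: ler_wpM2l => //; lra.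
have h3 : 0 <= t ^+ 2 * (N - 1) by apply: mulr_ge0 => //; lra.
have h4 : 0 <= t ^+ 2 * (N ^+ 2) by apply: mulr_ge0 => //; rewrite sqr_ge0.
have -> : (N + 2) * (1 - (N + 2) ^+ 2 * t ^+ 2) = N * (1 - N ^+ 2 * t ^+ 2) + 2
   - 6 * (t ^+ 2 * N ^+ 2) - 12 * (t ^+ 2 * N) - 8 * t ^+ 2 by ring.
lra.
Qed.

Lemma is_derive_atan_scale (c a t : R) :
  is_derive t 1 (fun t => c * atan (a * t)) (c * (a / (1 + (a * t) ^+ 2))).
Proof.
have h : is_derive t 1 (fun t => a * t) (a * 1) by exact: is_deriveZ.
have h2 := @is_derive1_comp R (@atan R) (fun t => a * t) t _ _ (is_derive1_atan _) h.
have := @is_deriveZ _ _ _ _ c _ _ _ h2.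
by rewrite mulr1 [_^-1 * a]mulrC.
Qed.

(** The fourth power of the normalized peak, scaled to [-3, 3], where the differences of points of
    [-1, 1] and [-2, 2] lie. It has a second moment of the order of 1/N^3 against a mass of the
    order of 1/N. The quotient (54 pi / N^3) / (3 / (4 N)) is 72 pi / N^2, and M <= 4 N. *)
Lemma jackson_kernel : exists2 C : R, 0 <= C & forall M, (0 < M)%N ->
  exists K : {poly R}, [/\ (size K <= (2 * M).-1)%N,
    forall t : R, - 3 <= t <= 3 -> 0 <= K.[t], pint (- 3) 3 K = 1 &
    pint (- 3) 3 ('X^2 * K) <= C / M%:R ^+ 2].
Proof.
exists (4 ^+ 2 * (72 * pi)).
  by apply: mulr_ge0; [exact: sqr_ge0 | apply: mulr_ge0; [exact: ler0n | exact: pi_ge0]].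
(* The kernel has degree at most 8 m <= 2 M - 2, so that the even part of a convolution with it has
   size at most M. *)
move=> M M0; set m := (M.-1 %/ 4)%N; set N : R := (2 * m).+1%:R.
have N1 : 1 <= N by rewrite ler1n.
have Ngt0 : 0 < N by lra.
have NE : N = (2 * m).+1%:R by [].
have MN : M%:R <= 4 * N by rewrite -natrM ler_nat; lia.
clearbody N.
pose w : {poly R} := (N^-1 *: (peak m).1) \Po (3^-1 *: 'X).
have wE (t : R) : w.[t] = N^-1 * (peak m).1.[t / 3].
  by rewrite horner_comp !hornerZ hornerX [3^-1 * t]mulrC.
pose K0 : {poly R} := w ^+ 4.
have K0E (t : R) : K0.[t] = w.[t] ^+ 4 by rewrite horner_exp.
have bnd (t : R) : - 3 <= t <= 3 -> w.[t] ^+ 2 <= 1 /\ (N * t / 3) ^+ 2 * w.[t] ^+ 2 <= 1.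
  move=> t3; have s1 : (t / 3) ^+ 2 <= 1.
    by rewrite -[leRHS](expr1n _ 2) ler_sqr_norm normr1 ler_norml; lra.
  rewrite wE; split.
    rewrite -[leRHS](expr1n _ 2) ler_sqr_norm normr1 normrM gtr0_norm ?invr_gt0//.
    by rewrite mulrC ler_pdivrMr// mul1r NE peak_le.
  have -> : (N * t / 3) ^+ 2 * (N^-1 * (peak m).1.[t / 3]) ^+ 2 =
            (t / 3) ^+ 2 * (peak m).1.[t / 3] ^+ 2 by field; lra.
  have := peak_pell m (t / 3); have := sqr_ge0 (peak m).2.[t / 3]; nra.
have K0_ge0 (t : R) : 0 <= K0.[t] by rewrite K0E (exprM _ 2 2) sqr_ge0.
(* On |t| <= 3 / (2 N), [peak_ge] gives w >= 3/4, and (3/4)^4 >= 1/4. *)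
have mass : 3 / (4 * N) <= pint (- 3) 3 K0.
  have a3 : 3 / (2 * N) <= 3 by rewrite ler_pdivrMr; lra.
  have a0 : 0 <= 3 / (2 * N) by rewrite divr_ge0; lra.
  apply: (@le_trans _ _ (pint (- (3 / (2 * N))) (3 / (2 * N)) K0)); last first.
    by apply: pint_subset => [|||t _]; [lra|lra|lra|exact: K0_ge0].
  have -> : 3 / (4 * N) = pint (- (3 / (2 * N))) (3 / (2 * N)) (4^-1)%:P.
    rewrite pintC; last by lra.
    by field; lra.
  apply: ler_pint => t ht; rewrite hornerC K0E.
  have t1 : N ^+ 2 * (t / 3) ^+ 2 <= 1 / 4.
    rewrite -exprMn (_ : 1 / 4 = (1 / 2) ^+ 2); last by field.
    rewrite ler_sqr_norm [leRHS]ger0_norm; last by lra.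
    rewrite normrM (gtr0_norm Ngt0) mulrC -ler_pdivlMr//.
    rewrite (_ : 1 / 2 / N = (3 / (2 * N)) / 3); last by field; lra.
    by rewrite ler_norml; lra.
  have t2 : (t / 3) ^+ 2 <= 1 / 2.
    have := sqr_ge0 (t / 3); have : 1 <= N ^+ 2 by rewrite exprn_ege1.
    nra.
  have := peak_ge m t2; rewrite -NE => h.
  have {h} x34 : 3 / 4 <= w.[t].
    rewrite wE [leRHS]mulrC ler_pdivlMr//; apply: le_trans h.
    by rewrite mulrC; apply: ler_wpM2l; lra.
  have x2 : 9 / 16 <= w.[t] ^+ 2 by nra.
  by rewrite (exprM _ 2 2); nra.
have I0 : 0 < pint (- 3) 3 K0 by apply: lt_le_trans mass; rewrite divr_gt0//; lra.
(* With y = (N t / 3)^2, the bounds w^2 <= 1 and y w^2 <= 1 give y w^4 <= 2 / (1 + y), whose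
   primitive is an arctangent. *)
have mom : pint (- 3) 3 ('X^2 * K0) <= 54 * pi / N ^+ 3.
  pose g (t : R) : R := 54 / N ^+ 3 * atan (N / 3 * t).
  have Dg (t : R) := is_derive_atan_scale (54 / N ^+ 3) (N / 3) t.
  apply: (@le_trans _ _ (g 3 - g (- 3))).
    apply: (pint_le_primitive _ (fun t _ => Dg t)); first by lra.
    move=> t t3; have [] := bnd _ t3; rewrite hornerM hornerXn K0E.
    set x := w.[t]; have := sqr_ge0 x.
    rewrite (_ : N / 3 * t = N * t / 3); last by ring.
    rewrite (_ : t ^+ 2 = 9 * (N * t / 3) ^+ 2 / N ^+ 2); last by field; lra.
    have := sqr_ge0 (N * t / 3); set y := (N * t / 3) ^+ 2 => y0 x0 x1 yx.
    rewrite (_ : 54 / N ^+ 3 * _ = 9 / N ^+ 2 * (2 / (1 + y))); last by field; lra.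
    rewrite [leLHS](_ : _ = 9 / N ^+ 2 * (y * x ^+ 2 * x ^+ 2)); last by field; lra.
    apply: ler_wpM2l; first by rewrite divr_ge0// sqr_ge0.
    rewrite ler_pdivlMr; last by lra.
    have := mulr_ge0 y0 x0; move: yx; set u := y * x ^+ 2 => u1 u0.
    rewrite (_ : _ * (1 + y) = u * x ^+ 2 + u ^+ 2); last by rewrite /u; ring.
    nra.
  rewrite /g mulrN atanN mulrN opprK -mulrDr [leRHS]mulrAC.
  apply: ler_wpM2l; first by rewrite divr_ge0// exprn_ge0//; lra.
  have := atan_ltpi2 (N / 3 * 3); lra.
exists ((pint (- 3) 3 K0)^-1 *: K0); split.
- rewrite (leq_trans (size_scale_leq _ _))// (leq_trans (size_poly_exp_leq _ _))//.
  have : (size w <= (2 * m).+1)%N.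
    rewrite size_comp_poly2 ?size_scale ?size_polyX ?invr_neq0//.
    by rewrite (size_peak m).1.
    by rewrite gt_eqF.
  by have := leq_trunc_div M.-1 4; rewrite -/m; move: (size w) => sw; lia.
- by move=> t _; rewrite hornerZ mulr_ge0 ?invr_ge0// ltW.
- by rewrite pintZ mulVf// gt_eqF.
- rewrite -scalerAr pintZ mulrC ler_pdivrMr//.
  apply: (le_trans mom).
  apply: (@le_trans _ _ (4 ^+ 2 * (72 * pi) / M%:R ^+ 2 * (3 / (4 * N)))); last first.
    by apply: ler_wpM2l => //; apply: divr_ge0; [apply: mulr_ge0; [exact: sqr_ge0 | apply: mulr_ge0; [exact: ler0n | exact: pi_ge0]] | exact: sqr_ge0].
  have M0' : 0 < M%:R :> R by rewrite ltr0n.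
  rewrite ler_pdivrMr ?exprn_gt0//.
  rewrite (_ : _ * N ^+ 3 = 54 * pi * ((4 * N) ^+ 2 / M%:R ^+ 2)); last first.
    by field; lra.
  rewrite ler_peMr ?mulr_ge0 ?pi_ge0// ler_pdivlMr ?exprn_gt0// mul1r.
  by rewrite ler_pXn2r ?nnegrE//; lra.
Qed.

End JacksonKernel.

Section Jackson.
Context {R : realType}.
Local Notation mu := (@lebesgue_measure R).

Lemma continuous_lip (G : R -> R) (k : R) :
  (forall u v, `|G u - G v| <= k * `|u - v|) -> continuous G.
Proof.
move=> Gk x; have k0 : 0 <= k.
  by have := Gk 1 0; rewrite subr0 normr1 mulr1; exact: le_trans.
apply/cvgrPdist_le => e e0; near=> t.
rewrite (le_trans (Gk _ _))//.
rewrite (@le_trans _ _ ((k + 1) * `|x - t|))//; first by rewrite ler_wpM2r// lerDl.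
rewrite mulrC -ler_pdivlMr; last by lra.
near: t; apply: cvgr_dist_le; first exact: cvg_id.
by rewrite divr_gt0//; lra.
Unshelve. all: by end_near. Qed.

Lemma Rintegral_sum n (D : set R) (F : 'I_n -> R -> R) : measurable D ->
  (forall j, mu.-integrable D (EFin \o F j)) ->
  \int[mu]_(t in D) (\sum_(j < n) F j t) = \sum_(j < n) \int[mu]_(t in D) F j t.
Proof.
move=> mD iF.
suff h : (\int[mu]_(t in D) (\sum_(j < n) F j t)%:E = (\sum_(j < n) \int[mu]_(t in D) F j t)%R%:E)%E.
  by rewrite {1}/Rintegral h.
under eq_integral do rewrite -sumEFin.
rewrite integral_sum// -sumEFin; apply: eq_bigr => j _.
by rewrite /Rintegral fineK//; apply: integrable_fin_num (iF j).
Qed.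

(** Taylor's formula for [K] at -u separates v from u in K(v - u); the coefficient of v^j is an
    integral in u alone. *)
Lemma poly_convolution (G : R -> R) (K : {poly R}) : continuous G ->
  exists2 q : {poly R}, (size q <= size K)%N &
    forall v, q.[v] = \int[mu]_(u in `[(- 2), 2]) (G u * K.[v - u]).
Proof.
move=> cG.
exists (\poly_(j < size K) \int[mu]_(u in `[(- 2), 2]) (G u * (K^`N(j) \Po - 'X).[u])).
  exact: size_poly.
move=> v; rewrite horner_poly.
have int_ j : mu.-integrable `[(- 2), 2] (EFin \o (fun u => G u * (K^`N(j) \Po - 'X).[u])).
  apply: integrable_continuous => x; apply: cvgM; first exact: cG.
  exact: continuous_horner_poly.
under eq_bigr => j _ do rewrite -RintegralZr//.
rewrite -Rintegral_sum//; last first.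
  move=> j; rewrite (_ : EFin \o _ = (fun u => ((v ^+ j)%:E * (G u * (K^`N(j) \Po - 'X).[u])%:E)%E)).
    by apply: integrableZl => //; exact: int_.
  by apply/funext => u; rewrite /= mulrC EFinM.
apply: eq_Rintegral => u _.
rewrite [v - u]addrC nderiv_taylor ?mulr_sumr; last exact: mulrC.
by apply: eq_bigr => j _; rewrite horner_comp hornerN hornerX mulrA.
Qed.

Lemma size_even_poly_le (p : {poly R}) M : (size p <= (2 * M).-1)%N ->
  (size (even_poly p) <= M)%N.
Proof.
move=> sp; apply: (leq_trans (size_even_poly _)).
rewrite uphalf_half; lia.
Qed.

Lemma horner_even_poly (p : {poly R}) (v : R) :
  (even_poly p).[v ^+ 2] = (p.[v] + p.[- v]) / 2.
Proof.
have E w : p.[w] = (even_poly p).[w ^+ 2] + (odd_poly p).[w ^+ 2] * w.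
  by rewrite -{1}[p]poly_even_odd hornerD hornerM !horner_comp !hornerXn hornerX.
by rewrite (E v) (E (- v)) sqrrN; field.
Qed.

(* The hypothesis on B is a Lipschitz bound weighted around the point v, so that the error at v
   depends on the local behaviour of G; q is the even part, in the variable v^2, of a convolution. *)
Lemma jackson : exists2 C : R, 0 <= C & forall M (G : R -> R) (k : R), (0 < M)%N ->
  (forall u v, `|G u - G v| <= k * `|u - v|) -> (forall v, G (- v) = G v) ->
  exists2 q : {poly R}, (size q <= M)%N &
    forall v B : R, 0 <= v <= 1 -> 0 <= B ->
    (forall u : R, - 2 <= u <= 2 -> `|G u - G v| <= B / M%:R * (1 + M%:R ^+ 2 * (u - v) ^+ 2)) ->
    `|q.[v ^+ 2] - G v| <= C * B / M%:R.
Proof.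
have [C0 C00 HK] := @jackson_kernel R.
(* 1 + C0 for the convolution integral, 1 + 4 C0 for the mass missing from the kernel. *)
exists (2 + 5 * C0); first by lra.
move=> M G k M0 Gk Geven.
have [K [sK K0 K1 K2]] := HK M M0.
have cG : continuous G by exact: continuous_lip Gk.
have cGc (c : R) : continuous (fun u => G u - c).
  by move=> u; apply: cvgB; [exact: cG | exact: cvg_cst].
(* Constants are not reproduced, since only the part of [K] over [v - 2, v + 2] enters. Subtracting
   G 1 first leaves the factor G v - G 1, which the hypothesis on [B] controls at u = 1. *)
have [q0 sq0 q0E] := poly_convolution K (cGc (G 1)).
pose q1 : {poly R} := q0 + (G 1)%:P.
have M0' : 0 < M%:R :> R by rewrite ltr0n.
have main (v B : R) : - 1 <= v <= 1 -> 0 <= B ->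
    (forall u : R, - 2 <= u <= 2 -> `|G u - G v| <= B / M%:R * (1 + M%:R ^+ 2 * (u - v) ^+ 2)) ->
    `|q1.[v] - G v| <= (2 + 5 * C0) * B / M%:R.
  move=> v1 B0 HB.
  pose Kv : {poly R} := K \Po (v%:P - 'X).
  have KvE (u : R) : Kv.[u] = K.[v - u] by rewrite horner_comp !hornerE.
  have int_cK (c : R) : mu.-integrable `[(- 2), 2] (EFin \o (fun u => (G u - c) * Kv.[u])).
    by apply: integrable_continuous => u; apply: cvgM; [exact: cGc | exact: continuous_horner_poly].
  have int_K (p : {poly R}) : mu.-integrable `[(- 2), 2] (EFin \o horner p).
    by apply: integrable_continuous; exact: continuous_horner_poly.
  have massE : pint (- 2) 2 Kv = pint (v - 2) (v + 2) K.
    by rewrite pint_comp_subl ?opprK//; lra.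
  have split3 (p : {poly R}) : pint (- 3) 3 p = pint (- 3) (v - 2) p + pint (v - 2) (v + 2) p + pint (v + 2) 3 p.
    by rewrite (@pint_cat _ (- 3) (v + 2)) ?(@pint_cat _ (- 3) (v - 2) (v + 2))//; clear -v1; lra.
  (* The tails lie in |t| >= 1, where 1 <= t^2, so the second moment bounds their mass. *)
  have tails : 0 <= pint (- 3) (v - 2) K + pint (v + 2) 3 K <= C0 / M%:R ^+ 2.
    apply/andP; split.
      by apply: addr_ge0; apply: pint_ge0 => u hu; apply: K0; lra.
    apply: le_trans K2; rewrite split3.
    have h1 : 0 <= pint (v - 2) (v + 2) ('X^2 * K).
      apply: pint_ge0 => u hu; rewrite hornerM hornerXn mulr_ge0 ?sqr_ge0// K0//; lra.
    have h2 : pint (- 3) (v - 2) K <= pint (- 3) (v - 2) ('X^2 * K).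
      apply: ler_pint => u hu; rewrite hornerM hornerXn ler_peMl ?K0//; clear -v1 hu; [lra|nra].
    have h3 : pint (v + 2) 3 K <= pint (v + 2) 3 ('X^2 * K).
      apply: ler_pint => u hu; rewrite hornerM hornerXn ler_peMl ?K0//; clear -v1 hu; [lra|nra].
    clear -h1 h2 h3; lra.
  have mass1 : pint (- 2) 2 Kv = 1 - (pint (- 3) (v - 2) K + pint (v + 2) 3 K).
    by have e := K1; rewrite split3 in e; rewrite massE; lra.
  have conv : q1.[v] - G v = \int[mu]_(u in `[(- 2), 2]) ((G u - G v) * Kv.[u])
      + (G v - G 1) * (pint (- 2) 2 Kv - 1).
    rewrite hornerD hornerC q0E.
    have -> : \int[mu]_(u in `[(- 2), 2]) ((G u - G 1) * K.[v - u]) =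
        \int[mu]_(u in `[(- 2), 2]) ((G u - G v) * Kv.[u] + (G v - G 1) * Kv.[u]).
      by apply: eq_Rintegral => u _; rewrite KvE; ring.
    rewrite RintegralD//; last first.
      by apply: integrable_continuous => u; apply: cvgZr; exact: continuous_horner_poly.
    by rewrite RintegralZl// -pintI; ring.
  have first : `|\int[mu]_(u in `[(- 2), 2]) ((G u - G v) * Kv.[u])| <= B / M%:R * (1 + C0).
    apply: (le_trans (le_normr_Rintegral _ _)) => //.
    pose p : {poly R} := (B / M%:R) *: (Kv + M%:R ^+ 2 *: (('X^2 * K) \Po (v%:P - 'X))).
    have le_p (u : R) : - 2 <= u <= 2 -> `|(G u - G v) * Kv.[u]| <= p.[u].
      move=> hu; have Ku : 0 <= K.[v - u] by apply: K0; clear -hu v1; lra.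
      rewrite normrM KvE [`|K.[_]|]ger0_norm//.
      apply: (le_trans (ler_wpM2r Ku (HB u hu))).
      rewrite /p hornerZ hornerD KvE hornerZ horner_comp hornerM hornerXn.
      rewrite !(hornerD, hornerN, hornerC, hornerX).
      by rewrite le_eqVlt; apply/orP; left; apply/eqP; ring.
    apply: (@le_trans _ _ (pint (- 2) 2 p)).
      rewrite pintI; apply: le_Rintegral => //.
      apply: integrable_continuous => u; apply: cvg_norm.
      by apply: cvgM; [exact: cGc | exact: continuous_horner_poly].
    rewrite /p pintZ pintD pintZ mass1 pint_comp_subl ?opprK; last by lra.
    apply: ler_wpM2l; first by rewrite divr_ge0.
    apply: lerD; first by case/andP: tails; lra.
    rewrite mulrC -ler_pdivlMr ?exprn_gt0//; apply: le_trans K2.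
    apply: pint_subset; [clear -v1; lra|clear -v1; lra|clear -v1; lra|move=> u hu].
    by rewrite hornerM hornerXn mulr_ge0 ?sqr_ge0// K0.
  have snd : `|(G v - G 1) * (pint (- 2) 2 Kv - 1)| <= B / M%:R * (1 + 4 * C0).
    set T : R := pint (- 3) (v - 2) K + pint (v + 2) 3 K in tails mass1.
    have T1 : T <= 1.
      have : 0 <= pint (- 2) 2 Kv by apply: pint_ge0 => u hu; rewrite KvE K0//; clear -hu v1; lra.
      by rewrite mass1 subr_ge0.
    clearbody T; rewrite normrM distrC mass1.
    rewrite (_ : 1 - T - 1 = - T); last by ring.
    rewrite [`|- T|]normrN [`|T|]ger0_norm; last by case/andP: tails.
    apply: (@le_trans _ _ (B / M%:R * (1 + M%:R ^+ 2 * (1 - v) ^+ 2) * T)).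
      by apply: ler_wpM2r; [case/andP: tails | apply: HB; lra].
    rewrite -mulrA; apply: ler_wpM2l; first by rewrite divr_ge0.
    have TM : M%:R ^+ 2 * T <= C0.
      by case/andP: tails => _; rewrite ler_pdivlMr ?exprn_gt0// mulrC.
    have v4 : (1 - v) ^+ 2 <= 4 by clear -v1; nra.
    have : 0 <= M%:R ^+ 2 * T by rewrite mulr_ge0 ?sqr_ge0//; case/andP: tails.
    move: TM; set Y := M%:R ^+ 2 * T => TM Y0.
    rewrite (_ : _ * T = T + (1 - v) ^+ 2 * Y); last by rewrite /Y; ring.
    have : (1 - v) ^+ 2 * Y <= 4 * Y by apply: ler_wpM2r.
    lra.
  rewrite conv; apply: (le_trans (ler_normD _ _)).
  apply: (le_trans (lerD first snd)); rewrite -mulrDr.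
  by rewrite -[leRHS]mulrA [leRHS]mulrC ler_wpM2l ?divr_ge0//; clear -C00; lra.
exists (even_poly q1).
  apply: size_even_poly_le; rewrite /q1.
  rewrite (leq_trans (size_polyD _ _))// geq_max (leq_trans sq0)//=.
  by rewrite (leq_trans (size_polyC_leq1 _))//; lia.
move=> v B v1 B0 HB; rewrite horner_even_poly.
have h1 := main v B ltac:(lra) B0 HB.
have h2 : `|q1.[- v] - G v| <= (2 + 5 * C0) * B / M%:R.
  rewrite -Geven; apply: main => //; first by lra.
  move=> u hu; rewrite -(Geven u) (Geven v) (_ : (u - - v) ^+ 2 = (- u - v) ^+ 2); last by ring.
  by apply: HB; lra.
by move: h1 h2; rewrite !ler_norml; lra.
Qed.
End Jackson.

(** * Gauss quadrature *)

Section GaussRules.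
Context {R : realType}.
Local Notation mu := (@lebesgue_measure R).

(** What the error analysis uses of a Gauss rule; [size q <= 2 * M] means degree below 2 M. The
    class is invariant under t |-> 1 - t, so a singularity at 1 can be moved to 0. *)
Definition gauss_rule M (x lam : 'I_M -> R) : Prop :=
  [/\ forall h, 0 < x h < 1, forall h, 0 <= lam h &
      forall q : {poly R}, (size q <= 2 * M)%N ->
        \sum_h lam h * q.[x h] = pint 0 1 q].

Lemma gauss_rule_sub M (x lam : 'I_M -> R) :
  gauss_rule x lam -> gauss_rule (fun h => 1 - x h) lam.
Proof.
move=> [x01 lam0 ex]; split=> [h|//|q sq]; first by have := x01 h; lra.
have s2 : size (1%:P - 'X : {poly R}) = 2%N.
  by rewrite -opprB size_polyN size_XsubC.
transitivity (\sum_h lam h * (q \Po (1%:P - 'X)).[x h]).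
  by apply: eq_bigr => h _; rewrite horner_comp hornerD hornerN hornerC hornerX.
by rewrite ex ?size_comp_poly2// pint_comp_subl// subrr subr0.
Qed.

Lemma gauss_rule_sum1 M (x lam : 'I_M -> R) : (0 < M)%N ->
  gauss_rule x lam -> \sum_h lam h = 1.
Proof.
move=> M0 [_ _ ex]; have := ex 1%:P; rewrite pintC// subr0 mulr1 => <-.
  by apply: eq_bigr => h _; rewrite hornerC mulr1.
by rewrite (leq_trans (size_polyC_leq1 _))//; lia.
Qed.

Section Legendre.
Variable leg : nat -> {poly R}.
Hypothesis legP : orthonormal_legendre leg.

Lemma legendre_dot i j : pint 0 1 (leg i * leg j) = (i == j)%:R.
Proof.
rewrite -(legP.2 i j) pintI; apply: eq_Rintegral => t _.
by rewrite hornerM.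
Qed.

Lemma legendre_span_ex n (q : {poly R}) : (size q <= n)%N ->
  exists c : nat -> R, q = \sum_(i < n) c i *: leg i.
Proof.
elim: n q => [|n IH] q.
  by rewrite leqn0 size_poly_eq0 => /eqP ->; exists (fun=> 0); rewrite big_ord0.
move=> sq; have [sl l0] := legP.1 n.
pose a := q`_n / lead_coef (leg n).
have [|c cE] := IH (q - a *: leg n).
  apply/leq_sizeP => j; rewrite leq_eqVlt => /predU1P[<-|nj].
    rewrite coefB coefZ /a (_ : (leg n)`_n = lead_coef (leg n)).
      by rewrite divfK ?subrr// gt_eqF.
    by rewrite lead_coefE sl.
  rewrite coefB coefZ nth_default ?(leq_trans sq)//.
  by rewrite nth_default ?sl// mulr0 subrr.
exists (fun i => if i == n then a else c i).
rewrite big_ord_recr/= eqxx -[LHS](subrK (a *: leg n)) cE; congr (_ + _).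
by apply: eq_bigr => i _; rewrite ltn_eqF.
Qed.

Lemma legendre_span n (q : {poly R}) : (size q <= n)%N ->
  q = \sum_(i < n) pint 0 1 (q * leg i) *: leg i.
Proof.
move=> /legendre_span_ex [c ->]; apply: eq_bigr => i _; congr (_ *: _).
rewrite mulr_suml pint_sum (bigD1 i)//= big1 ?addr0.
  by rewrite -scalerAl pintZ legendre_dot eqxx mulr1.
by move=> j ji; rewrite -scalerAl pintZ legendre_dot val_eqE (negbTE ji) mulr0.
Qed.

Lemma legendre_orth n (q : {poly R}) : (size q <= n)%N -> pint 0 1 (leg n * q) = 0.
Proof.
move=> /legendre_span_ex [c ->]; rewrite mulr_sumr pint_sum big1// => i _.
by rewrite -scalerAr pintZ legendre_dot gtn_eqF ?mulr0.
Qed.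

(** Exactness comes from interpolation for degree below M, and beyond from division by [leg M],
    which is orthogonal to the quotient. Positivity comes from testing on squares of Lagrange
    polynomials. *)
Lemma gauss_legendre_rule M (x lam : 'I_M -> R) :
  gauss_legendre leg x lam -> gauss_rule x lam.
Proof.
move=> [xinj xroot lamE]; have [sl l0] := legP.1 M.
set a := lead_coef (leg M) in l0.
have legE : leg M = a *: \prod_(j < M) ('X - (x j)%:P).
  rewrite [LHS](@all_roots_prod_XsubC _ _ (codom x)) ?big_image//.
  - by rewrite size_codom card_ord.
  - by apply/allP => _ /codomP[h ->].
  - by rewrite uniq_rootsE; apply/injectiveP.
pose omit h : {poly R} := \prod_(j < M | j != h) ('X - (x j)%:P).
have legEh h : leg M = a *: (('X - (x h)%:P) * omit h).
  by rewrite legE (bigD1 h).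
have omit0 h : omit h != 0 by apply/prodf_neq0 => j _; rewrite polyXsubC_eq0.
have size_omit h : (size (omit h) <= M)%N.
  have := sl; rewrite (legEh h) size_scale ?gt_eqF// size_monicM ?monicXsubC//.
  by rewrite size_XsubC add2n => /eq_add_S <-.
(* Pairing [leg M] with [omit h] shows that (X - x h) (omit h)^2 has integral 0; it would have
   constant sign on [0, 1] if the node were not interior. *)
have x01 h : 0 < x h < 1.
  have o := legendre_orth (size_omit h).
  have {}o : pint 0 1 (('X - (x h)%:P) * omit h ^+ 2) = 0.
    move: o; rewrite (legEh h) -scalerAl pintZ -mulrA -expr2 => /eqP.
    by rewrite mulf_eq0 gt_eqF//= => /eqP.
  have nz : ('X - (x h)%:P) * omit h ^+ 2 != 0.
    by rewrite mulf_neq0 ?expf_neq0 ?polyXsubC_eq0.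
  apply: contraT; rewrite negb_and -!leNgt => /orP[xh|xh].
    rewrite -(negbTE nz); apply/eqP; apply: pint_eq0 o => t /andP[t0 t1].
    by rewrite hornerM hornerXsubC horner_exp mulr_ge0 ?sqr_ge0//; lra.
  rewrite -oppr_eq0 in nz; rewrite -(negbTE nz); apply/eqP; apply: pint_eq0.
    move=> t /andP[t0 t1]; rewrite hornerN hornerM hornerXsubC horner_exp -mulNr.
    by rewrite mulr_ge0 ?sqr_ge0//; lra.
  by rewrite -scaleN1r pintZ o mulr0.
pose l h : {poly R} := \prod_(j < M | j != h) ((x h - x j)^-1 *: ('X - (x j)%:P)).
have lE h t : (l h).[t] = \prod_(j < M | j != h) ((t - x j) / (x h - x j)).
  by rewrite horner_prod; apply: eq_bigr => j _; rewrite hornerZ hornerXsubC mulrC.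
have lx h j : (l h).[x j] = (h == j)%:R.
  rewrite lE; have [->|hj] := eqVneq h j.
    rewrite big1// => i ij; rewrite divff// subr_eq0.
    by apply: contra_neq ij => /xinj.
  by rewrite (bigD1 j) 1?eq_sym//= subrr mul0r mul0r.
have size_l h : (size (l h) <= M)%N.
  rewrite /l scaler_prod; apply: leq_trans (size_scale_leq _ _) _; exact: size_omit.
have lamI h : lam h = pint 0 1 (l h).
  by rewrite lamE pintI; apply: eq_Rintegral => t _; rewrite lE.
have exM (q : {poly R}) : (size q <= M)%N -> \sum_h lam h * q.[x h] = pint 0 1 q.
  move=> sq; suff {2}-> : q = \sum_h q.[x h] *: l h.
    by rewrite pint_sum; apply: eq_bigr => h _; rewrite pintZ lamI mulrC.
  apply/eqP; rewrite -subr_eq0; apply/eqP.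
  apply: (@roots_geq_poly_eq0 _ _ (codom x)).
  - apply/allP => _ /codomP[h ->]; rewrite /root hornerD hornerN horner_sum.
    rewrite (bigD1 h)//= big1 => [|j jh]; rewrite hornerZ lx ?eqxx ?mulr1 ?addr0 ?subrr//.
    by rewrite (negbTE jh) mulr0.
  - by apply/injectiveP.
  - rewrite size_codom card_ord (leq_trans (size_polyD _ _))// geq_max sq/=.
    rewrite size_polyN (leq_trans (size_sum _ _ _))//; apply/bigmax_leqP => h _.
    exact: leq_trans (size_scale_leq _ _) (size_l h).
have ex2M (q : {poly R}) : (size q <= 2 * M)%N -> \sum_h lam h * q.[x h] = pint 0 1 q.
  move=> sq; have lM0 : leg M != 0 by rewrite -size_poly_eq0 sl.
  rewrite {2}(divp_eq q (leg M)) pintD mulrC legendre_orth; last first.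
    by rewrite size_divp// sl /= leq_subLR addnn -mul2n.
  rewrite add0r -exM; last by rewrite -ltnS -sl ltn_modp.
  apply: eq_bigr => h _; congr (_ * _).
  rewrite {1}(divp_eq q (leg M)) hornerD hornerM.
  by have /rootP -> := xroot h; rewrite mulr0 add0r.
split=> // h.
have -> : lam h = pint 0 1 (l h ^+ 2).
  rewrite -ex2M.
    rewrite (bigD1 h)//= big1 => [|j jh]; rewrite horner_exp lx ?eqxx ?expr1n ?mulr1 ?addr0//.
    by rewrite eq_sym (negbTE jh) expr0n mulr0.
  apply: leq_trans (size_polyMleq _ _) _; apply: leq_trans (leq_pred _) _.
  by rewrite mul2n -addnn leq_add.
by apply: pint_ge0 => t _; rewrite horner_exp sqr_ge0.
Qed.
End Legendre.

End GaussRules.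

(** * Gauss sums with an inverse square root *)

Section GaussSums.
Context {R : realType}.

Lemma is_derive_ln_add (a t : R) : 0 < t + a ->
  is_derive t 1 (fun t => ln (t + a)) (t + a)^-1.
Proof.
move=> ta; have h : is_derive t 1 (fun t => t + a) (1 + 0) by exact: is_deriveD.
have := @is_derive1_comp R (@ln R) (fun t => t + a) t _ _ (is_derive1_ln ta) h.
by rewrite addr0 mulr1.
Qed.

(* The Hermite interpolant of 1/(t + a) at the nodes x is (1 - P(t)^2/P(-a)^2)/(t + a) with
   P = prod_h (t - x h), hence it lies below 1/(t + a). *)
Lemma gauss_resolvent M (x lam : 'I_M -> R) (a : R) : 0 < a -> gauss_rule x lam ->
  \sum_h lam h / (x h + a) <= ln (1 + a) - ln a.
Proof.
move=> a0 [x01 _ ex]; pose P : {poly R} := \prod_h ('X - (x h)%:P).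
have Pa : P.[- a] != 0.
  rewrite horner_prod; apply/prodf_neq0 => h _; rewrite hornerXsubC.
  by rewrite lt_eqF//; have := x01 h; lra.
have sP : size P = M.+1 by rewrite /P -big_enum size_prod_XsubC size_enum_ord.
pose N : {poly R} := 1%:P - (P.[- a] ^- 2) *: P ^+ 2.
have NE t : N.[t] = 1 - P.[t] ^+ 2 / P.[- a] ^+ 2.
  by rewrite hornerD hornerN hornerZ hornerC horner_exp [_^-1 * _]mulrC.
have : root N (- a) by rewrite /root NE divff ?subrr// expf_neq0.
move=> /factor_theorem[H NH].
have HE t : 0 <= t -> H.[t] = (1 - P.[t] ^+ 2 / P.[- a] ^+ 2) / (t + a).
  move=> t0; rewrite -NE NH hornerM hornerXsubC opprK mulfK//.
  by rewrite gt_eqF// ltr_wpDl.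
have sH : (size H <= 2 * M)%N.
  have [->|H0] := eqVneq H 0; first by rewrite size_poly0.
  have : (size N <= (2 * M).+1)%N.
    rewrite (leq_trans (size_polyD _ _))// geq_max (leq_trans (size_polyC_leq1 _))//=.
    rewrite size_polyN (leq_trans (size_scale_leq _ _))//.
    by rewrite (leq_trans (size_poly_exp_leq _ _))// sP/= mulnC.
  by rewrite NH size_Mmonic ?monicXsubC// size_XsubC addn2.
have -> : \sum_h lam h / (x h + a) = pint 0 1 H.
  rewrite -ex//; apply: eq_bigr => h _; congr (_ * _).
  rewrite HE; last by have := x01 h; lra.
  have -> : P.[x h] = 0.
    by rewrite horner_prod (bigD1 h)//= hornerXsubC subrr mul0r.
  by rewrite expr0n/= mul0r subr0 mul1r.
rewrite -[in ln a](add0r a).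
apply: (@pint_le_primitive _ 0 1 H (fun t => ln (t + a)) (fun t => (t + a)^-1)) => //.
  by move=> t /andP[t0 _]; apply: is_derive_ln_add; lra.
move=> t /andP[t0 _]; have ta : 0 < t + a by lra.
rewrite HE// ler_piMl ?invr_ge0 ?(ltW ta)//.
by rewrite lerBlDr lerDl divr_ge0 ?sqr_ge0.
Qed.

(* The term k with 4^-k of the order of x is already of the order of 1/sqrt x. *)
Lemma isqrt_le_dyadic J (x : R) : 4^-1 ^+ J <= x -> x <= 1 ->
  (Num.sqrt x)^-1 <= 5 * \sum_(k < J.+1) 2^-1 ^+ k / (x + 4^-1 ^+ k).
Proof.
move=> xJ x1; have x0 : 0 < x by apply: lt_le_trans xJ; rewrite exprn_gt0.
have tm k : 0 <= 2^-1 ^+ k / (x + 4^-1 ^+ k).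
  by rewrite divr_ge0 ?addr_ge0 ?exprn_ge0// ltW.
elim: J xJ => [|J IH] xJ.
  have -> : x = 1 by apply/le_anti; rewrite x1.
  rewrite big_ord1 /= !expr0 sqrtr1 invr1 mulrA ler_pdivlMr.
    lra.
  lra.
rewrite big_ord_recr/= mulrDr; have [xJ'|xJ'] := leP (4^-1 ^+ J) x.
  by rewrite (le_trans (IH xJ'))// lerDl mulr_ge0.
apply: le_trans (_ : 5 * (2^-1 ^+ J.+1 / (x + 4^-1 ^+ J.+1)) <= _); last first.
  by rewrite lerDr mulr_ge0// sumr_ge0.
set c : R := 2^-1 ^+ J.+1; have c0 : 0 < c by rewrite exprn_gt0.
have c2 : 4^-1 ^+ J.+1 = c ^+ 2.
  by rewrite -exprM mulnC exprM; congr (_ ^+ _); field.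
have xc : x < 4 * c ^+ 2 by rewrite -c2 exprS mulVKf.
rewrite c2 in xJ *.
have s : c <= Num.sqrt x by rewrite -[leLHS]ger0_norm ?(ltW c0)// -sqrtr_sqr ler_wsqrtr.
apply: (@le_trans _ _ c^-1); first by rewrite lef_pV2 ?posrE ?sqrtr_gt0.
rewrite mulrA ler_pdivlMr; last by rewrite addr_gt0// exprn_gt0.
by rewrite mulrC ler_pdivrMr//; nra.
Qed.

Lemma sum_odd_halves J : \sum_(k < J) ((2 * k).+1%:R * 2^-1 ^+ k) =
  6 - (4 * J + 6)%:R * 2^-1 ^+ J :> R.
Proof.
elim: J => [|J IH]; first by rewrite big_ord0 muln0 add0n expr0; ring.
rewrite big_ord_recr/= IH exprS -[(2 * J).+1%:R]natr1 !natrD !natrM -[J.+1%:R]natr1.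
by field.
Qed.

(** By 1 + 4^k <= 2^(2k+1) and e >= 2. This serves for [gauss_resolvent] at a = 4^-k; the growth is
    linear in k, hence summable against 2^-k. *)
Lemma ln_4X_le k : ln (1 + 4 ^+ k) <= (2 * k).+1%:R :> R.
Proof.
rewrite -[leRHS]expRK ler_ln ?posrE ?expR_gt0 ?addr_gt0 ?exprn_gt0//.
have e2 : 2 <= expR 1 :> R by rewrite (le_trans _ (expR_ge1Dx _)).
rewrite -[X in expR X]mulr1 expRM_natl.
apply: (@le_trans _ _ (2 ^+ (2 * k).+1)); last by rewrite ler_pXn2r ?nnegrE ?expR_ge0.
have : 1 <= 4 ^+ k :> R by rewrite exprn_ege1// ler1n.
by rewrite exprS exprM (_ : 2 ^+ 2 = 4); [lra|ring].
Qed.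

(** A dyadic superposition of resolvents dominates 1 / sqrt x. The number of terms depends on the
    nodes but the bound does not: 30 = 5 * 6, where 6 is the sum of (2k+1) / 2^k over all k. *)
Lemma gauss_isqrt M (x lam : 'I_M -> R) : gauss_rule x lam ->
  \sum_h lam h / Num.sqrt (x h) <= 30.
Proof.
move=> g; have [x01 lam0 _] := g.
have [J HJ] : exists J, forall h, 4^-1 ^+ J <= x h.
  have H h : exists J, 4^-1 ^+ J <= x h.
    have [xh0 _] := andP (x01 h).
    exists (Num.bound (x h)^-1); rewrite exprVn invf_ple ?posrE ?exprn_gt0//.
    apply: le_trans (ltW (archi_boundP _)) _; first by rewrite invr_ge0 ltW.
    by rewrite -natrX ler_nat ltnW// ltn_expl.
  have [J HJ] := choice H; exists (\max_h J h) => h.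
  apply: le_trans (HJ h); apply: ler_wiXn2l; [by rewrite invr_ge0 | by rewrite invf_le1// ler1n | exact: leq_bigmax].
apply: (@le_trans _ _ (\sum_h \sum_(k < J.+1) 5 * 2^-1 ^+ k * (lam h / (x h + 4^-1 ^+ k)))).
  apply: ler_sum => h _; apply: (@le_trans _ _ (lam h * (5 * \sum_(k < J.+1) 2^-1 ^+ k / (x h + 4^-1 ^+ k)))).
    apply: ler_wpM2l => //; apply: isqrt_le_dyadic => //.
    by have := x01 h; lra.
  rewrite !mulr_sumr le_eqVlt; apply/orP; left; apply/eqP; apply: eq_bigr => k _; ring.
rewrite exchange_big/=.
apply: (@le_trans _ _ (\sum_(k < J.+1) 5 * ((2 * k).+1%:R * 2^-1 ^+ k))).
  apply: ler_sum => k _; rewrite -mulr_sumr [X in _ <= 5 * X]mulrC mulrA ler_wpM2l//.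
  have a0 : 0 < 4^-1 ^+ k :> R by rewrite exprn_gt0.
  apply: (le_trans (gauss_resolvent a0 g)); rewrite -ln_div ?posrE ?addr_gt0//.
  rewrite mulrDl mul1r divff ?gt_eqF// exprVn invrK addrC; exact: ln_4X_le.
rewrite -mulr_sumr sum_odd_halves.
have : 0 <= (4 * J.+1 + 6)%:R * 2^-1 ^+ J.+1 :> R by rewrite mulr_ge0// exprn_ge0.
lra.
Qed.

End GaussSums.

(** * Integrable singularities *)

Section SingularIntegrals.
Context {R : realType}.
Local Notation mu := (@lebesgue_measure R).

(** Zero for t <= 0, as square root and inverse are total. Hence isq (c (t - s)) with c = 1 or c =
    -1 is singular on one side of s and vanishes on the other. *)
Definition isq (t : R) : R := (Num.sqrt t)^-1.

Lemma isq_ge0 t : 0 <= isq t. Proof. by rewrite invr_ge0 sqrtr_ge0. Qed.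

Lemma is_derive_sqrt_aff (c s t : R) : 0 < c * (t - s) ->
  is_derive t 1 (fun t => Num.sqrt (c * (t - s))) (c / 2 * isq (c * (t - s))).
Proof.
move=> ts; have h : is_derive t 1 (fun t => c * (t - s)) (c * (1 - 0)).
  exact: is_deriveZ.
have h2 : is_derive (c * (t - s)) 1 (@Num.sqrt R) (2 * Num.sqrt (c * (t - s)))^-1.
  exact: is_derive1_sqrt.
have := @is_derive1_comp R (@Num.sqrt R) (fun t => c * (t - s)) t _ _ h2 h.
by rewrite subr0 mulr1 invfM [_ * c]mulrC mulrA.
Qed.

Lemma measurable_isq : measurable_fun [set: R] isq.
Proof.
have -> : isq = (fun t => (Num.max t 0) `^ (- 2^-1)).
  apply/funext => t; rewrite /isq powRN; congr (_^-1).
  have [t0|t0] := leP t 0; first by rewrite ler0_sqrtr// powR12_sqrt// sqrtr0.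
  by rewrite powR12_sqrt// ltW.
apply: (measurableT_comp (measurable_powR _)).
exact: measurable_maxr.
Qed.

Lemma measurable_isq_aff (c s : R) (D : set R) :
  measurable_fun D (fun t => isq (c * (t - s))).
Proof.
apply: measurable_funTS; apply: measurableT_comp; first exact: measurable_isq.
apply: measurable_funM => //; exact: measurable_funB.
Qed.

Lemma continuous_isq_aff (c s t : R) : 0 < c * (t - s) ->
  {for t, continuous (fun t => isq (c * (t - s)))}.
Proof.
move=> ts; apply: cvgV; first by rewrite gt_eqF ?sqrtr_gt0.
have [+ _] := is_derive_sqrt_aff ts.
by move=> /derivable1_diffP/differentiable_continuous.
Qed.

(** Monotone convergence, to pass from intervals that avoid the singularity, where the fundamental
    theorem applies, to their union. *)
Lemma ge0_integral_exhaust (S : (set (measurableTypeR R))^nat) (f : R -> R) (C : R) :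
  {homo S : n m / (n <= m)%N >-> (n <= m)%O} -> (forall i, measurable (S i)) ->
  measurable_fun [set: R] f -> (forall t, 0 <= f t) ->
  (forall i, \int[mu]_(t in S i) (f t)%:E <= C%:E)%E ->
  (\int[mu]_(t in \bigcup_i S i) (f t)%:E <= C%:E)%E.
Proof.
move=> homoS mS mf f0 leC.
have mfS i : measurable_fun (S i) (EFin \o f).
  by apply/measurable_EFinP; exact: measurable_funTS.
have f0S i t : S i t -> (0 <= (EFin \o f) t)%E by rewrite lee_fin.
have cv := @ge0_nondecreasing_set_cvg_integral _ _ _ S (EFin \o f) mu homoS mS mfS f0S.
move/cvg_lim : (cv) => <-//; apply: lime_le; first by apply/cvg_ex; eexists; exact: cv.
by near=> n; exact: leC.
Unshelve. all: by end_near. Qed.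

(** As c is 1 or -1, a primitive on either side of s is 2 c sqrt (c (t - s)), with square roots in
    [0, 1]. *)
Lemma integral_isq_aff_le (c s a b : R) : c ^+ 2 = 1 -> a < b ->
  (forall t, a <= t <= b -> 0 < c * (t - s) <= 1) ->
  (\int[mu]_(t in `[a, b]) (isq (c * (t - s)))%:E <= 2%:E)%E.
Proof.
move=> c1 ab H.
have D t : 0 < c * (t - s) ->
    is_derive t 1 (fun t => 2 * c * Num.sqrt (c * (t - s))) (isq (c * (t - s))).
  move=> ts; have /(is_deriveZ (2 * c)) := is_derive_sqrt_aff ts.
  rewrite (_ : 2 * c *: _ = isq (c * (t - s)))//.
  rewrite /GRing.scale/= mulrA (_ : 2 * c * (c / 2) = c ^+ 2); last by field.
  by rewrite c1 mul1r.
have cF t : 0 < c * (t - s) -> {for t, continuous (fun t => 2 * c * Num.sqrt (c * (t - s)))}.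
  move=> ts; have [+ _] := D t ts.
  by move=> /derivable1_diffP/differentiable_continuous.
rewrite (@continuous_FTC2 _ _ (fun t => 2 * c * Num.sqrt (c * (t - s))))//.
- have [/andP[a0 a1]] := H a ltac:(lra); have [/andP[b0 b1]] := H b ltac:(lra).
  rewrite -EFinB lee_fin.
  have sa := sqrtr_ge0 (c * (a - s)); have sb := sqrtr_ge0 (c * (b - s)).
  have sa1 : Num.sqrt (c * (a - s)) <= 1 by rewrite -sqrtr1 ler_wsqrtr.
  have sb1 : Num.sqrt (c * (b - s)) <= 1 by rewrite -sqrtr1 ler_wsqrtr.
  move: sa sb sa1 sb1; set u := Num.sqrt _; set w := Num.sqrt _.
  clearbody u w => sa sb sa1 sb1.
  have /orP[/eqP->|/eqP->] : (c == 1) || (c == -1) by rewrite -eqf_sqr c1 expr1n.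
    by lra.
  by lra.
- apply/continuous_in_subspaceT => t; rewrite inE/= in_itv/= => /H/andP[t0 _].
  exact: continuous_isq_aff.
- split.
  + move=> t; rewrite in_itv/= => /andP[at_ tb].
    by have /andP[ts _] := H t ltac:(lra); have [] := D t ts.
  + by apply: cvg_at_right_filter; apply: cF; have := H a ltac:(lra); lra.
  + apply: cvg_at_left_filter; apply: cF; have := H b ltac:(lra); lra.
- move=> t; rewrite in_itv/= => /andP[at_ tb]; rewrite derive1E.
  have ts : 0 < c * (t - s) by have := H t ltac:(lra); lra.
  by have ? := D t ts; rewrite derive_val.
Qed.

(** The intervals where c (t - s) >= 1 / (i + 1) exhaust the side of s on which the integrand is
    nonzero; [lo] and [hi] name their ends for either sign of c. *)
Lemma integral_isq_aff01 (c s : R) (lo hi : nat -> R) : c ^+ 2 = 1 -> 0 <= s <= 1 ->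
  (forall i t, (lo i <= t <= hi i) = ((0 <= t <= 1) && (i.+1%:R^-1 <= c * (t - s)))) ->
  (\int[mu]_(t in `[0%R, 1%R]) (isq (c * (t - s)))%:E <= 2%:E)%E.
Proof.
move=> c1 s01 lohi.
have cE : c = 1 \/ c = -1.
  by have /orP[/eqP ->|/eqP ->] : (c == 1) || (c == -1); rewrite -?eqf_sqr ?c1 ?expr1n//; [left|right].
pose S (i : nat) : set (measurableTypeR R) := [set` `[lo i, hi i]].
have SE i t : S i t <-> (0 <= t <= 1) /\ i.+1%:R^-1 <= c * (t - s).
  by rewrite /S /= in_itv/= lohi; split => /andP.
have i0 i : 0 < i.+1%:R^-1 :> R by rewrite invr_gt0.
rewrite integral_mkcond (_ : _ \_ _ =
    (fun t => (isq (c * (t - s)))%:E) \_ (\bigcup_i S i)); last first.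
  apply/funext => t; rewrite !patchE; case: ifPn => [|] /=.
    rewrite inE/= in_itv/= => t01; case: ifPn => //; rewrite notin_setE/= => nS.
    have [ts|ts] := leP (c * (t - s)) 0.
      by rewrite /isq ler0_sqrtr// invr0.
    exfalso; apply: nS; exists (Num.bound (c * (t - s))^-1) => //.
    apply/SE; split=> //; rewrite invf_ple ?posrE// ltW// (lt_le_trans (archi_boundP _))//.
      by rewrite invr_ge0 ltW.
    by rewrite ler_nat.
  rewrite notin_setE/= in_itv/= => t01; case: ifPn => //.
  by rewrite inE => -[i _ /SE[]].
rewrite -integral_mkcond; apply: ge0_integral_exhaust.
- move=> n m nm; apply/subsetPset => t /SE[t01 ti]; apply/SE; split=> //.
  by apply: le_trans ti; rewrite lef_pV2 ?posrE// ler_nat.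
- by move=> i; exact: measurable_itv.
- exact: measurable_isq_aff.
- by move=> t; exact: isq_ge0.
move=> i; rewrite /S; have [ab|ba] := ltP (lo i) (hi i).
  apply: integral_isq_aff_le => // t; rewrite lohi => /andP[t01 ti].
  by rewrite (lt_le_trans (i0 i) ti)/=; case: cE => ->; lra.
have := ba; rewrite le_eqVlt => /predU1P[<-|ba'].
  by rewrite set_itv1 integral_set1 lee_fin.
by rewrite set_itv_ge ?integral_set0 ?lee_fin// bnd_simp -ltNge.
Qed.

Lemma isq_dist_split (t s : R) : isq `|t - s| = isq (1 * (t - s)) + isq (-1 * (t - s)).
Proof.
rewrite mul1r mulN1r; have [ts|ts] := leP 0 (t - s).
  by rewrite (ger0_norm ts) [isq (- _)]/isq ler0_sqrtr ?oppr_le0// invr0 addr0.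
by rewrite (ltr0_norm ts) [isq (t - s)]/isq ler0_sqrtr ?(ltW ts)// invr0 add0r.
Qed.

Lemma integral_isq_dist (s : R) : 0 <= s <= 1 ->
  (\int[mu]_(t in `[0%R, 1%R]) (isq `|t - s|)%:E <= 4%:E)%E.
Proof.
move=> s01; under eq_integral do rewrite isq_dist_split EFinD.
rewrite ge0_integralD//=; last 4 first.
- by move=> t _; rewrite lee_fin isq_ge0.
- by apply/measurable_EFinP; exact: measurable_isq_aff.
- by move=> t _; rewrite lee_fin isq_ge0.
- by apply/measurable_EFinP; exact: measurable_isq_aff.
rewrite (_ : 4 = 2 + 2); last by ring.
have i0 i : 0 < i.+1%:R^-1 :> R by rewrite invr_gt0.
rewrite EFinD; apply: leeD.
  apply: (@integral_isq_aff01 1 s (fun i => s + i.+1%:R^-1) (fun=> 1)) => //.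
    by rewrite expr1n.
  move=> i t; have := i0 i; set d := _^-1 => d0.
  by apply/idP/idP => [/andP[]|/andP[/andP[]]]; rewrite mul1r; lra.
apply: (@integral_isq_aff01 (-1) s (fun=> 0) (fun i => s - i.+1%:R^-1)) => //.
  by rewrite sqrrN expr1n.
move=> i t; have := i0 i; set d := _^-1 => d0.
by apply/idP/idP => [/andP[]|/andP[/andP[]]]; rewrite mulN1r; lra.
Qed.

Lemma measurable_isq_dist (s : R) (D : set R) : measurable_fun D (fun t : R => isq `|t - s|).
Proof.
rewrite (_ : (fun _ => _) = (fun t => isq (1 * (t - s)) + isq (-1 * (t - s)))).
  by apply: measurable_funD; exact: measurable_isq_aff.
by apply/funext => t; exact: isq_dist_split.
Qed.

Lemma integrable_isq_dist (s : R) : 0 <= s <= 1 ->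
  mu.-integrable `[0, 1] (EFin \o (fun t => isq `|t - s|)).
Proof.
move=> s01; apply/integrableP; split.
  by apply/measurable_EFinP; exact: measurable_isq_dist.
under eq_integral do rewrite /= ger0_norm ?isq_ge0//.
by apply: le_lt_trans (integral_isq_dist s01) _; rewrite ltry.
Qed.

Lemma Rintegral_isq_dist (s : R) : 0 <= s <= 1 ->
  \int[mu]_(t in `[0, 1]) (isq `|t - s|) <= 4.
Proof.
move=> s01; rewrite -lee_fin fineK; first exact: integral_isq_dist.
exact: integrable_fin_num (integrable_isq_dist s01).
Qed.

Lemma ler_wln (x y : R) : 0 < x -> x <= y -> ln x <= ln y.
Proof. by move=> x0 xy; rewrite ler_ln ?posrE// (lt_le_trans x0). Qed.

Lemma ln_le_subr1 (x : R) : 0 < x -> ln x <= x - 1.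
Proof. by move=> x0; have := @le_ln1Dx R (x - 1); rewrite subrKC; apply; lra. Qed.

(** With u = w^-4 this is 0 <= ln w <= w, since isq u = w^2. At u = 0 the left side is 0 by the
    convention ln 0 = 0. *)
Lemma sqr_ln_le_isq (u : R) : 0 <= u <= 1 -> ln u ^+ 2 <= 16 * isq u.
Proof.
move=> /andP[u0 u1]; have [->|un0] := eqVneq u 0.
  by rewrite ln0// expr0n/= mulr_ge0 ?isq_ge0.
have {un0}u0 : 0 < u by rewrite lt_neqAle eq_sym un0.
set w := Num.sqrt (isq u).
have iu0 : 0 < isq u by rewrite invr_gt0 sqrtr_gt0.
have w0 : 0 < w by rewrite sqrtr_gt0.
have w2 : w ^+ 2 = isq u by rewrite sqr_sqrtr// ltW.
have uE : u = (w ^+ 4)^-1.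
  by rewrite (exprM w 2 2) w2 exprVn invrK sqr_sqrtr// ltW.
have lnu : ln u = - 4 * ln w by rewrite uE lnV ?posrE ?exprn_gt0// lnXn//; ring.
have w1 : ln w <= w by have := ln_le_subr1 w0; lra.
have lw0 : 0 <= ln w by have := ln_le0 u1; rewrite lnu; lra.
by rewrite lnu -w2; nra.
Qed.

Lemma measurable_ln_dist (s : R) (D : set R) : measurable_fun D (fun t : R => ln `|t - s|).
Proof.
apply: measurable_funTS; apply: (measurableT_comp (@measurable_ln R)).
by apply: measurableT_comp => //; exact: measurable_funB.
Qed.

End SingularIntegrals.

(** * Quadrature of logarithmic singularities *)

Section QuadratureErrors.
Context {R : realType}.
Local Notation mu := (@lebesgue_measure R).
Local Notation rint D f := (mu.-integrable D (EFin \o f)).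

Lemma rintegrableD (D : set (measurableTypeR R)) (f g : R -> R) : measurable D ->
  rint D f -> rint D g -> rint D (fun t => f t + g t).
Proof. by move=> mD fi gi; have := integrableD mD fi gi. Qed.

Lemma rintegrableB (D : set (measurableTypeR R)) (f g : R -> R) : measurable D ->
  rint D f -> rint D g -> rint D (fun t => f t - g t).
Proof. by move=> mD fi gi; have := integrableB mD fi gi. Qed.

Lemma rintegrableZ (D : set (measurableTypeR R)) (k : R) (f : R -> R) : measurable D ->
  rint D f -> rint D (fun t => k * f t).
Proof. by move=> mD fi; have := integrableZl mD k fi. Qed.

Lemma le_rintegrable (D : set (measurableTypeR R)) (f g : R -> R) : measurable D ->
  measurable_fun D f -> (forall t, D t -> `|f t| <= g t) -> rint D g -> rint D f.
Proof.
move=> mD mf fg gi; apply: (le_integrable mD _ _ gi); first exact/measurable_EFinP.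
by move=> t Dt /=; rewrite lee_fin (le_trans (fg t Dt))// ler_norm.
Qed.

Lemma rintegrableM (a b : R) (h g : R -> R) : continuous h ->
  rint `[a, b] g -> rint `[a, b] (fun t => h t * g t).
Proof.
move=> ch gi; apply: (@integrableMr _ _ _ mu `[a, b] _ h (EFin \o g)) => //.
  by apply: measurable_funTS; exact: continuous_measurable_fun.
have : compact (h @` `[a, b]).
  apply: continuous_compact; first exact: continuous_subspaceT.
  exact: segment_compact.
move/compact_bounded => [N [Nr HN]]; exists N; split => // x Nx t tab.
by apply: (HN x Nx); exists t.
Qed.

Lemma rintegrable_cst (a b c : R) : rint `[a, b] (fun=> c).
Proof. by apply: integrable_continuous => x; exact: cvg_cst. Qed.

Lemma rintegrable_obnd (a b : R) (f : R -> R) : rint `[a, b] f -> rint `]a, b] f.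
Proof.
by move=> fi; apply: integrableS fi => //; apply: subset_itvr; rewrite bnd_simp.
Qed.

Lemma eq_rintegrable (D : set (measurableTypeR R)) (f g : R -> R) : measurable D ->
  (forall t, D t -> f t = g t) -> rint D f -> rint D g.
Proof.
move=> mD fg; apply: eq_integrable => // t; rewrite inE => Dt.
by rewrite /= fg.
Qed.

Lemma integrable_isq : rint `[0, 1] isq.
Proof.
have z01 : 0 <= (0 : R) <= 1 by lra.
apply: eq_rintegrable (integrable_isq_dist z01) => //.
by move=> t /=; rewrite in_itv/= => /andP[t0 _]; rewrite subr0 ger0_norm.
Qed.

Lemma Rintegral_isq : \int[mu]_(t in `[0, 1]) isq t <= 4.
Proof.
apply: le_trans (@Rintegral_isq_dist R 0 _); last by lra.
rewrite le_eqVlt; apply/orP; left; apply/eqP.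
apply: eq_Rintegral => t; rewrite inE/= in_itv/= => /andP[t0 _].
by rewrite subr0 ger0_norm.
Qed.

Lemma ln_le_isq (t : R) : 0 < t -> - ln t <= 2 * isq t.
Proof.
move=> t0; have s0 : 0 < Num.sqrt t by rewrite sqrtr_gt0.
have tE : t = (isq t) ^- 2 by rewrite /isq exprVn invrK sqr_sqrtr// ltW.
have i0 : 0 < isq t by rewrite invr_gt0.
have := ln_le_subr1 i0.
have -> : ln t = - (ln (isq t) *+ 2) by rewrite -lnXn// -lnV ?posrE ?exprn_gt0// -tE.
lra.
Qed.

(* F is a Lipschitz function of ln t. *)
Lemma measurable_loglip (F : R -> R) (A : R) :
  (forall t t' : R, 0 < t -> t <= t' -> t' <= 1 -> `|F t - F t'| <= A * (ln t' - ln t)) ->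
  measurable_fun (`]0, 1]%classic : set R) F.
Proof.
move=> HF; pose H (u : R) : R := F (expR (Num.min u 0)).
have A0 : 0 <= A.
  have := HF (expR (-1)) 1 (expR_gt0 _) _ (lexx _).
  by rewrite ln1 expRK opprK add0r mulr1 => /(_ _)/(le_trans _); apply=> //;
    rewrite -(@expR0 R) ler_expR; lra.
have HH (u v : R) : `|H u - H v| <= A * `|u - v|.
  wlog uv : u v / u <= v.
    move=> W; have [/W//|/ltW/W] := leP u v; by rewrite distrC (distrC u).
  have m0 (w : R) : Num.min w 0 <= 0 by rewrite ge_min lexx orbT.
  have muv : Num.min u 0 <= Num.min v 0.
    by rewrite le_min !ge_min uv lexx orbT.
  apply: (le_trans (HF _ _ (expR_gt0 _) _ _)).
  - by rewrite ler_expR.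
  - by rewrite -(@expR0 R) ler_expR.
  rewrite !expRK; apply: ler_wpM2l => //; rewrite (ler0_norm (_ : u - v <= 0)); last by lra.
  by have [u0|u0] := leP u 0; have [v0|v0] := leP v 0; lra.
apply: (@eq_measurable_fun _ _ _ _ _ (H \o @ln R)).
  move=> t; rewrite inE/= in_itv/= => /andP[t0 t1].
  by rewrite /H min_l ?ln_le0// lnK.
apply: measurable_funTS; apply: measurableT_comp; last exact: measurable_ln.
apply: continuous_measurable_fun; exact: continuous_lip HH.
Qed.

Lemma ln_ratio_le (b c : R) : 0 < b -> b <= c -> ln c - ln b <= (c - b) / b.
Proof.
move=> b0 bc; have c0 : 0 < c by lra.
rewrite -ln_div ?posrE//; apply: (le_trans (ln_le_subr1 _)); first by rewrite divr_gt0.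
by rewrite mulrBl divff// gt_eqF.
Qed.

(** An even function of v with values in [d, 1] for d <= 1: d = 1/M keeps away from a singularity at
    0, and d = 0 gives a retraction of the line onto [0, 1]. *)
Definition clamp (d v : R) : R := Num.max (Num.min `|v| 1) d.

Lemma clamp_ge d v : d <= clamp d v. Proof. by rewrite le_max lexx orbT. Qed.

Lemma clamp_le1 d v : d <= 1 -> clamp d v <= 1.
Proof. by move=> d1; rewrite ge_max ge_min lexx orbT. Qed.

Lemma clampN d v : clamp d (- v) = clamp d v.
Proof. by rewrite /clamp normrN. Qed.

Lemma max_lip (a b d : R) : `|Num.max a d - Num.max b d| <= `|a - b|.
Proof.
wlog ab : a b / a <= b.
  by move=> W; have [/W//|/ltW/W] := leP a b; rewrite distrC (distrC b).
rewrite distrC (distrC a) [leRHS]ger0_norm ?subr_ge0// ger0_norm.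
  by have [ad|ad] := leP a d; have [bd|bd] := leP b d; lra.
by have [ad|ad] := leP a d; have [bd|bd] := leP b d; lra.
Qed.

Lemma min_lip (a b d : R) : `|Num.min a d - Num.min b d| <= `|a - b|.
Proof.
wlog ab : a b / a <= b.
  by move=> W; have [/W//|/ltW/W] := leP a b; rewrite distrC (distrC b).
rewrite distrC (distrC a) [leRHS]ger0_norm ?subr_ge0// ger0_norm.
  by have [ad|ad] := leP a d; have [bd|bd] := leP b d; lra.
by have [ad|ad] := leP a d; have [bd|bd] := leP b d; lra.
Qed.

Lemma clamp_lip d u v : `|clamp d u - clamp d v| <= `|u - v|.
Proof.
apply: le_trans (ler_dist_dist u v).
exact: le_trans (max_lip _ _ _) (min_lip _ _ _).
Qed.

(* Jackson's estimate for v |-> F (v^2), made constant for |v| <= 1/M: its Lipschitz constant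
   near v is of the order of A/v, whence the factor 1/sqrt t. *)
Lemma jackson_loglip : exists2 C : R, 0 <= C & forall M (F : R -> R) (A : R),
  (0 < M)%N -> 0 <= A ->
  (forall t t' : R, 0 < t -> t <= t' -> t' <= 1 -> `|F t - F t'| <= A * (ln t' - ln t)) ->
  exists2 q : {poly R}, (size q <= M)%N &
    forall t : R, 0 < t <= 1 -> `|q.[t] - F t| <= C * A / M%:R * isq t.
Proof.
have [C1 C10 HJ] := @jackson R.
exists (4 * C1 + 2); first by lra.
move=> M F A M0 A0 HF.
have M0' : 0 < M%:R :> R by rewrite ltr0n.
have M1 : 1 <= M%:R :> R by rewrite ler1n.
pose d : R := M%:R^-1.
have d0 : 0 < d by rewrite invr_gt0.
have d1 : d <= 1 by rewrite invf_le1.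
have Md : M%:R * d = 1 by rewrite mulfV// gt_eqF.
clearbody d.
pose G (v : R) : R := F (clamp d v ^+ 2).
have cpos v : 0 < clamp d v by apply: lt_le_trans (clamp_ge _ _).
have csq1 v : clamp d v ^+ 2 <= 1.
  by rewrite expr_le1// ?clamp_le1// ltW.
have MC v : 1 <= M%:R * clamp d v.
  by rewrite -[leLHS]Md; apply: ler_wpM2l; [lra|exact: clamp_ge].
have Gln u v : clamp d u <= clamp d v ->
    `|G u - G v| <= 2 * A * (ln (clamp d v) - ln (clamp d u)).
  move=> uv; apply: (le_trans (HF _ _ _ _ _)) => //.
  - by rewrite exprn_gt0.
  - by rewrite ler_pXn2r ?nnegrE// ltW.
  - by rewrite !lnXn//; lra.
have Glip u v : `|G u - G v| <= (2 * A * M%:R) * `|u - v|.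
  wlog uv : u v / clamp d u <= clamp d v.
    move=> W; have [/W//|/ltW/W] := leP (clamp d u) (clamp d v).
    by rewrite distrC (distrC v).
  apply: (le_trans (Gln u v uv)); rewrite -[leRHS]mulrA; apply: ler_wpM2l; first by lra.
  apply: (le_trans (ln_ratio_le (cpos u) uv)).
  rewrite ler_pdivrMr//; have := clamp_lip d u v; rewrite distrC ger0_norm ?subr_ge0// => h.
  apply: (le_trans h); by rewrite mulrAC ler_peMl.
have Geven v : G (- v) = G v by rewrite /G clampN.
have [q sq Hq] := HJ M G _ M0 Glip Geven.
exists q => // t /andP[t0 t1].
pose v : R := Num.sqrt t.
have v0 : 0 < v by rewrite sqrtr_gt0.
have v1 : v <= 1 by rewrite -sqrtr1 ler_wsqrtr.
have v2 : v ^+ 2 = t by rewrite sqr_sqrtr// ltW.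
have isqE : isq t = v^-1 by [].
clearbody v.
have Hv := Hq v (4 * A / clamp d v).
have {Hv} : `|q.[v ^+ 2] - G v| <= C1 * (4 * A / clamp d v) / M%:R.
  apply: Hv; first by lra.
    by rewrite divr_ge0// ?mulr_ge0// ltW.
  move=> u _; set a : R := clamp d v; have a0 : 0 < a by exact: cpos.
  set b : R := clamp d u; have b0 : 0 < b by exact: cpos.
  have := normr_ge0 (u - v); set D : R := `|u - v| => D0.
  have -> : (u - v) ^+ 2 = D ^+ 2 by rewrite real_normK ?num_real.
  have abD : `|a - b| <= D by rewrite distrC; exact: clamp_lip.
  (* Away from 0 the slope is at most 2 A / a. Towards 0 it is at most 2 A / b, with a / b <= 1 + M
     D since b >= 1/M; the quadratic term in the hypothesis of [jackson] absorbs this growth. *)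
  have key : `|G u - G v| <= 2 * A / a * (D * (1 + M%:R * D)).
    have [ab|ba] := leP a b.
      rewrite distrC; apply: (le_trans (Gln v u ab)).
      rewrite -[leRHS]mulrA; apply: ler_wpM2l; first by lra.
      apply: (le_trans (ln_ratio_le a0 ab)); rewrite mulrC; apply: ler_wpM2l.
        by rewrite invr_ge0 ltW.
      apply: (@le_trans _ _ D); first by move: abD; rewrite ler_norml -/a -/b; lra.
      by rewrite ler_peMr// lerDl mulr_ge0.
    apply: (le_trans (Gln u v (ltW ba))); rewrite -[leRHS]mulrA; apply: ler_wpM2l; first by lra.
    apply: (le_trans (ln_ratio_le b0 (ltW ba))); rewrite -/a -/b.
    have abD' : a - b <= D by exact: le_trans (ler_norm _) abD.
    have -> : (a - b) / b = a^-1 * ((a - b) * (1 + (a - b) / b)) by field; lra.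
    apply: ler_wpM2l; first by rewrite invr_ge0 ltW.
    have h0 : 0 <= (a - b) / b by rewrite divr_ge0 ?subr_ge0 ?(ltW ba)// ltW.
    apply: ler_pM; [by rewrite subr_ge0 ltW|by rewrite addr_ge0|exact: abD'|rewrite lerD2l].
    rewrite ler_pdivrMr//; apply: (le_trans abD').
    by rewrite mulrAC ler_peMl// MC.
  apply: (le_trans key).
  have -> : 4 * A / a / M%:R * (1 + M%:R ^+ 2 * D ^+ 2) =
            2 * A / a * (2 * (1 + (M%:R * D) ^+ 2) / M%:R) by field; lra.
  apply: ler_wpM2l; first by rewrite divr_ge0// ?mulr_ge0// ltW.
  rewrite ler_pdivlMr//; have MD0 : 0 <= M%:R * D by rewrite mulr_ge0.
  move: MD0; rewrite (_ : D * _ * _ = M%:R * D * (1 + M%:R * D)); last by ring.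
  by move: (M%:R * D) => y y0; have := sqr_ge0 (y - 1); nra.
rewrite v2 => Hv.
have h1 : C1 * (4 * A / clamp d v) / M%:R <= 4 * C1 * A / M%:R * isq t.
  rewrite isqE (_ : C1 * _ / _ = 4 * C1 * A / M%:R * (clamp d v)^-1); last by ring.
  apply: ler_wpM2l; first by rewrite divr_ge0// ?mulr_ge0.
  rewrite lef_pV2 ?posrE// /clamp le_max le_min (ger0_norm (ltW v0)) lexx v1.
  by [].
(* Clamping changes the value only for v < 1/M, and there by at most 2 A (ln d - ln v) <= 2 A d /
   v. *)
have h2 : `|G v - F t| <= 2 * A / M%:R * isq t.
  rewrite /G isqE; have [vd|dv] := leP v d.
    have -> : clamp d v = d by rewrite /clamp (ger0_norm (ltW v0)) min_l// max_r.
    rewrite distrC -v2; apply: (le_trans (HF _ _ _ _ _)).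
    - by rewrite exprn_gt0.
    - by rewrite ler_pXn2r ?nnegrE// ltW.
    - by rewrite expr_le1// ltW.
    have dM : M%:R^-1 = d by apply: (@mulfI _ M%:R); rewrite ?gt_eqF// Md mulfV// gt_eqF.
    have h := ln_ratio_le v0 vd.
    have {}h : ln d - ln v <= d / v.
      by apply: (le_trans h); apply: ler_wpM2r; [rewrite invr_ge0 ltW|lra].
    rewrite dM !lnXn// (_ : A * _ = 2 * A * (ln d - ln v)); last by ring.
    by rewrite -[leRHS]mulrA; apply: ler_wpM2l; first lra.
  have -> : clamp d v = v by rewrite /clamp (ger0_norm (ltW v0)) min_l// max_l// ltW.
  by rewrite v2 subrr normr0 mulr_ge0// ?invr_ge0 ?(ltW v0)// divr_ge0// mulr_ge0.
have := ler_normD (q.[t] - G v) (G v - F t); rewrite addrA subrK => h3.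
apply: (le_trans h3); apply: (le_trans (lerD (le_trans Hv h1) h2)).
by rewrite le_eqVlt; apply/orP; left; apply/eqP; ring.
Qed.

Lemma rintegrable_oo_cc (f : R -> R) : rint `]0, 1[ f -> rint `[0, 1] f.
Proof.
move=> /integrableP[mf intf]; have moc : measurable_fun (`]0, 1]%classic : set R) (EFin \o f).
  exact/emeasurable_fun_itv_bndo_bndcP.
apply/integrableP; split; first exact/emeasurable_fun_itv_obnd_cbndP.
rewrite -integral_itv_obnd_cbnd//; last exact: measurableT_comp.
by rewrite -integral_itv_bndo_bndc//; exact: measurableT_comp.
Qed.

Lemma Rintegral_oo_cc (f : R -> R) : rint `[0, 1] f ->
  \int[mu]_(t in `]0, 1[) f t = \int[mu]_(t in `[0, 1]) f t.
Proof.
move=> fi; rewrite Rintegral_itv_bndo_bndc; first last.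
  by apply: integrableS fi => //; apply: subset_itv; rewrite bnd_simp.
by rewrite Rintegral_itv_obnd_cbnd//; exact: rintegrable_obnd.
Qed.

(** The rule is exact on [q], so only F - q counts, and [w] bounds it both under the integral and at
    the nodes, which are interior. Integrability of F follows from that of w. *)
Lemma quad_error_approx M (x lam : 'I_M -> R) (F w : R -> R) (q : {poly R}) (W : R) :
  gauss_rule x lam -> (size q <= 2 * M)%N ->
  measurable_fun (`]0, 1[%classic : set R) F -> rint `[0, 1] w ->
  (forall t : R, 0 < t < 1 -> `|q.[t] - F t| <= w t) ->
  \int[mu]_(t in `[0, 1]) w t + \sum_h lam h * w (x h) <= W ->
  rint `[0, 1] F /\
  `|\int[mu]_(t in `[0, 1]) F t - \sum_h lam h * F (x h)| <= W.
Proof.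
move=> [x01 lam0 ex] sq mF iw Hq HW.
have iq : rint `[0, 1] (fun t => q.[t]).
  by apply: integrable_continuous; exact: continuous_horner_poly.
have sub01 f : rint `[0, 1] f -> rint `]0, 1[ f.
  by move=> fi; apply: integrableS fi => //; apply: subset_itv; rewrite bnd_simp.
have iF : rint `[0, 1] F.
  apply: rintegrable_oo_cc; apply: (@le_rintegrable _ _ (fun t => `|q.[t]| + w t)) => //.
    move=> t /=; rewrite in_itv/= => /Hq h.
    have := ler_normB q.[t] (q.[t] - F t); rewrite opprB addrC subrK => h2.
    exact: le_trans h2 (lerD (lexx _) h).
  apply: sub01; apply: rintegrableD => //; first by have := integrable_norm iq.
have qE : \int[mu]_(t in `[0, 1]) q.[t] = \sum_h lam h * q.[x h].
  by rewrite ex// pintI.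
split=> //; apply: le_trans HW.
rewrite (_ : _ - _ = - (\int[mu]_(t in `[0, 1]) (q.[t] - F t))
    + \sum_h lam h * (q.[x h] - F (x h))); last first.
  rewrite RintegralB// qE.
  under [X in _ = _ + X]eq_bigr do rewrite mulrBr.
  by rewrite sumrB; ring.
apply: (le_trans (ler_normD _ _)); rewrite normrN; apply: lerD.
  have iqF : rint `[0, 1] (fun t => q.[t] - F t) by exact: rintegrableB.
  apply: (le_trans (le_normr_Rintegral _ _)) => //.
  have inqF : rint `[0, 1] (fun t => `|q.[t] - F t|) by have := integrable_norm iqF.
  rewrite -!Rintegral_oo_cc//; apply: le_Rintegral => //; exact: sub01.
apply: (le_trans (ler_norm_sum _ _ _)); apply: ler_sum => h _.
by rewrite normrM ger0_norm//; apply: ler_wpM2l => //; exact: Hq.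
Qed.

End QuadratureErrors.

(** * The product rule for the kernel ln |t - s| *)

Section ProductRule.
Context {R : realType}.
Local Notation mu := (@lebesgue_measure R).
Local Notation rint D f := (mu.-integrable D (EFin \o f)).

Lemma Rintegral01_cst (c : R) : \int[mu]_(t in `[0, 1]) c = c.
Proof.
transitivity (pint 0 1 c%:P); last by rewrite pintC// subr0 mulr1.
by rewrite pintI; apply: eq_Rintegral => t _; rewrite hornerC.
Qed.

Lemma dist_le1 (s t : R) : 0 <= s <= 1 -> 0 <= t <= 1 -> 0 <= `|t - s| <= 1.
Proof. by move=> s01 t01; rewrite normr_ge0 ler_norml; lra. Qed.

Lemma integrable_sqr_ln_dist (s : R) : 0 <= s <= 1 ->
  rint `[0, 1] (fun t => ln `|t - s| ^+ 2).
Proof.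
move=> s01; apply: (@le_rintegrable _ _ _ (fun t => 16 * isq `|t - s|)) => //.
- by apply: measurable_funX; exact: measurable_ln_dist.
- move=> t /=; rewrite in_itv/= => t01; rewrite ger0_norm ?sqr_ge0//.
  by apply: sqr_ln_le_isq; exact: dist_le1.
- by apply: rintegrableZ => //; exact: integrable_isq_dist.
Qed.

Lemma Rintegral_sqr_ln_dist (s : R) : 0 <= s <= 1 ->
  \int[mu]_(t in `[0, 1]) (ln `|t - s| ^+ 2) <= 64.
Proof.
move=> s01; apply: (@le_trans _ _ (\int[mu]_(t in `[0, 1]) (16 * isq `|t - s|))).
  apply: le_Rintegral => //.
  - exact: integrable_sqr_ln_dist.
  - by apply: rintegrableZ => //; exact: integrable_isq_dist.
  - move=> t /=; rewrite in_itv/= => t01.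
    by apply: sqr_ln_le_isq; exact: dist_le1.
rewrite RintegralZl//; last exact: integrable_isq_dist.
by have := Rintegral_isq_dist s01; lra.
Qed.

Lemma integrable_ln_dist (s : R) : 0 <= s <= 1 -> rint `[0, 1] (fun t => ln `|t - s|).
Proof.
move=> s01; apply: (@le_rintegrable _ _ _ (fun t => 1 + ln `|t - s| ^+ 2)) => //.
- exact: measurable_ln_dist.
- move=> t _; move: (ln _) => y; rewrite -[in leRHS]real_normK ?num_real//.
  by move: (normr_ge0 y); move: `|y| => z z0; have := sqr_ge0 (z - 1); nra.
- apply: rintegrableD => //; first exact: rintegrable_cst.
  exact: integrable_sqr_ln_dist.
Qed.

Section LogSum.
Variables (leg : nat -> {poly R}) (s : R).
Hypotheses (legP : orthonormal_legendre leg) (s01 : 0 <= s <= 1).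

(** The orthogonal projection of ln |t - s| onto polynomials of degree below M; the product rule
    puts its values at the nodes in place of the logarithm. *)
Definition log_sum M : {poly R} := \sum_(nu < M) log_moment leg nu s *: leg nu.

Lemma horner_log_sum M t :
  (log_sum M).[t] = \sum_(nu < M) log_moment leg nu s * (leg nu).[t].
Proof. by rewrite horner_sum; apply: eq_bigr => i _; rewrite hornerZ. Qed.

Lemma size_log_sum M : (size (log_sum M) <= M)%N.
Proof.
rewrite (leq_trans (size_sum _ _ _))//; apply/bigmax_leqP => i _.
by rewrite (leq_trans (size_scale_leq _ _))// (legP.1 i).1.
Qed.

Lemma integrable_poly_ln (q : {poly R}) : rint `[0, 1] (fun t => q.[t] * ln `|t - s|).
Proof.
by apply: rintegrableM; [exact: continuous_horner_poly | exact: integrable_ln_dist].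
Qed.

(** The projection drops only components orthogonal to q; the proof expands q in the Legendre
    basis. *)
Lemma pint_log_sum M (q : {poly R}) : (size q <= M)%N ->
  pint 0 1 (q * log_sum M) = \int[mu]_(t in `[0, 1]) (q.[t] * ln `|t - s|).
Proof.
move=> sq; transitivity (\sum_(i < M) pint 0 1 (q * leg i) * log_moment leg i s).
  rewrite mulr_sumr pint_sum; apply: eq_bigr => i _.
  by rewrite -scalerAr pintZ mulrC.
rewrite {2}(legendre_span legP sq); under [RHS]eq_Rintegral => t _.
  rewrite horner_sum mulr_suml.
  under eq_bigr => i _ do rewrite hornerZ -mulrA.
  over.
rewrite Rintegral_sum//; last first.
  by move=> i; apply: rintegrableZ => //; exact: integrable_poly_ln.
by apply: eq_bigr => i _; rewrite RintegralZl//; exact: integrable_poly_ln.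
Qed.

(** [pint_log_sum] with q = S turns S^2 into S times the logarithm, and 2ab <= a^2 + b^2 absorbs S.
    The constant 64 bounds the integral of the squared logarithm. *)
Lemma pint_sqr_log_sum M : pint 0 1 (log_sum M * log_sum M) <= 64.
Proof.
set S := log_sum M; suff : 2 * pint 0 1 (S * S) <= pint 0 1 (S * S) + 64 by lra.
have iSS : rint `[0, 1] (fun t => (S * S).[t]).
  by apply: integrable_continuous; exact: continuous_horner_poly.
have igg := integrable_sqr_ln_dist s01.
have h : 2 * pint 0 1 (S * S) = \int[mu]_(t in `[0, 1]) (2 * (S.[t] * ln `|t - s|)).
  by rewrite pint_log_sum ?size_log_sum// RintegralZl//; exact: integrable_poly_ln.
rewrite h.
apply: (@le_trans _ _ (\int[mu]_(t in `[0, 1]) ((S * S).[t] + ln `|t - s| ^+ 2))).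
  apply: le_Rintegral => //.
  - by apply: rintegrableZ => //; exact: integrable_poly_ln.
  - exact: rintegrableD.
  - move=> t _; rewrite hornerM -/S; move: S.[t] (ln _) => a b.
    by have := sqr_ge0 (a - b); rewrite expr2; lra.
rewrite RintegralD// -pintI lerD2l; exact: Rintegral_sqr_ln_dist.
Qed.

End LogSum.

Lemma quad_error_product : exists2 C : R, 0 <= C &
  forall M (x lam : 'I_M -> R) (leg : nat -> {poly R}) (phi : R -> R) (L s : R),
  (0 < M)%N -> 0 <= L -> gauss_rule x lam -> orthonormal_legendre leg -> 0 <= s <= 1 ->
  continuous phi ->
  (forall t t' : R, 0 <= t <= 1 -> 0 <= t' <= 1 -> `|phi t - phi t'| <= L * `|t - t'|) ->
  `|\int[mu]_(t in `[0, 1]) (phi t * ln `|t - s|)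
    - \sum_h lam h * phi (x h) * (\sum_(nu < M) log_moment leg nu s * (leg nu).[x h])|
  <= C * L / M%:R.
Proof.
have [C1 C10 HJ] := @jackson R.
(* With c = 2 C1 L / M the distance from phi to q, the integral and the sum each cost c (1 + 64) /
   2. *)
exists (130 * C1); first by rewrite mulr_ge0.
move=> M x lam leg phi L s M0 L0 g legP s01 cphi Hphi.
have M0' : 0 < M%:R :> R by rewrite ltr0n.
pose G (v : R) : R := phi (clamp 0 v ^+ 2).
have c01 (v : R) : 0 <= clamp 0 v <= 1 by rewrite clamp_ge clamp_le1.
have csq (v : R) : 0 <= clamp 0 v ^+ 2 <= 1.
  by rewrite sqr_ge0 expr_le1//; case/andP: (c01 v).
have Glip u v : `|G u - G v| <= (2 * L) * `|u - v|.
  apply: (le_trans (Hphi _ _ (csq u) (csq v))).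
  rewrite subr_sqr normrM [2 * L]mulrC -mulrA; apply: ler_wpM2l => //.
  rewrite mulrC; apply: ler_pM => //; last exact: clamp_lip.
  by rewrite ler_norml; have := c01 u; have := c01 v; lra.
have Geven v : G (- v) = G v by rewrite /G clampN.
have [q sq Hq] := HJ M G _ M0 Glip Geven.
set c : R := C1 * (2 * L) / M%:R.
have c0 : 0 <= c by rewrite divr_ge0// mulr_ge0// mulr_ge0.
have {}Hq (t : R) : 0 <= t <= 1 -> `|phi t - q.[t]| <= c.
  move=> /andP[t0 t1]; have v0 := sqrtr_ge0 t.
  have v1 : Num.sqrt t <= 1 by rewrite -sqrtr1 ler_wsqrtr.
  have := Hq (Num.sqrt t) (2 * L); rewrite /G sqr_sqrtr//.
  rewrite /clamp (ger0_norm v0) min_l// max_l// sqr_sqrtr// distrC; apply.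
  - by rewrite v0.
  - by rewrite mulr_ge0.
  - move=> u _; have := Glip u (Num.sqrt t).
    rewrite /G {2}/clamp (ger0_norm v0) min_l// max_l// sqr_sqrtr// => h.
    apply: (le_trans h); rewrite -[leRHS]mulrA; apply: ler_wpM2l; first by rewrite mulr_ge0.
    rewrite mulrC ler_pdivlMr// -[in leRHS](real_normK (num_real (u - _))).
    have := normr_ge0 (u - Num.sqrt t); move: `|u - _| => D D0.
    have : 0 <= D * M%:R by rewrite mulr_ge0.
    rewrite (_ : M%:R ^+ 2 * D ^+ 2 = (D * M%:R) ^+ 2); last by ring.
    by move: (D * _) => y y0; have := sqr_ge0 (y - 1); nra.
set S := log_sum leg s M.
have [x01 lam0 ex] := g.
have ephi : rint `[0, 1] (fun t => phi t * ln `|t - s|).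
  by apply: rintegrableM => //; exact: integrable_ln_dist.
have epq : rint `[0, 1] (fun t => (phi t - q.[t]) * ln `|t - s|).
  apply: rintegrableM; last exact: integrable_ln_dist.
  by move=> t; apply: cvgB; [exact: cphi | exact: continuous_horner_poly].
(* q S has degree below 2 M, so q contributes the same to the integral and to the sum. *)
have e1 : \int[mu]_(t in `[0, 1]) (phi t * ln `|t - s|) =
    \int[mu]_(t in `[0, 1]) ((phi t - q.[t]) * ln `|t - s|) + \sum_h lam h * (q * S).[x h].
  rewrite ex; last first.
    rewrite (leq_trans (size_polyMleq _ _))// (leq_trans (leq_pred _))//.
    by rewrite mul2n -addnn leq_add// size_log_sum.
  rewrite pint_log_sum// -RintegralD//; last exact: integrable_poly_ln.
  by apply: eq_Rintegral => t _; ring.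
rewrite e1 (_ : _ + _ - _ = \int[mu]_(t in `[0, 1]) ((phi t - q.[t]) * ln `|t - s|)
    - \sum_h lam h * ((phi (x h) - q.[x h]) * S.[x h])); last first.
  rewrite -addrA -opprB; congr (_ - _).
  by rewrite -sumrB; apply: eq_bigr => h _; rewrite -horner_log_sum hornerM -/S; ring.
have amgm (y : R) : `|y| <= (1 + y ^+ 2) / 2.
  rewrite -[in leRHS]real_normK ?num_real//.
  by move: `|y| => z; have := sqr_ge0 (z - 1); nra.
apply: (le_trans (ler_normB _ _)).
rewrite (_ : 130 * C1 * L / M%:R = c * (65 / 2) + c * (65 / 2)); last by rewrite /c; field; lra.
apply: lerD.
  apply: (le_trans (le_normr_Rintegral _ _)) => //.
  have iw : rint `[0, 1] (fun t => 1 + ln `|t - s| ^+ 2).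
    apply: rintegrableD => //; first exact: rintegrable_cst.
    exact: integrable_sqr_ln_dist.
  apply: (@le_trans _ _ (\int[mu]_(t in `[0, 1]) (c / 2 * (1 + ln `|t - s| ^+ 2)))).
    apply: le_Rintegral => //.
    - by have := integrable_norm epq.
    - exact: rintegrableZ.
    - move=> t /=; rewrite in_itv/= => t01; rewrite normrM -mulrA.
      apply: ler_pM => //; first exact: Hq.
      by rewrite mulrC.
  rewrite RintegralZl// RintegralD//; last 2 first.
  - exact: rintegrable_cst.
  - exact: integrable_sqr_ln_dist.
  rewrite -mulrA; apply: ler_wpM2l => //.
  rewrite Rintegral01_cst.
  by have := Rintegral_sqr_ln_dist s01; lra.
apply: (le_trans (ler_norm_sum _ _ _)).
apply: (@le_trans _ _ (\sum_h c / 2 * (lam h + lam h * (S * S).[x h]))).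
  apply: ler_sum => h _; rewrite !normrM (ger0_norm (lam0 h)).
  rewrite (_ : c / 2 * _ = lam h * (c * ((1 + S.[x h] ^+ 2) / 2))); last first.
    by rewrite hornerM; field.
  apply: ler_wpM2l => //; apply: ler_pM => //; apply: Hq.
  by have := x01 h; lra.
rewrite -mulr_sumr big_split/= (gauss_rule_sum1 M0 g) -mulrA; apply: ler_wpM2l => //.
rewrite ex; last first.
  rewrite (leq_trans (size_polyMleq _ _))// (leq_trans (leq_pred _))//.
  by rewrite mul2n -addnn leq_add// size_log_sum.
by have := pint_sqr_log_sum legP s01 M; rewrite -/S; lra.
Qed.

End ProductRule.

(** * Integrands of the form phi * ln E *)

Section LogWeights.
Context {R : realType}.
Local Notation mu := (@lebesgue_measure R).
Local Notation rint D f := (mu.-integrable D (EFin \o f)).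

(* The data of the singular integrands phi * ln E: E may vanish at both ends, but there at most
   to first order. *)
Definition log_weight (K : nat) (phi E : R -> R) : Prop :=
  [/\ forall t t' : R, 0 <= t <= 1 -> 0 <= t' <= 1 -> `|phi t - phi t'| <= K%:R * `|t - t'|,
      forall t : R, 0 <= t <= 1 -> `|phi t| <= K%:R,
      forall t t' : R, 0 <= t <= 1 -> 0 <= t' <= 1 -> `|E t - E t'| <= K%:R * `|t - t'|,
      forall t : R, 0 <= t <= 1 -> E t <= K%:R &
      forall t : R, 0 < t < 1 -> t * (1 - t) <= K%:R * E t].

Lemma log_weight_onem K phi E : log_weight K phi E ->
  log_weight K (fun t => phi (1 - t)) (fun t => E (1 - t)).
Proof.
move=> [H1 H2 H3 H4 H5].
have o (t : R) : 0 <= t <= 1 -> 0 <= 1 - t <= 1 by lra.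
have d (t t' : R) : `|1 - t - (1 - t')| = `|t - t'|.
  by rewrite -normrN; congr `|_|; ring.
split=> [t t' /o t01 /o t'01|t /o t01|t t' /o t01 /o t'01|t /o t01|t t01].
- by rewrite -(d t t'); exact: H1.
- exact: H2.
- by rewrite -(d t t'); exact: H3.
- exact: H4.
- by have := H5 (1 - t); rewrite opprB subrKC mulrC; apply; lra.
Qed.

Lemma bernoulli (n : nat) (z : R) : 0 <= z -> 1 + n%:R * z <= (1 + z) ^+ n.
Proof.
move=> z0; elim: n => [|n IH]; first by rewrite mul0r addr0.
rewrite exprS; apply: (@le_trans _ _ ((1 + z) * (1 + n%:R * z))).
  rewrite -natr1; have : 0 <= n%:R * z * z by rewrite !mulr_ge0.
  lra.
by apply: ler_wpM2l => //; lra.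
Qed.

(* With z = t'/t - 1, the hypothesis is v <= u (1 + b z) and Bernoulli gives v/u <= (t'/t)^b. *)
Lemma ln_lip_ratio (b : nat) (u v t t' : R) : 0 < u -> 0 < v -> 0 < t -> t <= t' ->
  v <= u + b%:R * u * ((t' - t) / t) -> ln v - ln u <= b%:R * (ln t' - ln t).
Proof.
move=> u0 v0 t0 tt' vu; have t'0 : 0 < t' by lra.
rewrite -!ln_div ?posrE// mulr_natl -lnXn ?divr_gt0//.
apply: ler_wln; first by rewrite divr_gt0.
rewrite ler_pdivrMr//; apply: (le_trans vu).
rewrite (_ : t' / t = 1 + (t' - t) / t); last by field; lra.
have z0 : 0 <= (t' - t) / t by rewrite divr_ge0//; lra.
have := bernoulli b z0 => h.
by apply: le_trans (ler_wpM2r (ltW u0) h); lra.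
Qed.

Lemma log_weight_pos K phi E (t : R) : log_weight K phi E -> 0 < t < 1 -> 0 < E t.
Proof.
move=> [_ _ _ _ H] t01; have := H t t01.
have : 0 < t * (1 - t) by apply: mulr_gt0; lra.
have : 0 <= K%:R :> R by []. nra.
Qed.

Lemma ln_weight_abs K phi E (t : R) : (0 < K)%N -> log_weight K phi E ->
  0 < t <= 1 / 2 -> `|ln (E t)| <= 2 * K%:R - ln t.
Proof.
move=> K0 W t01; have E0 : 0 < E t by apply: (log_weight_pos W); lra.
have [_ _ _ H4 H5] := W.
have K1 : 1 <= K%:R :> R by rewrite ler1n.
have t0 : 0 < t by lra.
have lnt : ln t <= 0 by apply: ln_le0; lra.
have h1 : ln (E t) <= K%:R.
  by have := ln_le_subr1 E0; have := H4 t ltac:(lra); lra.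
have h2 : ln t - 2 * K%:R <= ln (E t).
  have : ln (t / (2 * K%:R)) <= ln (E t).
    apply: ler_wln; first by rewrite divr_gt0// mulr_gt0//; lra.
    rewrite ler_pdivrMr; last by rewrite mulr_gt0//; lra.
    have := H5 t ltac:(lra).
    have : t * (1 / 2) <= t * (1 - t) by apply: ler_wpM2l; lra.
    lra.
  rewrite ln_div ?posrE//; last by rewrite mulr_gt0//; lra.
  have := @ln_le_subr1 R (2 * K%:R) ltac:(lra); lra.
by rewrite ler_norml; lra.
Qed.

(** On ]0, 1/2] one has E >= t / (2 K), so that ln E is Lipschitz in ln t with constant 2 K^2. The
    variation of phi meets an unbounded ln E, which is paid for by t' - t <= t' (ln t' - ln t) and
    t' |ln (E t')| <= 2 K + 1. Freezing at 1/2 hides the other end. *)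
Lemma log_weight_loglip K phi E : (0 < K)%N -> log_weight K phi E ->
  let F t := phi (Num.min t (1 / 2)) * ln (E (Num.min t (1 / 2))) in
  forall t t' : R, 0 < t -> t <= t' -> t' <= 1 ->
  `|F t - F t'| <= (2 * K%:R ^+ 3 + K%:R * (2 * K%:R + 1)) * (ln t' - ln t).
Proof.
move=> K0 W F.
have K1 : 1 <= K%:R :> R by rewrite ler1n.
have [H1 H2 H3 H4 H5] := W.
set A : R := 2 * K%:R ^+ 3 + K%:R * (2 * K%:R + 1).
have A0 : 0 <= A by rewrite addr_ge0 ?mulr_ge0 ?addr_ge0 ?exprn_ge0.
have main (t t' : R) : 0 < t -> t <= t' -> t' <= 1 / 2 ->
    `|phi t * ln (E t) - phi t' * ln (E t')| <= A * (ln t' - ln t).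
  move=> t0 tt' t'1.
  have t'0 : 0 < t' by lra.
  have E0 : 0 < E t by apply: (log_weight_pos W); lra.
  have E0' : 0 < E t' by apply: (log_weight_pos W); lra.
  have dl0 : 0 <= ln t' - ln t by rewrite subr_ge0; exact: ler_wln.
  have Eh (u : R) : 0 < u -> u <= 1 / 2 -> u <= 2 * K%:R * E u.
    move=> u0 u1; have := H5 u ltac:(lra).
    have : u * (1 / 2) <= u * (1 - u) by apply: ler_wpM2l; lra.
    lra.
  have EL : `|E t - E t'| <= K%:R * (t' - t).
    have := H3 t t' ltac:(lra) ltac:(lra).
    by rewrite [`|t - t'|]distrC [`|t' - t|]ger0_norm//; lra.
  have bE : (2 * K ^ 2)%:R = 2 * K%:R * K%:R :> R by rewrite natrM natrX; ring.
  have step (u : R) : 0 < E u -> t <= 2 * K%:R * E u ->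
      K%:R * (t' - t) <= (2 * K ^ 2)%:R * E u * ((t' - t) / t).
    move=> Eu0 tE.
    rewrite (_ : _ * (_ / t) = K%:R * (t' - t) * (2 * K%:R * E u / t)); last by rewrite bE; ring.
    rewrite ler_peMr//; first by rewrite mulr_ge0//; lra.
    by rewrite ler_pdivlMr// mul1r.
  have dlE : `|ln (E t) - ln (E t')| <= (2 * K ^ 2)%:R * (ln t' - ln t).
    have e1 : ln (E t') - ln (E t) <= (2 * K ^ 2)%:R * (ln t' - ln t).
      apply: ln_lip_ratio => //.
      have := step t E0 (Eh t t0 ltac:(lra)); move: EL; rewrite ler_norml; lra.
    have e2 : ln (E t) - ln (E t') <= (2 * K ^ 2)%:R * (ln t' - ln t).
      apply: ln_lip_ratio => //.
      have := step t' E0' (le_trans tt' (Eh t' t'0 ltac:(lra))).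
      by move: EL; rewrite ler_norml; lra.
    by rewrite ler_norml; lra.
  have dt : t' - t <= t' * (ln t' - ln t).
    have := @ln_le_subr1 R (t / t') ltac:(by rewrite divr_gt0).
    rewrite ln_div ?posrE// => h.
    have : t' * (ln t - ln t') <= t' * (t / t' - 1) by apply: ler_wpM2l; lra.
    by rewrite (_ : t' * (t / t' - 1) = t - t'); [clear; lra | by field; rewrite gt_eqF].
  have lnE' := ln_weight_abs K0 W (_ : 0 < t' <= 1 / 2).
  have {}lnE' : t' * `|ln (E t')| <= 2 * K%:R + 1.
    have := lnE' ltac:(lra) => h.
    have h2 : t' * `|ln (E t')| <= t' * (2 * K%:R - ln t') by apply: ler_wpM2l => //; exact: ltW.
    have := @ln_le_subr1 R (t'^-1) ltac:(by rewrite invr_gt0).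
    rewrite lnV ?posrE// => h3.
    have h4 : t' * - ln t' <= t' * (t'^-1 - 1) by apply: ler_wpM2l => //; exact: ltW.
    rewrite mulrBr mulfV ?mulr1 in h4; last by rewrite gt_eqF.
    have : t' * (2 * K%:R) <= 1 * (2 * K%:R) by clear -t'1 K1; apply: ler_wpM2r; lra.
    by clear -h2 h4 t'0; lra.
  rewrite (_ : _ - _ = phi t * (ln (E t) - ln (E t')) + (phi t - phi t') * ln (E t')); last by ring.
  apply: (le_trans (ler_normD _ _)).
  rewrite !normrM mulrDl; apply: lerD.
    rewrite (_ : 2 * K%:R ^+ 3 = K%:R * (2 * K ^ 2)%:R); last by rewrite bE; ring.
    rewrite -mulrA; apply: ler_pM => //; apply: H2; lra.
  apply: (@le_trans _ _ (K%:R * (t' - t) * `|ln (E t')|)).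
    apply: ler_wpM2r => //.
    have := H1 t t' ltac:(lra) ltac:(lra).
    by rewrite [`|t - t'|]distrC [`|t' - t|]ger0_norm//; lra.
  rewrite -!mulrA; apply: ler_wpM2l => //.
  apply: (@le_trans _ _ (t' * (ln t' - ln t) * `|ln (E t')|)); first exact: ler_wpM2r.
  by rewrite mulrAC; apply: ler_wpM2r.
move=> t t' t0 tt' t'1; rewrite /F.
have [t'h|t'h] := leP t' (1 / 2).
  by rewrite (min_l (le_trans tt' t'h)); exact: main.
have [th|th] := leP t (1 / 2).
  apply: (le_trans (main _ _ t0 th (lexx _))); apply: ler_wpM2l => //.
  by rewrite lerD2r; apply: ler_wln; lra.
by rewrite subrr normr0 mulr_ge0// subr_ge0; exact: ler_wln.
Qed.

Lemma gauss_isq_sum M (x lam : 'I_M -> R) : gauss_rule x lam ->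
  \sum_h lam h * (isq (x h) + isq `|x h - 1|) <= 60.
Proof.
move=> g; under eq_bigr do rewrite mulrDr.
rewrite big_split/= (_ : 60 = 30 + 30); last by ring.
apply: lerD; first exact: gauss_isqrt g.
rewrite (_ : \sum_h _ = \sum_h lam h * isq (1 - x h)).
  exact: (gauss_isqrt (gauss_rule_sub g)).
apply: eq_bigr => h _; rewrite distrC ger0_norm//.
by have [/(_ h) + _ _] := g; lra.
Qed.

Lemma quad_error_ln (K : nat) : (0 < K)%N -> exists2 C : R, 0 <= C &
  forall M (x lam : 'I_M -> R) (phi E : R -> R),
  (0 < M)%N -> gauss_rule x lam -> log_weight K phi E ->
  rint `[0, 1] (fun t => phi t * ln (E t)) /\
  `|\int[mu]_(t in `[0, 1]) (phi t * ln (E t))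
    - \sum_h lam h * (phi (x h) * ln (E (x h)))| <= C / M%:R.
Proof.
move=> K0; have [C1 C10 HJ] := @jackson_loglip R.
set A : R := 2 * K%:R ^+ 3 + K%:R * (2 * K%:R + 1).
have A0 : 0 <= A by rewrite addr_ge0 ?mulr_ge0 ?addr_ge0 ?exprn_ge0.
exists (68 * (C1 * A)); first by rewrite mulr_ge0// mulr_ge0.
move=> M x lam phi E M0 g W.
have M0' : 0 < M%:R :> R by rewrite ltr0n.
pose F (phi E : R -> R) t := phi (Num.min t (1 / 2)) * ln (E (Num.min t (1 / 2))).
have L1 : forall t t' : R, 0 < t -> t <= t' -> t' <= 1 ->
    `|F phi E t - F phi E t'| <= A * (ln t' - ln t) := log_weight_loglip K0 W.
pose phi' (t : R) := phi (1 - t); pose E' (t : R) := E (1 - t).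
have L2 : forall t t' : R, 0 < t -> t <= t' -> t' <= 1 ->
    `|F phi' E' t - F phi' E' t'| <= A * (ln t' - ln t) :=
  log_weight_loglip K0 (log_weight_onem W).
have [q1 sq1 Hq1] := HJ M _ A M0 A0 L1.
have [q2 sq2 Hq2] := HJ M _ A M0 A0 L2.
set c : R := C1 * A / M%:R in Hq1 Hq2.
have c0 : 0 <= c by rewrite divr_ge0// mulr_ge0.
(* Each half is frozen beyond 1/2, so the value at 1/2 is counted twice. *)
have FE (t : R) : phi t * ln (E t) = F phi E t + F phi' E' (1 - t) - phi (1 / 2) * ln (E (1 / 2)).
  rewrite /F /phi' /E'; have [th|th] := leP t (1 / 2).
    rewrite min_r; last by lra.
    by rewrite (_ : 1 - 1 / 2 = 1 / 2 :> R); [ring | field].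
  rewrite min_l; last by lra.
  by rewrite opprB subrKC; ring.
have iw1 := @integrable_isq R.
have iw2 : rint `[0, 1] (fun t => isq `|t - 1|) by apply: integrable_isq_dist; lra.
pose q : {poly R} := q1 + (q2 \Po (1%:P - 'X)) - (phi (1 / 2) * ln (E (1 / 2)))%:P.
apply: (@quad_error_approx _ _ _ _ _ (fun t => c * (isq t + isq `|t - 1|)) q) => //.
- have s2 : size (1%:P - 'X : {poly R}) = 2%N.
    by rewrite -opprB size_polyN size_XsubC.
  rewrite /q (leq_trans (size_polyD _ _))// geq_max size_polyN.
  rewrite (leq_trans (size_polyC_leq1 _)) ?andbT; last by lia.
  rewrite (leq_trans (size_polyD _ _))// geq_max (leq_trans sq1) ?leq_pmull//=.
  by rewrite size_comp_poly2// (leq_trans sq2)// leq_pmull.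
- apply: (@eq_measurable_fun _ _ _ _ _
    (fun t => F phi E t + F phi' E' (1 - t) - phi (1 / 2) * ln (E (1 / 2)))).
    by move=> t _; rewrite -FE.
  apply: measurable_funB => //; apply: measurable_funD.
    apply: measurable_funS (measurable_loglip L1) => //.
    by apply: subset_itv; rewrite bnd_simp.
  apply: (measurable_comp _ _ (measurable_loglip L2)) => //.
    move=> _ [t + <-]; rewrite /= !in_itv /= => /andP[t0 t1].
    by rewrite subr_gt0 t1 gerBl ltW.
  exact: measurable_funB.
- by apply: rintegrableZ => //; exact: rintegrableD.
- move=> t t01; rewrite /q hornerD hornerN hornerC hornerD horner_comp.
  rewrite hornerD hornerN hornerC hornerX (FE t).
  have h1 := Hq1 t ltac:(lra); have h2 := Hq2 (1 - t) ltac:(lra).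
  rewrite [`|t - 1|]distrC [`|1 - t|]ger0_norm; last by lra.
  rewrite (_ : _ - _ = (q1.[t] - F phi E t) + (q2.[1 - t] - F phi' E' (1 - t))); last by ring.
  by apply: (le_trans (ler_normD _ _)); rewrite mulrDr; exact: lerD.
rewrite RintegralZl//; last exact: rintegrableD.
rewrite RintegralD//.
under eq_bigr do rewrite mulrCA.
(* 68 = 4 + 4 + 60: two integrals of inverse square roots and their Gauss sum. *)
rewrite -mulr_sumr -mulrDr (_ : 68 * (C1 * A) / M%:R = c * 68); last by rewrite /c; ring.
apply: ler_wpM2l => //.
have := gauss_isq_sum g; have := @Rintegral_isq R.
have : \int[mu]_(t in `[0, 1]) isq `|t - 1| <= 4 :> R by apply: Rintegral_isq_dist; lra.
lra.
Qed.

End LogWeights.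

(** * Regular arcs *)

Section Calculus01.
Context {R : realType}.

Definition lip01 (L : R) (h : R -> R) : Prop :=
  forall t t' : R, 0 <= t <= 1 -> 0 <= t' <= 1 -> `|h t - h t'| <= L * `|t - t'|.

(** A punctured neighbourhood of an interior point lies in [0, 1], so the restricted filter gives
    the ordinary derivative. *)
Lemma derivable01_is_derive (h : R -> R) (t : R) : 0 < t < 1 ->
  derivable01 h t -> is_derive t 1 h (derive01 h t).
Proof.
move=> /andP[t0 t1] /cvgP dh.
have dh' : diffquot01 h t u @[u --> within `[0, 1] t^'] --> derive01 h t := dh.
have sh : (fun e : R => e + t) @ 0^' --> within `[0, 1] t^'.
  move=> A; rewrite /within/= => /nbhs_ballP[e /= e0 HA].
  apply/nbhs_ballP; exists (Num.min e (Num.min t (1 - t))) => /=.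
    by rewrite !lt_min e0 t0 subr_gt0.
  move=> y; rewrite /ball/= sub0r normrN !lt_min => /and3P[ye yt y1] y0.
  apply: HA.
  - by rewrite /ball/= opprD addrC subrK normrN.
  - by rewrite -subr_eq0 addrK.
  - by rewrite in_itv/=; move: yt y1; rewrite !ltr_norml; lra.
have lim_ : (fun e : R => e^-1 *: (h (e *: (1 : R) + t) - h t)) @ 0^' --> derive01 h t.
  have := cvg_comp _ _ sh dh'; apply: cvg_trans; apply: near_eq_cvg; near=> e.
  by rewrite /diffquot01 /= addrK mulrC [e *: 1]mulr1.
by apply: DeriveDef; [apply/cvg_ex; eexists; exact: lim_ | exact: cvg_lim lim_].
Unshelve. all: by end_near. Qed.

Lemma mvt01 (h : R -> R) (s t : R) : {within `[0, 1], continuous h} ->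
  (forall t : R, t \in `[0, 1] -> derivable01 h t) ->
  0 <= s <= 1 -> 0 <= t <= 1 -> s < t ->
  exists2 x, s < x < t & h t - h s = derive01 h x * (t - s).
Proof.
move=> ch dh s01 t01 st.
have [x| |x] := @MVT R h (derive01 h) s t st.
- rewrite in_itv/= => /andP[sx xt]; apply: derivable01_is_derive; first by lra.
  by apply: dh; rewrite in_itv/=; lra.
- case/andP: s01 t01 => s0 _ /andP[_ t1].
  by apply: continuous_subspaceW ch; apply: subset_itv; rewrite bnd_simp.
- by rewrite in_itv/= => ? ?; exists x.
Qed.

Lemma lip01_derive (h : R -> R) (L : R) : {within `[0, 1], continuous h} ->
  (forall t : R, t \in `[0, 1] -> derivable01 h t) ->
  (forall t : R, 0 <= t <= 1 -> `|derive01 h t| <= L) -> lip01 L h.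
Proof.
move=> ch dh HL s t s01 t01; wlog st : s t s01 t01 / s <= t.
  move=> W; have [st|/ltW ts] := leP s t; first exact: W.
  by rewrite distrC (distrC s); exact: W.
move: st; rewrite le_eqVlt => /predU1P[->|st]; first by rewrite !subrr normr0 mulr0.
have [x xst E] := mvt01 ch dh s01 t01 st.
rewrite distrC (distrC s) E normrM; apply: ler_wpM2r => //; apply: HL; lra.
Qed.

Lemma bounded01 (h : R -> R) : {within `[0, 1], continuous h} ->
  exists2 B : R, 0 <= B & forall t : R, 0 <= t <= 1 -> `|h t| <= B.
Proof.
move=> ch; have : compact (h @` `[0, 1]).
  by apply: continuous_compact => //; exact: segment_compact.
move/compact_bounded => [N [Nr HN]]; exists (`|N| + 1); first by rewrite addr_ge0.
move=> t t01; apply: (HN (`|N| + 1)).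
  by rewrite (le_lt_trans (ler_norm N))// ltrDl.
by exists t => //=; rewrite in_itv.
Qed.

Lemma C01_lip (h : R -> R) : C01 1 h -> exists2 L : R, 0 <= L & lip01 L h.
Proof.
move=> [ch [dh [cd _]]]; have [B B0 HB] := bounded01 cd.
by exists B => //; exact: lip01_derive.
Qed.

Lemma C02_taylor (h : R -> R) : C01 2 h -> exists L : R, [/\ 0 <= L, lip01 L h,
  lip01 L (derive01 h) & forall s t : R, 0 <= s <= 1 -> 0 <= t <= 1 ->
    `|h t - h s - (t - s) * derive01 h s| <= L * (t - s) ^+ 2].
Proof.
move=> [ch [dh [cd1 [dd1 cd2]]]].
have [L1 L10 H1] := C01_lip (conj ch (conj dh (conj cd1 I))).
have [L2 L20 H2] := C01_lip (conj cd1 (conj dd1 cd2)).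
exists (L1 + L2); split.
- by rewrite addr_ge0.
- move=> t t' t01 t'01; apply: (le_trans (H1 t t' t01 t'01)).
  by apply: ler_wpM2r => //; rewrite lerDl.
- move=> t t' t01 t'01; apply: (le_trans (H2 t t' t01 t'01)).
  by apply: ler_wpM2r => //; rewrite lerDr.
move=> s t s01 t01.
suff h3 : `|h t - h s - (t - s) * derive01 h s| <= L2 * (t - s) ^+ 2.
  by apply: (le_trans h3); apply: ler_wpM2r; rewrite ?sqr_ge0// lerDr.
have [ts|st|->] := ltgtP t s; last by rewrite !subrr mul0r subr0 normr0 expr0n/= mulr0.
  have [x xst E] := mvt01 ch dh t01 s01 ts.
  rewrite (_ : _ - _ - _ = (derive01 h x - derive01 h s) * (t - s)); last first.
    by rewrite -[h t - h s]opprB E; ring.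
  rewrite normrM -[leRHS]/(_ * _) -(real_normK (num_real (t - s))) expr2 mulrA.
  apply: ler_wpM2r => //; have x01 : 0 <= x <= 1 by lra.
  apply: (le_trans (H2 x s x01 s01)).
  by apply: ler_wpM2l => //; rewrite !ler0_norm; lra.
have [x xst E] := mvt01 ch dh s01 t01 st.
rewrite (_ : _ - _ - _ = (derive01 h x - derive01 h s) * (t - s)); last first.
  by rewrite E; ring.
rewrite normrM -(real_normK (num_real (t - s))) expr2 mulrA.
apply: ler_wpM2r => //; have x01 : 0 <= x <= 1 by lra.
apply: (le_trans (H2 x s x01 s01)).
by apply: ler_wpM2l => //; rewrite !ger0_norm; lra.
Qed.

Definition difference_quotient (h : R -> R) (s t : R) : R :=
  if t == s then derive01 h t else (h s - h t) / (s - t).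

(* For t between s and t', the quotient at t' is a weighted mean of the quotient at t and of
   the one over [t, t']. *)
Lemma difference_quotient_lip (h : R -> R) (L s : R) : 0 <= L ->
  (forall s t : R, 0 <= s <= 1 -> 0 <= t <= 1 ->
    `|h t - h s - (t - s) * derive01 h s| <= L * (t - s) ^+ 2) ->
  0 <= s <= 1 -> lip01 L (difference_quotient h s).
Proof.
move=> L0 T s01; set e := difference_quotient h s.
have es : e s = derive01 h s by rewrite /e /difference_quotient eqxx.
have eE (t : R) : t != s -> e t = (h s - h t) / (s - t).
  by rewrite /e /difference_quotient => /negbTE ->.
have E1 (t : R) : 0 <= t <= 1 -> `|e t - derive01 h s| <= L * `|s - t|.
  move=> t01; have [->|ts] := eqVneq t s; first by rewrite es !subrr normr0 mulr0.
  have st0 : s - t != 0 by rewrite subr_eq0 eq_sym.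
  rewrite eE// -(ler_pM2r (_ : 0 < `|s - t|)) ?normr_gt0// -normrM -mulrA -expr2.
  rewrite real_normK ?num_real// -sqrrN opprB -[X in X <= _]normrN.
  rewrite [X in `|X|](_ : _ = h t - h s - (t - s) * derive01 h s); first exact: T.
  by field.
have E2 (t : R) : 0 <= t <= 1 -> `|e t - derive01 h t| <= L * `|s - t|.
  move=> t01; have [->|ts] := eqVneq t s; first by rewrite es !subrr normr0 mulr0.
  have st0 : s - t != 0 by rewrite subr_eq0 eq_sym.
  rewrite eE// -(ler_pM2r (_ : 0 < `|s - t|)) ?normr_gt0// -normrM -mulrA -expr2.
  rewrite real_normK ?num_real//.
  rewrite (_ : _ * (s - t) = h s - h t - (s - t) * derive01 h t); first exact: T.
  by field.
move=> t t' t01 t'01; wlog tt' : t t' t01 t'01 / `|s - t'| <= `|s - t|.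
  move=> W; have [st|/ltW ts] := leP `|s - t'| `|s - t|; first exact: W.
  by rewrite distrC (distrC t); exact: W.
have [t's|t's] := eqVneq t' s.
  by rewrite t's es (distrC t); exact: E1.
have st'0 : s - t' != 0 by rewrite subr_eq0 eq_sym.
have a0 : 0 < `|s - t| by apply: lt_le_trans tt'; rewrite normr_gt0.
have ts : t != s by move: a0; rewrite normr_gt0 subr_eq0 eq_sym.
have st0 : s - t != 0 by rewrite subr_eq0 eq_sym.
have [same|opp] := leP 0 ((s - t) * (s - t')).
  have tri : `|t' - t| + `|s - t'| = `|s - t|.
    move: a0 tt'; have [s0|s0] := leP 0 (s - t); have [s1|s1] := leP 0 (s - t').
    - by rewrite ger0_norm// ger0_norm// => _ h'; rewrite ger0_norm; lra.
    - by nra.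
    - by nra.
    - by rewrite ltr0_norm// ltr0_norm// => _ h'; rewrite ler0_norm; lra.
  have key : (e t - e t') * (s - t) =
      (e t' - derive01 h t') * (t - t') - (h t - h t' - (t - t') * derive01 h t').
    have eT : e t * (s - t) = h s - h t by rewrite eE// divfK.
    have eT' : e t' * (s - t') = h s - h t' by rewrite eE// divfK.
    lra.
  rewrite -(ler_pM2r a0) -normrM key; apply: (le_trans (ler_normB _ _)).
  have h1 := T t' t t'01 t01; have h2 := E2 t' t'01.
  have h3 : `|(e t' - derive01 h t') * (t - t')| <= L * `|s - t'| * `|t - t'|.
    by rewrite normrM; exact: ler_wpM2r.
  rewrite -tri (distrC t'); rewrite -(real_normK (num_real (t - t'))) in h1.
  by apply: (le_trans (lerD h3 h1)); rewrite le_eqVlt; apply/orP; left; apply/eqP; ring.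
(* Here s lies between t and t', so |t - t'| = |s - t| + |s - t'| and passing through the derivative
   at s loses nothing. *)
have h1 := E1 t t01; have h2 := E1 t' t'01; rewrite distrC in h2.
have := ler_normD (e t - derive01 h s) (derive01 h s - e t'); rewrite addrA subrK => h3.
apply: (le_trans h3); apply: (le_trans (lerD h1 h2)); rewrite -mulrDr.
apply: ler_wpM2l => //.
have [s0|s0] := leP 0 (s - t); have [s1|s1] := leP 0 (s - t').
- nra.
- by clear -s0 s1; rewrite (ger0_norm s0) (ltr0_norm s1) ler0_norm; lra.
- by clear -s0 s1; rewrite (ltr0_norm s0) (ger0_norm s1) ger0_norm; lra.
- nra.
Qed.

End Calculus01.

(** * Euclidean length and estimates for regular arcs *)

Section Curves.
Context {R : realType}.
Implicit Types (u v : R * R) (c : R -> R * R).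

Lemma enorm_ge0 u : 0 <= enorm u. Proof. exact: sqrtr_ge0. Qed.

Lemma sqr_enorm u : enorm u ^+ 2 = u.1 ^+ 2 + u.2 ^+ 2.
Proof. by rewrite sqr_sqrtr// addr_ge0 ?sqr_ge0. Qed.

Lemma enormN u : enorm (- u) = enorm u.
Proof. by rewrite /enorm /= !sqrrN. Qed.

Lemma enormZ (a : R) u : enorm (a *: u) = `|a| * enorm u.
Proof.
by rewrite /enorm /= !exprMn -mulrDr sqrtrM ?sqr_ge0// sqrtr_sqr.
Qed.

Lemma enorm_triangle u v : enorm (u + v) <= enorm u + enorm v.
Proof.
rewrite -(@ler_pXn2r _ 2) ?nnegrE ?addr_ge0 ?enorm_ge0// sqrrD !sqr_enorm /=.
have h : u.1 * v.1 + u.2 * v.2 <= enorm u * enorm v.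
  apply: le_trans (ler_norm _) _.
  rewrite -[leRHS]ger0_norm ?mulr_ge0 ?enorm_ge0// -ler_sqr_norm exprMn !sqr_enorm.
  by have := sqr_ge0 (u.1 * v.2 - u.2 * v.1); lra.
by rewrite mulr2n; lra.
Qed.

Lemma enorm_dist u v : `|enorm u - enorm v| <= enorm (u - v).
Proof.
have h1 := enorm_triangle (u - v) v; rewrite subrK in h1.
have h2 := enorm_triangle (v - u) u; rewrite subrK in h2.
have h3 : enorm (v - u) = enorm (u - v) by rewrite -enormN opprB.
by rewrite ler_norml; lra.
Qed.

Lemma enorm_le u : enorm u <= `|u.1| + `|u.2|.
Proof.
rewrite -(@ler_pXn2r _ 2) ?nnegrE ?addr_ge0 ?enorm_ge0// sqr_enorm.
rewrite sqrrD !real_normK ?num_real// mulr2n.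
by have := normr_ge0 u.1; have := normr_ge0 u.2; nra.
Qed.

Lemma enorm_gt0 u : u != 0 -> 0 < enorm u.
Proof.
move=> u0; rewrite sqrtr_gt0 lt_neqAle addr_ge0 ?sqr_ge0// andbT eq_sym.
apply: contra u0; rewrite paddr_eq0 ?sqr_ge0// !sqrf_eq0 => /andP[/eqP u1 /eqP u2].
by apply/eqP; case: u u1 u2 => a b /= -> ->.
Qed.

Lemma clamp0_itv (t : R) : 0 <= clamp 0 t <= 1.
Proof. by rewrite clamp_ge clamp_le1. Qed.

Lemma clamp0_id (t : R) : 0 <= t <= 1 -> clamp 0 t = t.
Proof. by move=> /andP[t0 t1]; rewrite /clamp (ger0_norm t0) min_l// max_l. Qed.

Lemma continuous_clamp_lip01 (L : R) (h : R -> R) : 0 <= L -> lip01 L h ->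
  continuous (fun t => h (clamp 0 t)).
Proof.
move=> L0 Lh; apply: (@continuous_lip _ _ L) => s t.
apply: (le_trans (Lh _ _ (clamp0_itv s) (clamp0_itv t))).
by apply: ler_wpM2l => //; exact: clamp_lip.
Qed.

Lemma lip01_lower (L : R) (h : R -> R) : 0 <= L -> lip01 L h ->
  (forall t : R, 0 <= t <= 1 -> 0 < h t) ->
  exists2 m : R, 0 < m & forall t : R, 0 <= t <= 1 -> m <= h t.
Proof.
move=> L0 Lh h0; have ch := continuous_clamp_lip01 L0 Lh.
have [s s01 Hs] := @EVT_min R _ 0 1 ler01 (continuous_subspaceT ch).
exists (h (clamp 0 s)); first by apply: h0; exact: clamp0_itv.
by move=> t t01; have := Hs t; rewrite in_itv/= (clamp0_id t01); exact.
Qed.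

(* The exact kernel of delta is t |-> ln (chord_quotient c s t). *)
Definition chord_quotient c (s t : R) : R :=
  enorm (difference_quotient (fun t => (c t).1) s t, difference_quotient (fun t => (c t).2) s t).

Lemma chord_quotientE c (s t : R) :
  chord_quotient c s t = if t == s then speed c t else enorm (c s - c t) / `|t - s|.
Proof.
rewrite /chord_quotient /difference_quotient; case: eqVneq => // ts.
rewrite distrC -normfV -[RHS]mulrC -enormZ; congr enorm.
by rewrite [RHS]surjective_pairing /=; congr pair; exact: mulrC.
Qed.

(** The constants serve for all base points s at once; this is what makes the error constants
    independent of the evaluation point. *)
Lemma regular_bounds c : regular_C2 c -> exists L m : R, [/\ 0 <= L, 0 < m &
  [/\ forall t t' : R, 0 <= t <= 1 -> 0 <= t' <= 1 -> enorm (c t - c t') <= L * `|t - t'|,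
      lip01 L (speed c),
      forall s t : R, 0 <= s <= 1 -> 0 <= t <= 1 ->
        enorm (c t - c s - (t - s) *: dcurve c s) <= L * (t - s) ^+ 2,
      forall t : R, 0 <= t <= 1 -> m <= speed c t &
      forall s : R, 0 <= s <= 1 -> lip01 L (chord_quotient c s)]].
Proof.
move=> [c1 c2 c0].
have [L1 [L10 H1 D1 T1]] := C02_taylor c1; have [L2 [L20 H2 D2 T2]] := C02_taylor c2.
have Lsp : lip01 (L1 + L2) (speed c).
  move=> t t' t01 t'01; apply: (le_trans (enorm_dist _ _)).
  apply: (le_trans (enorm_le _)) => /=; rewrite mulrDl.
  by apply: lerD; [exact: D1|exact: D2].
have L0 : 0 <= L1 + L2 by rewrite addr_ge0.
have [m m0 Hm] : exists2 m : R, 0 < m & forall t : R, 0 <= t <= 1 -> m <= speed c t.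
  apply: lip01_lower Lsp _ => // t t01.
  by rewrite lt_neqAle eq_sym enorm_ge0 andbT; apply: c0; rewrite in_itv.
exists (L1 + L2), m; split=> //; split=> //.
- move=> t t' t01 t'01; apply: (le_trans (enorm_le _)) => /=; rewrite mulrDl.
  by apply: lerD; [exact: H1|exact: H2].
- move=> s t s01 t01; apply: (le_trans (enorm_le _)) => /=; rewrite mulrDl.
  by apply: lerD; [exact: T1|exact: T2].
- move=> s s01 t t' t01 t'01; apply: (le_trans (enorm_dist _ _)).
  apply: (le_trans (enorm_le _)) => /=; rewrite mulrDl.
  by apply: lerD; [exact: (difference_quotient_lip L10 T1)|exact: (difference_quotient_lip L20 T2)].
Qed.

(** For p = |u| and q = |v|, |a v - b u|^2 equals (1 - cos theta) / 2 (a q + b p)^2 + (1 + cos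
    theta) / 2 (a q - b p)^2. The range of theta excludes cos theta = 1, that is, a cusp. *)
Lemma corner_vectors u v (theta : R) : u != 0 -> v != 0 -> 0 < theta < 2 * pi ->
  (enorm v)^-1 *: v = rotate_by theta ((enorm u)^-1 *: u) ->
  exists2 k : R, 0 < k &
    forall a b : R, 0 <= a -> 0 <= b -> k * (a + b) <= enorm (a *: v - b *: u).
Proof.
move=> /enorm_gt0 u0 /enorm_gt0 v0 th E.
set p := enorm u in u0 E *; set q := enorm v in v0 E *.
have c1 : cos theta < 1.
  have -> : cos theta = 1 - 2 * sin (theta / 2) ^+ 2.
    rewrite {1}(_ : theta = theta / 2 + theta / 2); last by field.
    by rewrite cosD -!expr2 cos2sin2; ring.
  have : 0 < sin (theta / 2) by apply: sin_gt0_pi; lra.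
  move=> s0; have : 0 < sin (theta / 2) ^+ 2 by rewrite exprn_gt0.
  by lra.
have cN1 : -1 <= cos theta by exact: cos_geN1.
set w := Num.sqrt ((1 - cos theta) / 2).
have w0 : 0 < w by rewrite sqrtr_gt0; lra.
have w2 : w ^+ 2 = (1 - cos theta) / 2 by rewrite sqr_sqrtr//; lra.
exists (w * Num.min p q); first by rewrite mulr_gt0// lt_min u0.
move=> a b a0 b0.
apply: (@le_trans _ _ (w * (a * q + b * p))).
  rewrite -mulrA; apply: ler_wpM2l; first exact: ltW.
  rewrite mulrC mulrDl; apply: lerD; apply: ler_wpM2l => //; by rewrite ge_min lexx ?orbT.
have dot : u.1 * v.1 + u.2 * v.2 = p * q * cos theta.
  have v1 : v.1 = q * (cos theta * (p^-1 * u.1) - sin theta * (p^-1 * u.2)).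
    have := congr1 fst E; rewrite /= => <-; rewrite [_ *: _]/(_ * _) mulVKf//.
    by rewrite gt_eqF.
  have v2 : v.2 = q * (sin theta * (p^-1 * u.1) + cos theta * (p^-1 * u.2)).
    have := congr1 snd E; rewrite /= => <-; rewrite [_ *: _]/(_ * _) mulVKf//.
    by rewrite gt_eqF.
  have pp : p ^+ 2 = u.1 ^+ 2 + u.2 ^+ 2 by exact: sqr_enorm.
  rewrite v1 v2 (_ : _ + _ = q * cos theta * p^-1 * (u.1 ^+ 2 + u.2 ^+ 2)); last by ring.
  by rewrite -pp; field; rewrite gt_eqF.
have q0 := enorm_ge0 (a *: v - b *: u).
rewrite -(@ler_pXn2r _ 2) ?nnegrE// ?mulr_ge0 ?addr_ge0 ?mulr_ge0 ?(ltW w0) ?(ltW u0) ?(ltW v0)//.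
rewrite sqr_enorm exprMn w2 /=.
have -> : (a * v.1 - b * u.1) ^+ 2 + (a * v.2 - b * u.2) ^+ 2 =
   a ^+ 2 * (v.1 ^+ 2 + v.2 ^+ 2) + b ^+ 2 * (u.1 ^+ 2 + u.2 ^+ 2)
   - 2 * a * b * (u.1 * v.1 + u.2 * v.2) by ring.
rewrite dot -!sqr_enorm -/p -/q -subr_ge0.
rewrite (_ : _ - _ = (1 + cos theta) / 2 * (a * q - b * p) ^+ 2); last by field.
by rewrite mulr_ge0 ?sqr_ge0//; lra.
Qed.

End Curves.

(** * Separation of the arcs *)

Section EndPoints.
Context {R : realType}.

(** Coding the end by a Boolean makes (-1)^a the direction from it into [0, 1], so that one lemma
    covers both orders of two arcs at a corner. *)
Definition end01 (a : bool) : R := if a then 1 else 0.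

Lemma end01_itv a : 0 <= end01 a <= 1.
Proof. by case: a; rewrite /= ler01 lexx. Qed.

Lemma end01_dist a (t : R) : 0 <= t <= 1 -> t - end01 a = `|t - end01 a| * (-1) ^+ a.
Proof.
move=> t01; case: a => /=; first by rewrite expr1 ler0_norm; lra.
by rewrite expr0 ger0_norm; lra.
Qed.

Lemma end01_weight a (t : R) : 0 <= t <= 1 -> t * (1 - t) <= `|t - end01 a|.
Proof.
move=> t01; case: a => /=; first by rewrite ler0_norm; nra.
by rewrite ger0_norm; nra.
Qed.

End EndPoints.

Section Separation.
Context {R : realType} (n : nat) (D : set (R * R)) (P : 'I_n -> R * R) (chi : 'I_n -> R).
Context (st : 'I_n -> R -> R * R).
Hypothesis dom : corner_domain D P chi st.

(* The factor t (1 - t) accounts for the corners, the factor |y - t| for the chords of one arc. *)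
Definition separation_weight (l k : 'I_n) (y t : R) : R :=
  (if k == l then `|y - t| else 1) * (t * (1 - t)).

(** Injectivity is known on [0, 1[, so a parameter 1 is traded for 0 on the next arc. For n = 1 the
    corner cases occur with k = l. *)
Lemma arc_coincidence (l k : 'I_n) (y t : R) : 0 <= y <= 1 -> 0 <= t <= 1 ->
  st l y = st k t ->
  [\/ k = l /\ y = t, [/\ k = ordS l, y = 1 & t = 0] | [/\ l = ordS k, y = 0 & t = 1]].
Proof.
have S := arcs_simple dom.
have E i : st i 1 = st (ordS i) 0 by rewrite (arc_end dom) (arc_start dom).
have z : (0 : R) \in `[0, 1[ by rewrite in_itv/= lexx ltr01.
move=> /andP[y0 y1] /andP[t0 t1].
have yI : y != 1 -> y \in `[0, 1[ by move=> h; rewrite in_itv/= y0 lt_neqAle h.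
have tI : t != 1 -> t \in `[0, 1[ by move=> h; rewrite in_itv/= t0 lt_neqAle h.
have [->|/yI {}yI] := eqVneq y 1; have [->|/tI {}tI] := eqVneq t 1.
- rewrite !E => /(S _ _ _ _ z z)[e _]; apply: Or31; split=> //.
  by apply: (can_inj (@ordSK n)).
- by rewrite E => /(S _ _ _ _ z tI)[<- <-]; apply: Or32.
- by rewrite E => /(S _ _ _ _ yI z)[-> ->]; apply: Or33.
- by move=> /(S _ _ _ _ yI tI)[-> ->]; apply: Or31.
Qed.

Lemma separation_weight_le (l k : 'I_n) (y t : R) : 0 <= y <= 1 -> 0 <= t <= 1 ->
  separation_weight l k y t <= t * (1 - t).
Proof.
move=> y01 t01; rewrite /separation_weight ler_piMl ?mulr_ge0//; [lra|lra|].
by case: ifP => // _; have /andP[] := dist_le1 t01 y01.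
Qed.

(** To first order the two points leave the corner along the tangents pointing into their arcs, at
    mutual distance at least kappa (p + q). The quadratic remainders take at most a quarter of this
    when p, q < kappa / (4 L), and the weight is at most q. *)
Lemma corner_separation (l k : 'I_n) (a b : bool) :
  st l (end01 a) = st k (end01 b) ->
  (exists2 kappa : R, 0 < kappa & forall p q : R, 0 <= p -> 0 <= q ->
     kappa * (p + q) <= enorm (p *: ((-1) ^+ a *: dcurve (st l) (end01 a))
                      - q *: ((-1) ^+ b *: dcurve (st k) (end01 b)))) ->
  exists e K : R, [/\ 0 < e, 0 <= K & forall y t : R, 0 <= y <= 1 -> 0 <= t <= 1 ->
    `|y - (end01 a)| < e -> `|t - (end01 b)| < e ->
    separation_weight l k y t <= K * enorm (st l y - st k t)].
Proof.
have y001 := @end01_itv R a; have t001 := @end01_itv R b.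
move=> E [kap kap0 Hk].
have [L1 [m1 [L10 _ [_ _ T1 _ _]]]] := regular_bounds (arc_regular dom l).
have [L2 [m2 [L20 _ [_ _ T2 _ _]]]] := regular_bounds (arc_regular dom k).
have L120 : 0 < L1 + L2 + 1 by lra.
pose L := L1 + L2 + 1; rewrite -/L in L120.
have L1L : L1 <= L by rewrite /L; lra.
have L2L : L2 <= L by rewrite /L; lra.
clearbody L.
exists (kap / (4 * L)), (2 / kap); split.
- by rewrite divr_gt0// mulr_gt0.
- by rewrite divr_ge0// ltW.
move=> y t y01 t01 ye te.
have yp := end01_dist a y01; have tq := end01_dist b t01.
have wq : separation_weight l k y t <= `|t - end01 b|.
  by apply: (le_trans (separation_weight_le l k y01 t01)); exact: end01_weight.
have R1 := T1 _ y y001 y01; have R2 := T2 _ t t001 t01.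
rewrite yp in R1; rewrite tq in R2.
move: ye te wq R1 R2; set p := `|y - _|; set q := `|t - _| => ye te wq R1 R2.
have p0 : 0 <= p by exact: normr_ge0.
have q0 : 0 <= q by exact: normr_ge0.
set U := dcurve (st l) _ in R1 Hk; set V := dcurve (st k) _ in R2 Hk.
have H := Hk p q p0 q0.
set r1 := _ - _ - _ in R1; set r2 := _ - _ - _ in R2.
have eqn : p *: ((-1) ^+ a *: U) - q *: ((-1) ^+ b *: V) = st l y - st k t - r1 + r2.
  rewrite /r1 /r2 !scalerA E [LHS]surjective_pairing [RHS]surjective_pairing /=.
  by congr pair; ring.
have sqr1 : (p * (-1) ^+ a) ^+ 2 = p ^+ 2 by rewrite exprMn -exprM mulnC exprM sqrrN !expr1n mulr1.
have sqr2 : (q * (-1) ^+ b) ^+ 2 = q ^+ 2 by rewrite exprMn -exprM mulnC exprM sqrrN !expr1n mulr1.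
rewrite sqr1 in R1; rewrite sqr2 in R2.
have tri : kap * (p + q) <= enorm (st l y - st k t) + L * p ^+ 2 + L * q ^+ 2.
  apply: (le_trans H); rewrite eqn.
  apply: (le_trans (enorm_triangle _ _)); apply: lerD.
    apply: (le_trans (enorm_triangle _ _)); rewrite enormN lerD2l.
    by apply: (le_trans R1); apply: ler_wpM2r; rewrite ?sqr_ge0.
  by apply: (le_trans R2); apply: ler_wpM2r; rewrite ?sqr_ge0.
apply: (le_trans wq); rewrite mulrAC ler_pdivlMr//.
rewrite ltr_pdivlMr ?mulr_gt0// in ye; rewrite ltr_pdivlMr ?mulr_gt0// in te.
clear -wq ye te tri p0 q0 kap0 L120.
have hp : L * p ^+ 2 <= kap / 4 * p by rewrite expr2 mulrA; apply: ler_wpM2r => //; lra.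
have hq : L * q ^+ 2 <= kap / 4 * q by rewrite expr2 mulrA; apply: ler_wpM2r => //; lra.
have kp : 0 <= kap * p by rewrite mulr_ge0// ltW.
have kq : 0 <= kap * q by rewrite mulr_ge0// ltW.
lra.
Qed.

Lemma corner_kappa (k : 'I_n) : exists2 kappa : R, 0 < kappa &
  forall p q : R, 0 <= p -> 0 <= q ->
  kappa * (p + q) <= enorm (p *: (- dcurve (st (ord_pred k)) 1) - q *: dcurve (st k) 0).
Proof.
have [/andP[c1 c2] _] := corner_range dom k.
have pi0 := pi_gt0 R.
have nz i (t : R) : 0 <= t <= 1 -> dcurve (st i) t != 0.
  move=> t01; have [_ _ /(_ t)] := arc_regular dom i; rewrite in_itv/= => /(_ t01).
  by apply: contra_neq; rewrite /speed => ->; rewrite /enorm /= expr0n addr0 sqrtr0.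
apply: (corner_vectors _ _ _ (corner_angle dom k)).
- by apply: nz; rewrite lexx ler01.
- by rewrite oppr_eq0; apply: nz; rewrite lexx ler01.
- by nra.
Qed.

Lemma separation_local (l k : 'I_n) (y0 t0 : R) : 0 <= y0 <= 1 -> 0 <= t0 <= 1 ->
  exists e K : R, [/\ 0 < e, 0 <= K & forall y t : R, 0 <= y <= 1 -> 0 <= t <= 1 ->
    `|y - y0| < e -> `|t - t0| < e ->
    separation_weight l k y t <= K * enorm (st l y - st k t)].
Proof.
move=> y001 t001.
have [L1 [m1 [L10 m10 [H1 S1 T1 M1 _]]]] := regular_bounds (arc_regular dom l).
have [L2 [m2 [L20 _ [H2 _ _ _ _]]]] := regular_bounds (arc_regular dom k).
have [E|/eqP ne] := eqVneq (st l y0) (st k t0); last first.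
  (* Distinct points: nearby ones stay at distance at least d / 2. *)
  have d0 : 0 < enorm (st l y0 - st k t0) by apply: enorm_gt0; rewrite subr_eq0; apply/eqP.
  set d := enorm _ in d0.
  have LL : 0 < 4 * (L1 + L2 + 1) by lra.
  exists (d / (4 * (L1 + L2 + 1))), (2 / d); split.
  - by rewrite divr_gt0.
  - by rewrite divr_ge0// ltW.
  move=> y t y01 t01; rewrite !ltr_pdivlMr// => ye te.
  have h1 := H1 _ _ y01 y001; have h2 := H2 _ _ t01 t001.
  have h3 : d <= enorm (st l y - st k t) + enorm (st l y - st l y0) + enorm (st k t - st k t0).
    rewrite /d (_ : st l y0 - st k t0 = (st l y - st k t) - (st l y - st l y0) + (st k t - st k t0)).
      apply: (le_trans (enorm_triangle _ _)); rewrite lerD2r.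
      by apply: (le_trans (enorm_triangle _ _)); rewrite enormN.
    by rewrite [LHS]surjective_pairing [RHS]surjective_pairing /=; congr pair; ring.
  have w1 : separation_weight l k y t <= 1.
    by apply: (le_trans (separation_weight_le l k y01 t01)); nra.
  apply: (le_trans w1); rewrite mulrAC ler_pdivlMr// mul1r.
  have := normr_ge0 (y - y0); have := normr_ge0 (t - t0).
  move: ye te h1 h2; set p : R := `|y - y0|; set q : R := `|t - t0|.
  clearbody p q; clear -h3 LL L10 L20 => ye te h1 h2 q0 p0.
  have : 0 <= p * L2 by rewrite mulr_ge0.
  have : 0 <= q * L1 by rewrite mulr_ge0.
  lra.
have [[kl yt]|[kl y1 t1]|[lk y1 t1]] := arc_coincidence y001 t001 E.
(* Equal parameters on one arc: nearby chords are at least m1 / 2 times |y - t|, by Taylor's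
   formula. *)
- rewrite kl in E *; exists (m1 / (4 * (L1 + 1))), (2 / m1).
  have LL : 0 < 4 * (L1 + 1) by lra.
  split; [by rewrite divr_gt0 | by rewrite divr_ge0// ltW |].
  move=> y t y01 t01; rewrite !ltr_pdivlMr// -yt => ye te.
  have h : `|y - t| <= `|y - y0| + `|t - y0|.
    by rewrite (distrC t); have := ler_normD (y - y0) (y0 - t); rewrite addrA subrK.
  have w1 : separation_weight l l y t <= `|y - t|.
    by rewrite /separation_weight eqxx ler_piMr//; nra.
  apply: (le_trans w1); rewrite mulrAC ler_pdivlMr//.
  have h4 := T1 t y t01 y01; have h5 := M1 t t01.
  have h6 : `|y - t| * speed (st l) t <= enorm (st l y - st l t) + L1 * (y - t) ^+ 2.
    rewrite /speed -enormZ (_ : (y - t) *: _ = (st l y - st l t) - (st l y - st l t - (y - t) *: dcurve (st l) t)).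
      by apply: (le_trans (enorm_triangle _ _)); rewrite enormN lerD2l.
    by rewrite subKr.
  rewrite -(real_normK (num_real (y - t))) in h6.
  have p0 := normr_ge0 (y - t); have a0 := normr_ge0 (y - y0); have b0 := normr_ge0 (t - y0).
  move: h h6 ye te p0 a0 b0; set p : R := `|y - t|; set a : R := `|y - y0|; set b : R := `|t - y0|.
  clearbody p a b; clear -h5 L10 m10 LL => h h6 ye te p0 a0 b0.
  have h7 : p * m1 <= p * speed (st l) t by apply: ler_wpM2l.
  have h8 : L1 * p ^+ 2 <= m1 / 2 * p.
    have Lp : L1 * p <= L1 * (a + b) by exact: ler_wpM2l.
    by rewrite expr2 mulrA; apply: ler_wpM2r => //; lra.
  lra.
- rewrite y1 t1 in E *; apply: (@corner_separation l k true false) => //.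
  have [kap kap0 Hk] := corner_kappa k.
  exists kap => // p q p0 q0; have := Hk p q p0 q0.
  by rewrite kl ordSK expr1 expr0 scaleN1r scale1r.
- rewrite y1 t1 in E *; apply: (@corner_separation l k false true) => //.
  have [kap kap0 Hk] := corner_kappa l.
  exists kap => // p q p0 q0; have := Hk q p q0 p0.
  by rewrite lk ordSK expr1 expr0 scaleN1r scale1r -enormN opprB addrC.
Qed.

Lemma curve_separation (l k : 'I_n) : exists K : nat, forall y t : R,
  0 <= y <= 1 -> 0 <= t <= 1 ->
  separation_weight l k y t <= K%:R * enorm (st l y - st k t).
Proof.
pose Q : set (R * R) := `[0, 1] `*` `[0, 1].
have cQ : compact Q by apply: compact_setX; exact: segment_compact.
have /compact_near_coveringP nc := cQ.
(* The constant itself is the index: each local bound holds for all large i, and compactness makes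
   them simultaneous. *)
have := nc nat \oo (fun i z => Q z ->
  separation_weight l k z.1 z.2 <= i%:R * enorm (st l z.1 - st k z.2)) _.
case.
  move=> [y0 t0] [/= y001 t001].
  have [e [K [e0 K0 H]]] := @separation_local l k y0 t0 y001 t001.
  exists (ball (y0, t0) e, [set i | K <= i%:R]) => /=.
    split; first exact: nbhsx_ballx.
    exists (Num.bound K) => // i /= Ki.
    by rewrite (le_trans (ltW (archi_boundP K0)))// ler_nat.
  move=> [[y t] i] /= [[/= yb tb] Ki] [/= yI tI].
  apply: (le_trans (H y t yI tI _ _)).
  - by rewrite distrC.
  - by rewrite distrC.
  - by apply: ler_wpM2r => //; exact: enorm_ge0.
move=> N _ HN; exists N => y t yI tI.
by apply: (HN N (leqnn N) (y, t)).
Qed.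

End Separation.

(** * Error on one arc *)

Section ArcErrors.
Context {R : realType}.
Local Notation mu := (@lebesgue_measure R).
Local Notation rint D f := (mu.-integrable D (EFin \o f)).

Lemma ln_dist_le (m a b : R) : 0 < m -> m <= a -> m <= b -> `|ln a - ln b| <= `|a - b| / m.
Proof.
move=> m0; wlog ab : a b / a <= b.
  move=> W ma mb; have [ab|/ltW ba] := leP a b; first exact: W.
  by rewrite distrC (distrC a); exact: W.
move=> ma mb; have a0 : 0 < a by exact: lt_le_trans ma.
rewrite distrC (distrC a) ger0_norm; last by rewrite subr_ge0; exact: ler_wln.
rewrite ger0_norm ?subr_ge0//; apply: (le_trans (ln_ratio_le a0 ab)).
by apply: ler_wpM2l; [rewrite subr_ge0 | rewrite lef_pV2 ?posrE].
Qed.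

Lemma isq_ge1 (t : R) : 0 < t -> t <= 1 -> 1 <= isq t.
Proof.
move=> t0 t1; rewrite /isq -[leLHS]invr1 lef_pV2 ?posrE ?sqrtr_gt0//.
by rewrite -sqrtr1 ler_wsqrtr.
Qed.

Lemma ln_weight_le_isq K phi E (t : R) : (0 < K)%N -> log_weight K phi E -> 0 < t < 1 ->
  `|ln (E t)| <= (2 * K%:R + 2) * (isq t + isq `|t - 1|).
Proof.
move=> K0 W t01; have K00 : 0 <= K%:R :> R by [].
  have half psi F (s : R) : log_weight K psi F -> 0 < s <= 1 / 2 ->
    `|ln (F s)| <= (2 * K%:R + 2) * isq s.
    move=> WF s01; apply: (le_trans (ln_weight_abs K0 WF s01)).
    have s0 : 0 < s by case/andP: s01.
    have h1 := @ln_le_isq R s s0; have h2 : 1 <= isq s by apply: isq_ge1; lra.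
    by have : 2 * K%:R * 1 <= 2 * K%:R * isq s by [apply: ler_wpM2l; rewrite ?mulr_ge0]; lra.
  have A0 : 0 <= 2 * K%:R + 2 :> R by rewrite addr_ge0 ?mulr_ge0.
  have [th|th] := leP t (1 / 2).
    apply: (le_trans (half _ _ _ W _)); first by lra.
    by apply: ler_wpM2l => //; rewrite lerDl isq_ge0.
  have -> : `|t - 1| = 1 - t by rewrite distrC ger0_norm; lra.
  have := half _ _ (1 - t) (log_weight_onem W); rewrite /= opprB addrCA subrr addr0 => h.
  apply: (le_trans (h _)); first by lra.
  by apply: ler_wpM2l => //; rewrite lerDr isq_ge0.
Qed.

Lemma density_bounds (f : R * R -> R) (c : R -> R * R) (p : nat) : (0 < p)%N ->
  regular_C2 c -> C_arc p c (f \o c) ->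
  exists B : R, [/\ 0 <= B, lip01 B (density f c) &
    forall t : R, 0 <= t <= 1 -> `|density f c t| <= B].
Proof.
case: p => // p _ rc [cf [df cq]].
have {}cq : {within `[0, 1], continuous (fun t => derive01 (f \o c) t / speed c t)}.
  by case: p cq => [|p] [].
have [L [m [L0 m0 [_ Ls _ Hm _]]]] := regular_bounds rc.
have [S S0 HS] : exists2 S : R, 0 <= S & forall t : R, 0 <= t <= 1 -> speed c t <= S.
  have z01 : 0 <= (0 : R) <= 1 by rewrite lexx ler01.
  exists (speed c 0 + L); first by rewrite addr_ge0// enorm_ge0.
  move=> t t01; have := Ls t 0 t01 z01; rewrite subr0 => h.
  have h' : L * `|t| <= L * 1 by apply: ler_wpM2l => //; rewrite ger0_norm; lra.
  have h2 := ler_norm (speed c t - speed c 0).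
  by rewrite -lerBlDl; apply: (le_trans h2); apply: (le_trans h); rewrite mulr1 in h'.
have [B1 B10 HB1] := bounded01 cf; have [B2 B20 HB2] := bounded01 cq.
(* The derivative in the parameter is the bounded arc-length derivative times the speed. *)
have Lf : lip01 (B2 * S) (f \o c).
  apply: lip01_derive => // t t01; have s0 : 0 < speed c t by apply: lt_le_trans (Hm t t01).
  have := HB2 t t01; rewrite normrM normfV (gtr0_norm s0) ler_pdivrMr// => h.
  by apply: (le_trans h); apply: ler_wpM2l => //; exact: HS.
exists (B1 * L + B2 * S * S + B1 * S); split.
- by rewrite !addr_ge0 ?mulr_ge0.
- move=> t t' t01 t'01; rewrite /density.
  have fB := HB1 t t01; have fL := Lf t t' t01 t'01; have sL := Ls t t' t01 t'01.
  have sS : `|speed c t'| <= S by rewrite ger0_norm ?enorm_ge0// HS.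
  move: fB fL sL sS; rewrite /comp.
  move: (f (c t)) (f (c t')) (speed c t) (speed c t') => u u' v v' uB uL vL vS.
  rewrite -(subrKA (u * v')) -mulrBr -mulrBl.
  apply: (le_trans (ler_normD _ _)); rewrite !normrM -addrA mulrDl; apply: lerD.
    by rewrite -mulrA; apply: ler_pM.
  apply: (@le_trans _ _ (B2 * S * `|t - t'| * S)); first exact: ler_pM.
  by rewrite mulrAC mulrDl lerDl mulr_ge0// mulr_ge0.
move=> t t01; rewrite /density normrM (ger0_norm (enorm_ge0 _)).
apply: (@le_trans _ _ (B1 * S)).
  by apply: ler_pM => //; [exact: enorm_ge0 | exact: HB1 | exact: HS].
by rewrite lerDr addr_ge0 ?mulr_ge0.
Qed.

(** The kernels differ only for |t - y| < eps. If 2 L |t - y| <= m / 2, both arguments stay above m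
    / 2, where ln is Lipschitz, and the cost is of the order of |t - y|. Otherwise eps > m / (4 L)
    is not small and the sizes of the two logarithms suffice; the weight comes from that of ln E. *)
Lemma delta_error (c : R -> R * R) (K : nat) : (0 < K)%N -> regular_C2 c ->
  exists2 C : R, 0 <= C & forall (phi : R -> R) (eps y t : R), 0 <= eps -> 0 <= y <= 1 -> 0 < t < 1 ->
  log_weight K phi (chord_quotient c y) ->
  `|ln (chord_quotient c y t) - delta eps c t y| <= C * eps * (isq t + isq `|t - 1|).
Proof.
move=> K0 rc; have [L [m [L0 m0 [_ Ls _ Hm He]]]] := regular_bounds rc.
have z01 : 0 <= (0 : R) <= 1 by rewrite lexx ler01.
set S := speed c 0 + L.
have HS (t : R) : 0 <= t <= 1 -> speed c t <= S.
  move=> t01; have := Ls t 0 t01 z01; rewrite subr0 => h.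
  have h' : L * `|t| <= L * 1 by apply: ler_wpM2l => //; rewrite ger0_norm; lra.
  have h2 := ler_norm (speed c t - speed c 0).
  by rewrite -lerBlDl; apply: (le_trans h2); apply: (le_trans h); rewrite mulr1 in h'.
have S0 : 0 <= S by rewrite addr_ge0// enorm_ge0.
clearbody S.
pose C := 4 * L / m * (2 * K%:R + 2 + `|ln m| + S + 1).
have C0 : 0 <= C by rewrite mulr_ge0 ?divr_ge0 ?mulr_ge0 ?addr_ge0 ?mulr_ge0// ltW.
exists C => // phi eps y t eps0 y01 t01 W.
have t01' : 0 <= t <= 1 by lra.
set w := isq t + isq `|t - 1|.
have w1 : 1 <= w.
  rewrite /w -[leLHS]addr0; apply: lerD; last exact: isq_ge0.
  by apply: isq_ge1; lra.
have w0 : 0 <= w by exact: le_trans ler01 w1.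
have CE : C = 4 * L / m * (2 * K%:R + 2 + `|ln m| + S + 1) by [].
have wE : w = isq t + isq `|t - 1| by [].
clearbody C w.
have rhs0 : 0 <= C * eps * w by rewrite !mulr_ge0.
rewrite /delta; have [ty|ty] := eqVneq t y.
  by rewrite /= chord_quotientE ty eqxx subrr normr0.
rewrite /=; have [te|et] := ltP; last first.
  by rewrite chord_quotientE (negbTE ty) subrr normr0.
have Ey : chord_quotient c y y = speed c y by rewrite chord_quotientE eqxx.
have dE : `|chord_quotient c y t - speed c t| <= 2 * L * `|t - y|.
  have h1 := He y y01 t y t01' y01; have h2 := Ls y t y01 t01'.
  rewrite Ey in h1; rewrite (distrC y t) in h2.
  rewrite -(subrKA (speed c y)); apply: (le_trans (ler_normD _ _)).
  by apply: (le_trans (lerD h1 h2)); rewrite -mulrA mulr_natl mulr2n.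
have st := Hm t t01'; have Vs := HS t t01'.
have h1 := ln_weight_le_isq K0 W t01; rewrite -wE in h1.
have A0 : 0 <= 2 * K%:R + 2 :> R by rewrite addr_ge0 ?mulr_ge0.
clear -m0 L0 S0 A0 eps0 w1 w0 CE rhs0 te dE st Vs h1; move: dE te st Vs h1 CE A0.
set q : R := chord_quotient c y t; set v : R := speed c t; set d : R := `|t - y|.
set A : R := 2 * K%:R + 2.
clearbody q v d A; clear c y t K => dE te st Vs h1 CE A0.
have A1 : 1 <= A + `|ln m| + S + 1 by rewrite lerDr !addr_ge0.
have [near|far] := leP (2 * L * d) (m / 2).
  have Em : m / 2 <= q by move: dE; rewrite ler_norml; lra.
  apply: (le_trans (@ln_dist_le (m / 2) _ _ _ Em _)); [by lra|by lra|].
  rewrite ler_pdivrMr; last by lra.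
  apply: (le_trans dE).
  have -> : C * eps * w * (m / 2) = 2 * L * (eps * (w * (A + `|ln m| + S + 1))).
    by rewrite CE; field; lra.
  apply: ler_wpM2l; first by rewrite mulr_ge0.
  apply: (le_trans (ltW te)); rewrite ler_peMr//.
  by rewrite -[leLHS]mulr1; apply: ler_pM.
have e1 : 1 <= 4 * L / m * eps.
  rewrite mulrAC ler_pdivlMr// mul1r; have : L * d <= L * eps by apply: ler_wpM2l => //; exact: ltW.
  lra.
have s0 : 0 < v by lra.
have h2 : `|ln v| <= `|ln m| + S.
  have h4 := ler_wln m0 st; have h5 := ln_le_subr1 s0.
  have h3 := ler_norm (- ln m); rewrite normrN in h3; have h6 := normr_ge0 (ln m).
  by rewrite ler_norml; lra.
apply: (le_trans (ler_normB _ _)).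
apply: (@le_trans _ _ ((A + `|ln m| + S + 1) * w)).
  have : (`|ln m| + S + 1) * 1 <= (`|ln m| + S + 1) * w.
    by apply: ler_wpM2l => //; rewrite !addr_ge0.
  lra.
rewrite CE (_ : _ * _ * eps * w = (4 * L / m * eps) * ((A + `|ln m| + S + 1) * w)); last by ring.
by rewrite ler_peMl// mulr_ge0// !addr_ge0.
Qed.

End ArcErrors.

(** * Error constants for a pair of arcs *)

Section ErrorBounds.
Context {R : realType} (n : nat) (D : set (R * R)) (P : 'I_n -> R * R) (chi : 'I_n -> R).
Context (st : 'I_n -> R -> R * R) (f : R * R -> R) (p : nat).
Hypothesis dom : corner_domain D P chi st.
Hypothesis p0 : (0 < p)%N.
Hypothesis fC : C_boundary st p f.
Local Notation mu := (@lebesgue_measure R).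
Local Notation rint D f := (mu.-integrable D (EFin \o f)).

(** By the convention ln 0 = 0, the splitting of ln |st l y - st l t| into ln |t - y| and the
    logarithm of a chord quotient may fail at t = y. Measurability of g comes from that of h. *)
Lemma eq_Rintegral01_but1 (g h : R -> R) (y : R) : rint `[0, 1] h ->
  (forall t : R, 0 < t < 1 -> t != y -> g t = h t) ->
  \int[mu]_(t in `[0, 1]) g t = \int[mu]_(t in `[0, 1]) h t.
Proof.
move=> hi gh.
have mh : measurable_fun (`]0, 1[ : set R) h.
  have /measurable_int/measurable_EFinP := hi.
  by apply: measurable_funS => //; apply: subset_itv; rewrite bnd_simp.
have mD : measurable ((`]0, 1[ : set R) `\ y) by exact: measurableD.
have eq t : ((`]0, 1[ : set R) `\ y) t -> g t = h t.
  by move=> [/= + /eqP ty]; rewrite in_itv/= => t01; exact: gh.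
have mg' : measurable_fun ((`]0, 1[ : set R) `\ y) g.
  apply: (eq_measurable_fun h); first by move=> t; rewrite inE => /eq ->.
  by apply: measurable_funS mh => //; exact: subDsetl.
have mg : measurable_fun (`]0, 1[ : set R) g.
  apply: (@measurable_funS _ _ _ _ (((`]0, 1[ : set R) `\ y) `|` [set y])).
  - exact: measurableU.
  - by move=> t t01 /=; have [->|/eqP ty] := eqVneq t y; [right|left].
  - by apply/measurable_funU => //; split => //; exact: measurable_fun_set1.
congr fine; rewrite [LHS](@integral_itv_bndoo _ 0 1 _ true false); last exact/measurable_EFinP.
rewrite [RHS](@integral_itv_bndoo _ 0 1 _ true false); last exact/measurable_EFinP.
rewrite -(integral_setD1 (r := y)) //; last exact/measurable_EFinP.
rewrite -[RHS](integral_setD1 (r := y)) //; last first.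
  by apply/measurable_EFinP; apply: measurable_funS mh => //; exact: subDsetl.
by apply: eq_integral => t; rewrite inE => /eq ->.
Qed.

(** By [curve_separation] the distance to [st l y] satisfies [log_weight] with a constant that does
    not depend on y. *)
Lemma off_diagonal_error (l k : 'I_n) : k != l -> exists2 C : R, 0 <= C &
  forall M (x lam : 'I_M -> R) (y : R), (0 < M)%N -> gauss_rule x lam -> 0 <= y <= 1 ->
  `|\int[mu]_(t in `[0, 1]) (f (st k t) * ln (enorm (st l y - st k t)) * speed (st k) t)
    - \sum_h lam h * density f (st k) (x h) * ln (enorm (st l y - st k (x h)))| <= C / M%:R.
Proof.
move=> kl; have [_ /(_ k) fk] := fC.
have [B [B0 LB HB]] := density_bounds p0 (arc_regular dom k) fk.
have [L [_ [L0 _ [Lc _ _ _ _]]]] := regular_bounds (arc_regular dom k).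
have [L' [_ [L'0 _ [L'c _ _ _ _]]]] := regular_bounds (arc_regular dom l).
have [K1 HK1] := curve_separation dom l k.
have z01 : 0 <= (0 : R) <= 1 by rewrite lexx ler01.
pose S := enorm (st l 0 - st k 0) + L' + L.
have S0 : 0 <= S by rewrite !addr_ge0// enorm_ge0.
have HS (y t : R) : 0 <= y <= 1 -> 0 <= t <= 1 -> enorm (st l y - st k t) <= S.
  have i01 (r : R) : 0 <= r <= 1 -> `|r| <= 1 by move=> r01; rewrite ger0_norm; lra.
  move=> y01 t01; rewrite (_ : _ - _ = (st l 0 - st k 0) + (st l y - st l 0) + (st k 0 - st k t)); last first.
    by rewrite (addrAC (st l 0)) [st l 0 + _]addrC subrK addrA subrK.
  apply: (le_trans (enorm_triangle _ _)); apply: lerD.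
    apply: (le_trans (enorm_triangle _ _)); rewrite lerD2l.
    by apply: (le_trans (L'c _ _ y01 z01)); rewrite subr0 ler_piMr// i01.
  by apply: (le_trans (Lc _ _ z01 t01)); rewrite sub0r normrN ler_piMr// i01.
pose K := (Num.bound B + Num.bound L + Num.bound S + K1).+1.
have [BK LK SK] : [/\ B <= K%:R, L <= K%:R & S <= K%:R].
  by split; [apply: le_trans (ltW (archi_boundP B0)) _|apply: le_trans (ltW (archi_boundP L0)) _
    |apply: le_trans (ltW (archi_boundP S0)) _]; rewrite ler_nat /K; clear; lia.
have K1K : K1%:R <= K%:R :> R by rewrite ler_nat leqW// leq_addl.
have [C C0 H] := @quad_error_ln R K (ltn0Sn _).
exists C => // M x lam y M0 g y01.
have W : log_weight K (density f (st k)) (fun t => enorm (st l y - st k t)).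
  split=> [t t' t01 t'01|t t01|t t' t01 t'01|t t01|t t01].
  - by apply: (le_trans (LB _ _ t01 t'01)); exact: ler_wpM2r.
  - exact: le_trans (HB t t01) _.
  - apply: (le_trans (enorm_dist _ _)); rewrite opprB addrC addrA subrK distrC.
    by apply: (le_trans (Lc _ _ t'01 t01)); exact: ler_wpM2r.
  - by apply: le_trans SK; exact: HS.
  - have := HK1 y t y01; rewrite /separation_weight (negbTE kl) mul1r => h.
    apply: (le_trans (h _)); first by lra.
    by apply: ler_wpM2r => //; exact: enorm_ge0.
have [_] := H M x lam _ _ M0 g W.
congr (`| _ - _ | <= _); last by apply: eq_bigr => h _; rewrite mulrA.
by apply: eq_Rintegral => t _; rewrite /density mulrAC.
Qed.

Lemma diagonal_error (l : 'I_n) (leg : nat -> {poly R}) : orthonormal_legendre leg ->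
  exists2 C : R, 0 <= C &
  forall M (x lam : 'I_M -> R) (y eps : R), (0 < M)%N -> gauss_rule x lam ->
  0 <= y <= 1 -> 0 <= eps <= M%:R^-1 ->
  `|\int[mu]_(t in `[0, 1]) (f (st l t) * ln (enorm (st l y - st l t)) * speed (st l) t)
    - \sum_h lam h * density f (st l) (x h) *
      (\sum_(nu < M) log_moment leg nu y * (leg nu).[x h] + delta eps (st l) (x h) y)| <= C / M%:R.
Proof.
move=> legP; have [_ /(_ l) fl] := fC; have rl := arc_regular dom l.
have [B [B0 LB HB]] := density_bounds p0 rl fl.
have [L [m [L0 m0 [_ Ls _ Hm He]]]] := regular_bounds rl.
have [K1 HK1] := curve_separation dom l l.
have z01 : 0 <= (0 : R) <= 1 by rewrite lexx ler01.
pose S := speed (st l) 0 + L + L.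
have S0 : 0 <= S by rewrite !addr_ge0// enorm_ge0.
have d1 (r s : R) : 0 <= r <= 1 -> 0 <= s <= 1 -> L * `|r - s| <= L.
  by move=> r01 s01; rewrite ler_piMr//; by have := dist_le1 s01 r01; lra.
have HS (y t : R) : 0 <= y <= 1 -> 0 <= t <= 1 -> chord_quotient (st l) y t <= S.
  move=> y01 t01; have Ey : chord_quotient (st l) y y = speed (st l) y.
    by rewrite chord_quotientE eqxx.
  have h1 := le_trans (ler_norm _) (le_trans (He y y01 t y t01 y01) (d1 t y t01 y01)).
  have h2 := le_trans (ler_norm _) (le_trans (Ls y 0 y01 z01) (d1 y 0 y01 z01)).
  rewrite Ey lerBlDl in h1; rewrite lerBlDl in h2.
  by apply: (le_trans h1); rewrite lerD2r.
have m1 : 0 <= m^-1 by rewrite invr_ge0 ltW.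
pose K := (Num.bound B + Num.bound L + Num.bound S + Num.bound m^-1 + K1).+1.
have [BK LK SK mK] : [/\ B <= K%:R, L <= K%:R, S <= K%:R & m^-1 <= K%:R].
  by split; [apply: le_trans (ltW (archi_boundP B0)) _|apply: le_trans (ltW (archi_boundP L0)) _
    |apply: le_trans (ltW (archi_boundP S0)) _|apply: le_trans (ltW (archi_boundP m1)) _];
    rewrite ler_nat /K; clear; lia.
have K1K : K1%:R <= K%:R :> R by rewrite ler_nat leqW// leq_addl.
have K0 : (0 < K)%N by [].
clearbody K S.
have [C1 C10 H1] := @quad_error_ln R K K0.
have [C2 C20 H2] := @quad_error_product R.
have [C3 C30 H3] := delta_error K0 rl.
exists (C2 * B + C1 + K%:R * (C3 * 60)); first by rewrite !addr_ge0 ?mulr_ge0.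
move=> M x lam y eps M0 g y01 /andP[eps0 epsM].
set phi := density f (st l); set E := chord_quotient (st l) y.
have W : log_weight K phi E.
  split=> [t t' t01 t'01|t t01|t t' t01 t'01|t t01|t t01].
  - by apply: (le_trans (LB _ _ t01 t'01)); exact: ler_wpM2r.
  - exact: le_trans (HB t t01) _.
  - by apply: (le_trans (He _ y01 _ _ t01 t'01)); exact: ler_wpM2r.
  - by apply: le_trans SK; exact: HS.
  - have t01' : 0 <= t <= 1 by case/andP: t01 => /ltW-> /ltW->.
    rewrite /E chord_quotientE; have [ty|ty] := eqVneq t y.
      (* At t = y the separation says nothing; there the chord quotient is the speed, which is at
         least m. *)
      apply: (@le_trans _ _ (m^-1 * m)); first by rewrite mulVf ?gt_eqF//; nra.
      apply: ler_pM => //; first exact: ltW.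
      exact: Hm.
    have d0 : 0 < `|t - y| by rewrite normr_gt0 subr_eq0.
    have := HK1 y t y01 t01'; rewrite /separation_weight eqxx distrC => h.
    rewrite mulrA ler_pdivlMr// mulrC; apply: (le_trans h).
    by apply: ler_wpM2r => //; exact: enorm_ge0.
have [iE eE] := H1 M x lam _ _ M0 g W.
(* [quad_error_product] takes a function continuous on the whole line, so the density is extended by
   retraction. *)
pose phi' t := phi (clamp 0 t).
have phiE t : 0 <= t <= 1 -> phi' t = phi t by move=> t01; rewrite /phi' clamp0_id.
have cphi : continuous phi' by exact: continuous_clamp_lip01 B0 LB.
have Lphi (t t' : R) : 0 <= t <= 1 -> 0 <= t' <= 1 -> `|phi' t - phi' t'| <= B * `|t - t'|.
  by move=> t01 t'01; rewrite !phiE//; exact: LB.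
have eP := H2 M x lam leg phi' B y M0 B0 g legP y01 cphi Lphi.
have iP : rint `[0, 1] (fun t => phi' t * ln `|t - y|).
  by apply: rintegrableM => //; exact: integrable_ln_dist.
have xh h : 0 < x h < 1 by have [] := g.
have xh' h : 0 <= x h <= 1 by case/andP: (xh h) => /ltW-> /ltW->.
have -> : \int[mu]_(t in `[0, 1]) (f (st l t) * ln (enorm (st l y - st l t)) * speed (st l) t) =
    \int[mu]_(t in `[0, 1]) (phi' t * ln `|t - y|) + \int[mu]_(t in `[0, 1]) (phi t * ln (E t)).
  rewrite -RintegralD//; apply: (@eq_Rintegral01_but1 _ _ y); first exact: rintegrableD.
  move=> t t01 ty; have d0 : 0 < `|t - y| by rewrite normr_gt0 subr_eq0.
  have E0 := log_weight_pos W t01.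
  rewrite phiE; last by case/andP: t01 => /ltW-> /ltW->.
  rewrite -mulrDr -lnM ?posrE// mulrC mulrCA mulrA /E chord_quotientE (negbTE ty).
  by rewrite mulrC [`|_| * _]mulrC divfK ?gt_eqF// /phi /density mulrC [_ * speed _ _]mulrC.
(* The rule with the exact kernel, corrected by the replacement of ln E by [delta]. *)
have -> : \sum_h lam h * phi (x h) *
      (\sum_(nu < M) log_moment leg nu y * (leg nu).[x h] + delta eps (st l) (x h) y) =
    \sum_h lam h * phi' (x h) * (\sum_(nu < M) log_moment leg nu y * (leg nu).[x h]) +
    \sum_h lam h * (phi (x h) * ln (E (x h))) -
    \sum_h lam h * (phi (x h) * (ln (E (x h)) - delta eps (st l) (x h) y)).
  rewrite -big_split -sumrB; apply: eq_bigr => h _.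
  by rewrite /= phiE//; ring.
have eD : `|\sum_h lam h * (phi (x h) * (ln (E (x h)) - delta eps (st l) (x h) y))|
    <= K%:R * (C3 * 60) / M%:R.
  apply: (le_trans (ler_norm_sum _ _ _)).
  apply: (@le_trans _ _ (\sum_h K%:R * (C3 * eps) * (lam h * (isq (x h) + isq `|x h - 1|)))).
    apply: ler_sum => h _; have lam0 : 0 <= lam h by have [] := g.
    rewrite normrM (ger0_norm lam0) mulrCA; apply: ler_wpM2l => //.
    rewrite normrM -[leRHS]mulrA; apply: ler_pM => //; first by have [_ + _ _ _] := W; exact.
    by apply: (H3 phi).
  rewrite -mulr_sumr; apply: (@le_trans _ _ (K%:R * (C3 * eps) * 60)).
    by apply: ler_wpM2l; [rewrite !mulr_ge0 | exact: gauss_isq_sum].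
  rewrite -!mulrA; apply: ler_wpM2l => //; apply: ler_wpM2l => //.
  by rewrite mulrC; apply: ler_wpM2l.
rewrite -/phi; move: eP eE eD.
set a1 := Rintegral _ _ _; set a2 := Rintegral _ _ _.
set b1 := \sum_h _; set b2 := \sum_h _; set b3 := \sum_h _ => eP eE eD.
rewrite (_ : _ - _ = (a1 - b1) + (a2 - b2) + b3); last by rewrite opprB opprD; ring.
rewrite !mulrDl; apply: (le_trans (ler_normD _ _)); apply: lerD => //.
by apply: (le_trans (ler_normD _ _)); exact: lerD.
Qed.

End ErrorBounds.

Theorem theorem3p5 (R : realType) (n : nat) (D : set (R * R))
    (P : 'I_n -> R * R) (chi : 'I_n -> R) (st : 'I_n -> R -> R * R)
    (sg : 'I_(3 * n) -> R -> R * R) (p : nat) (f : R * R -> R)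
    (leg : nat -> {poly R}) (x lam : forall M : nat, 'I_M -> R)
    (ell : 'I_(3 * n) -> R -> 'I_n) (si : 'I_(3 * n) -> R -> R) :
  (0 < n)%N ->
  corner_domain D P chi st ->
  section_decomposition st sg ->
  (0 < p)%N ->
  C_boundary st p f ->
  boundary_integral st f = 0 ->
  orthonormal_legendre leg ->
  (forall M : nat, (0 < M)%N -> gauss_legendre leg (x M) (lam M)) ->
  (forall (i : 'I_(3 * n)) (s : R), s \in `[0, 1] ->
     si i s \in `[0, 1] /\ sg i s = st (ell i s) (si i s)) ->
  exists2 C : R, 0 < C &
    forall (M : nat) (eps : R),
      (0 < M)%N -> 0 <= eps -> eps <= M%:R^-1 ->
      forall s : R, s \in `[0, 1] ->
        supnorm (fun i : 'I_(3 * n) =>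
          gbar st sg f i s
          - gbar_approx st f leg eps (x M) (lam M) ell si i s)
        <= C / M%:R.
Proof.
move=> n0 dom sec p0 fC f0 legP gl siP.
(* An informative existence, so that the constants form a function of the pair of arcs. *)
have err (l k : 'I_n) : {C : R | 0 <= C /\ forall M (eps y : R), (0 < M)%N ->
    0 <= eps <= M%:R^-1 -> 0 <= y <= 1 ->
    `|\int[lebesgue_measure]_(t in `[0, 1])
        (f (st k t) * ln (enorm (st l y - st k t)) * speed (st k) t)
      - (if k != l then \sum_h lam M h * density f (st k) (x M h) *
           ln (enorm (st l y - st k (x M h)))
         else \sum_h lam M h * density f (st l) (x M h) *
           (\sum_(nu < M) log_moment leg nu y * (leg nu).[x M h]
            + delta eps (st l) (x M h) y))| <= C / M%:R}.
  apply: cid; have [->|kl] := eqVneq k l.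
    have [C C0 H] := diagonal_error dom p0 fC l legP.
    exists C; split=> // M eps y M0 epsM y01.
    by apply: H => //; exact: (gauss_legendre_rule legP (gl M M0)).
  have [C C0 H] := off_diagonal_error dom p0 fC kl.
  exists C; split=> // M eps y M0 epsM y01.
  by apply: H => //; exact: (gauss_legendre_rule legP (gl M M0)).
pose c l k := sval (err l k).
have c0 l k : 0 <= c l k by have [] := svalP (err l k).
(* The summand 1 makes C positive even if all constants vanish. *)
pose C := 1 + \sum_l \sum_k c l k.
have CS0 : 0 <= \sum_l \sum_k c l k.
  by apply: sumr_ge0 => l _; apply: sumr_ge0.
exists C; first by rewrite ltr_pwDl.
move=> M eps M0 eps0 epsM s s01; rewrite /supnorm.
have CM : \sum_l \sum_k c l k <= C by rewrite /C lerDr.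
apply/bigmax_leP; split; first by rewrite divr_ge0// (le_trans CS0).
move=> i _; have [si01 sgE] := siP i s s01; move: si01; rewrite in_itv/= => si01.
(* The arc through the point changes with i and s, so the constant sums over every l. *)
set l := ell i s; apply: (@le_trans _ _ ((\sum_k c l k) / M%:R)); last first.
  apply: ler_wpM2r => //; apply: le_trans CM.
  by rewrite [leRHS](bigD1 l)//= lerDl sumr_ge0// => j _; exact: sumr_ge0.
rewrite mulr_suml /gbar /log_potential /boundary_integral /gbar_approx sgE -/l.
set y := si i s in si01 *.
have split_sum (I Q : 'I_n -> R) (q : R) : \sum_k I k - (\sum_(k | k != l) Q k + q) =
    \sum_k (I k - if k != l then Q k else q).
  rewrite sumrB [in RHS](bigD1 l (F := fun k => if k != l then _ else _))//= eqxx/=.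
  by rewrite [in RHS]addrC; congr (_ - (_ + _)); apply: eq_bigr => k ->.
rewrite split_sum; apply: (le_trans (ler_norm_sum _ _ _)); apply: ler_sum => k _.
have [_] := svalP (err l k); apply => //; exact/andP.
Qed.
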